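(* Let $n\ge1$ and let $A=\{i_1<\dots<i_k\}$ be a non-empty subset of $\{1,\dots,n\}$, $\underline i=(i_1,\dots,i_k)$. Regard the Askey--Wilson algebra $\mathrm{AW}(n)\subset U^{\otimes n}$ inside the braided tensor product $(U^{\mathrm{lf}})^{\tilde\otimes n}$ via the injective unbraiding morphism $\gamma_n:(U^{\mathrm{lf}})^{\tilde\otimes n}\to U^{\otimes n}$. Then the generator $\Lambda_A$ is given in $(U^{\mathrm{lf}})^{\tilde\otimes n}$ by $\underline\Delta^{(k-1)}(\Lambda)_{\underline i}$, that is, $$\gamma_n\big(\underline\Delta^{(k-1)}(\Lambda)_{\underline i}\big)=\Lambda_A ,$$ where $\Lambda$ is the quantum Casimir, $\underline\Delta$ is the braided coproduct, and the subscript $\underline i$ means that the $j$-th tensor factor is placed in position $i_j$ and $1$ is placed in all remaining positions.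
   Context: **Quantum group.** $U=\mathcal{U}_q(\mathfrak{sl}_2)$ is the $\mathbb{C}(q)$-algebra generated by $K^{\pm1},E,F$ with $KE=q^2EK$, $KF=q^{-2}FK$, $[E,F]=\frac{K-K^{-1}}{q-q^{-1}}$; coproduct $\Delta(K)=K\otimes K$, $\Delta(E)=E\otimes K+1\otimes E$, $\Delta(F)=F\otimes 1+K^{-1}\otimes F$; antipode $S(K)=K^{-1}$, $S(E)=-EK^{-1}$, $S(F)=-KF$. It is $\mathbb Z$-graded by $|E|=1,|F|=-1,|K|=0$. Casimir: $\Lambda=(q-q^{-1})^2FE+qK+q^{-1}K^{-1}$. Sweedler notation $\Delta(x)=\sum x_{(1)}\otimes x_{(2)}$ (homogeneous components). **Locally finite part.** $h\rhd x=\sum h_{(1)}xS(h_{(2)})$ is the left adjoint action; $U^{\mathrm{lf}}=\{x: \dim(U\rhd x)<\infty\}$, which is the subalgebra generated by $E,FK,K,\Lambda$, and $\Delta(U^{\mathrm{lf}})\subset U\otimes U^{\mathrm{lf}}$. $U$ acts on tensor powers of $U^{\mathrm{lf}}$ through iterated coproducts, also written $\rhd$. **Quasi-$R$-matrix.** $\Theta=\sum_{i\ge0}u_i\otimes v_i$ with $u_i\otimes v_i=q^{i(i-1)/2}\frac{(q-q^{-1})^i}{[i]!}E^i\otimes F^i$, $[j]=\frac{q^j-q^{-j}}{q-q^{-1}}$, $[i]!=[1]\cdots[i]$. **Braided tensor product.** $(U^{\mathrm{lf}})^{\tilde\otimes n}$ is the vector space $(U^{\mathrm{lf}})^{\otimes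 n}$ with product defined inductively, for homogeneous $g,x\in U^{\mathrm{lf}}$ and $h,y\in (U^{\mathrm{lf}})^{\tilde\otimes(n-1)}$, by $(g\otimes h)\cdot(x\otimes y)=\sum_{i\ge0}q^{2(|h|+i)(|x|-i)}g(v_i\rhd x)\otimes(u_i\rhd h)\cdot y$. **Braided coproduct.** $\underline\Delta(x)=\sum_{i\ge0}x_{(1)}S(K^{i+|x_{(2)}|}v_i)\otimes u_i\rhd x_{(2)}$, a map $U^{\mathrm{lf}}\to U^{\mathrm{lf}}\otimes U^{\mathrm{lf}}$; $\underline\Delta^{(0)}=\mathrm{id}$, $\underline\Delta^{(m+1)}=(\mathrm{id}\otimes\underline\Delta^{(m)})\circ\underline\Delta$. **Unbraiding map.** $\varphi_n:(U^{\mathrm{lf}})^{\tilde\otimes n}\to U\otimes(U^{\mathrm{lf}})^{\tilde\otimes(n-1)}$, $\varphi_n(a\otimes b)=\sum_{i\ge0}aK^{i+|b|}v_i\otimes u_i\rhd b$ for homogeneous $a\in U^{\mathrm{lf}}$, $b\in(U^{\mathrm{lf}})^{\tilde\otimes(n-1)}$. $\gamma_1$ is the inclusion $U^{\mathrm{lf}}\subset U$ and $\gamma_{n+1}=(\mathrm{id}\otimes\gamma_n)\circ\varphi_{n+1}$. **Askey--Wilson generators.** $\tau_L:U^{\mathrm{lf}}\to U\otimes U^{\mathrm{lf}}$ is the algebra morphism $E\mapsto K\otimes E$, $FK\mapsto K^{-1}\otimes FK-qF\otimes\Lambda+q(q+q^{-1})F\otimes K-q^{-1}(q-q^{-1})^2F^2K\otimes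 E$, $K\mapsto1\otimes K-q^{-1}(q-q^{-1})^2FK\otimes E$, $\Lambda\mapsto1\otimes\Lambda$. Then $$\Lambda_A=\Big(\big(\mathrm{id}^{\otimes(i_k-2)}\otimes\alpha_{i_k-1}\big)\circ\cdots\circ(\mathrm{id}\otimes\alpha_2)\circ\alpha_1(\Lambda)\Big)\otimes1^{\otimes(n-i_k)},$$ with $\alpha_i=\Delta$ if $i\in A$ and $\alpha_i=\tau_L$ otherwise; $\mathrm{AW}(n)\subset U^{\otimes n}$ is the subalgebra generated by all $\Lambda_A$. *)

(* Defs.v *)
From HB Require Import structures.
From mathcomp Require Import all_boot all_order all_algebra.
From mathcomp Require Import boolp classical_sets reals.
From mathcomp Require Import complex ring.

Set Implicit Arguments.
Unset Strict Implicit.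
Unset Printing Implicit Defensive.

Import GRing.Theory.

Local Open Scope ring_scope.
Local Open Scope quotient_scope.

(* "Extend linearly": a linear map whose graph contains the prescribed pairs G.
   It is the unique such map when the pairs of G are consistent and their first
   components span V; when the pairs are inconsistent it is 0. *)
Definition lin_of (k : fieldType) (V W : lmodType k) (G : V -> W -> Prop) :
    {linear V -> W} :=
  if pselect (exists f : {linear V -> W}, forall x y, G x y -> f x = y)
    is left ex then projT1 (cid ex) else \0.

(* s_0 + s_1 + ... = v, where only finitely many terms are nonzero. *)
Definition sums_to (V : zmodType) (s : nat -> V) (v : V) : Prop :=
  exists2 N, (forall i, (N <= i)%N -> s i = 0) & v = \sum_(i < N) s i.

Definition fin_dim (k : fieldType) (V : lmodType k) (P : V -> Prop) : Prop :=
  exists b : seq V, forall v, P v ->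
    exists c : nat -> k, v = \sum_(i < size b) c i *: b`_i.

Section Separation.
Variables (k : fieldType) (V : lmodType k).

Lemma functional_neq0 (v : V) : v != 0 ->
  exists f : {linear V -> k^o}, f v = 1.
Proof.
move=> v0.
pose cl (A : set V) := forall (c : k) x y, A x -> A y -> A (c *: x + y).
pose P (A : set V) := cl A /\ ~ A v.
have [F FP Ftot|A [[clA Av] Amax]] := @Zorn_bigcup V P.
  split=> [c x y [X FX Xx] [Y FY Yy]|[X FX /(proj2 (FP _ FX))//]].
  have [XY|YX] := Ftot _ _ FX FY.
    by exists Y => //; apply: (proj1 (FP _ FY)) => //; exact: XY.
  by exists X => //; apply: (proj1 (FP _ FX)) => //; exact: YX.
have A0 : A 0.
  apply: contrapT => nA0.
  have Ae x : ~ A x.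
    move=> Ax; apply: nA0; have := clA (-1) x x Ax Ax.
    by rewrite scaleN1r addNr.
  apply: (Amax [set 0]%classic); last first.
    split=> [c x y /= -> ->|/= /eqP]; first by rewrite scaler0 addr0.
    by rewrite (negPf v0).
  by split=> [x /Ae//|/(_ 0 erefl)].
have AD x y : A x -> A y -> A (x + y).
  by move=> Ax Ay; rewrite -[x]scale1r; apply: clA.
have AZ c x : A x -> A (c *: x).
  by move=> Ax; rewrite -[c *: x]addr0; apply: clA.
have ex w : exists c : k, A (w - c *: v).
  have [Aw|nAw] := pselect (A w); first by exists 0; rewrite scale0r subr0.
  pose B := [set x | exists a c, A a /\ x = a + c *: w]%classic.
  have : ~ P B.
    apply: Amax; split=> [x Ax|/(_ w) Bw].
      by exists x, 0; rewrite scale0r addr0.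
    by apply: nAw; apply: Bw; exists 0, 1; rewrite scale1r add0r.
  move=> nPB; have [a [c [Aa ev]]] : B v.
    apply: contrapT => nB; apply: nPB; split=> // e x y [a [c [Aa ->]]].
    move=> [a' [c' [Aa' ->]]]; exists (e *: a + a'), (e * c + c').
    split; first exact: clA.
    by rewrite scalerDr scalerDl scalerA addrACA.
  have c0 : c != 0.
    apply/eqP => c0; apply: Av; rewrite ev c0 scale0r addr0; exact: Aa.
  exists c^-1; have -> : w - c^-1 *: v = - c^-1 *: a.
    rewrite ev scalerDr scalerA mulVf // scale1r opprD addrCA subrr addr0.
    by rewrite scaleNr.
  exact: AZ.
have uniq c : A (c *: v) -> c = 0.
  move=> Acv; apply: contrapT => /eqP c0; apply: Av.
  by rewrite -[v]scale1r -(mulVf c0) -scalerA; apply: AZ.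
pose f w : k^o := projT1 (cid (ex w)).
have fP w : A (w - f w *: v) by rewrite /f; case: cid.
have fE w c : A (w - c *: v) -> f w = c.
  move=> Aw; apply/eqP; rewrite -subr_eq0; apply/eqP; apply: uniq.
  have := clA (-1) _ _ (fP w) Aw.
  by rewrite scaleN1r opprB addrA subrK -scalerBl.
have flin : linear f.
  move=> c x y; apply: fE; have := clA c _ _ (fP x) (fP y).
  rewrite scalerBr scalerA addrACA -opprD -scalerDl.
  by [].
pose lf := GRing.isLinear.Build _ _ _ _ f flin.
pose g : {linear V -> k^o} := HB.pack f lf.
by exists g; apply: (@fE v 1); rewrite scale1r subrr.
Qed.

End Separation.

Section Tensor.
Variables (k : fieldType) (V W : lmodType k).

Definition bilin (X : lmodType k) (f : V -> W -> X) : Prop :=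
  (forall w, linear (f^~ w)) /\ (forall v, linear (f v)).

Definition tsum (X : lmodType k) (f : V -> W -> X) (s : seq (V * W)) : X :=
  \sum_(p <- s) f p.1 p.2.

(* Formal sums of pairs, modulo having the same image under every bilinear map. *)
Definition teq (s t : seq (V * W)) : bool :=
  `[< forall (X : lmodType k) (f : V -> W -> X), bilin f ->
        tsum f s = tsum f t >].

Lemma teq_refl : reflexive teq. Proof. by move=> s; apply/asboolP. Qed.
Lemma teq_sym : symmetric teq.
Proof.
by move=> s t; apply/asboolP/asboolP => H X f Hf; rewrite (H X f Hf).
Qed.
Lemma teq_trans : transitive teq.
Proof.
move=> t s u /asboolP H1 /asboolP H2; apply/asboolP => X f Hf.
by rewrite (H1 X f Hf) (H2 X f Hf).
Qed.
Canonical teq_equiv := EquivRel teq teq_refl teq_sym teq_trans.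

Definition tens : Type := {eq_quot teq}.
HB.instance Definition _ := Choice.on tens.
HB.instance Definition _ := EqQuotient.on tens.

(* f x_(1) x_(2), summed over an expression x = \sum x_(1) (x) x_(2). *)
Definition tlift (X : lmodType k) (f : V -> W -> X) (x : tens) : X :=
  tsum f (repr x).

Lemma tlift_pi (X : lmodType k) (f : V -> W -> X) s : bilin f ->
  tlift f (\pi_tens s) = tsum f s.
Proof.
move=> Hf; rewrite /tlift; suff /eqquotP/asboolP : repr (\pi_tens s) = s %[mod tens] by apply.
by rewrite reprK.
Qed.

Lemma tens_ext (x y : tens) :
  (forall (X : lmodType k) (f : V -> W -> X), bilin f -> tlift f x = tlift f y) -> x = y.
Proof.
move=> H; rewrite -[x]reprK -[y]reprK; apply/eqquotP/asboolP => X f Hf.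
exact: H.
Qed.

Definition tpure (v : V) (w : W) : tens := \pi_tens [:: (v, w)].
Definition tzero : tens := \pi_tens [::].
Definition tadd (x y : tens) : tens := \pi_tens (repr x ++ repr y).
Definition tscale (c : k) (x : tens) : tens :=
  \pi_tens [seq (c *: p.1, p.2) | p <- repr x].
Definition topp : tens -> tens := tscale (-1).

Lemma bilinZl (X : lmodType k) (f : V -> W -> X) c v w : bilin f -> f (c *: v) w = c *: f v w.
Proof.
case=> Hf _; have f0 : f 0 w = 0.
  by have /= := Hf w (-1) 0 0; rewrite scaler0 addr0 scaleN1r addNr.
by have /= := Hf w c v 0; rewrite !addr0 f0 addr0.
Qed.

Lemma bilinZr (X : lmodType k) (f : V -> W -> X) c v w : bilin f -> f v (c *: w) = c *: f v w.
Proof.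
case=> _ Hf; have f0 : f v 0 = 0.
  by have /= := Hf v (-1) 0 0; rewrite scaler0 addr0 scaleN1r addNr.
by have := Hf v c w 0; rewrite !addr0 f0 addr0.
Qed.

Section Val.
Variables (X : lmodType k) (f : V -> W -> X) (Hf : bilin f).
Lemma tlift_pure v w : tlift f (tpure v w) = f v w.
Proof. by rewrite tlift_pi // /tsum big_seq1. Qed.
Lemma tlift0 : tlift f tzero = 0.
Proof. by rewrite tlift_pi // /tsum big_nil. Qed.
Lemma tliftD x y : tlift f (tadd x y) = tlift f x + tlift f y.
Proof. by rewrite tlift_pi // /tsum big_cat. Qed.
Lemma tliftZ c x : tlift f (tscale c x) = c *: tlift f x.
Proof.
rewrite tlift_pi // /tsum big_map scaler_sumr; apply: eq_bigr => p _ /=.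
exact: bilinZl.
Qed.
Lemma tliftN x : tlift f (topp x) = - tlift f x.
Proof. by rewrite tliftZ scaleN1r. Qed.
End Val.

Let tE := (tliftD, tlift0, tliftN, tliftZ).

Lemma taddA : associative tadd.
Proof. by move=> x y z; apply: tens_ext => X f Hf; rewrite !tE // addrA. Qed.
Lemma taddC : commutative tadd.
Proof. by move=> x y; apply: tens_ext => X f Hf; rewrite !tE // addrC. Qed.
Lemma tadd0 : left_id tzero tadd.
Proof. by move=> x; apply: tens_ext => X f Hf; rewrite !tE // add0r. Qed.
Lemma taddN : left_inverse tzero topp tadd.
Proof. by move=> x; apply: tens_ext => X f Hf; rewrite !tE // addNr. Qed.
HB.instance Definition _ :=
  GRing.isZmodule.Build tens taddA taddC tadd0 taddN.

Lemma tscaleA a b x : tscale a (tscale b x) = tscale (a * b) x.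
Proof. by apply: tens_ext => X f Hf; rewrite !tE // scalerA. Qed.
Lemma tscale1 : left_id 1 tscale.
Proof. by move=> x; apply: tens_ext => X f Hf; rewrite !tE // scale1r. Qed.
Lemma tscaleDr : right_distributive tscale +%R.
Proof. by move=> a x y; apply: tens_ext => X f Hf; rewrite !tE // scalerDr. Qed.
Lemma tscaleDl x : {morph tscale^~ x : a b / a + b}.
Proof. by move=> a b; apply: tens_ext => X f Hf; rewrite !tE // scalerDl. Qed.
HB.instance Definition _ :=
  GRing.Zmodule_isLmodule.Build k tens tscaleA tscale1 tscaleDr tscaleDl.

Lemma tlift_lin (X : lmodType k) (f : V -> W -> X) : bilin f -> linear (tlift f : tens -> X).
Proof. by move=> Hf c x y; rewrite tliftD // tliftZ. Qed.

Lemma tpure_bilin : bilin (tpure : V -> W -> tens).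
Proof.
split=> [w|v] c a b; apply: tens_ext => X f Hf;
  rewrite (tlift_lin Hf) !tlift_pure //; [exact: Hf.1 | exact: Hf.2].
Qed.

Lemma tpure_sum (x : tens) : x = \sum_(p <- repr x) tpure p.1 p.2.
Proof.
apply: tens_ext => X f Hf; rewrite [LHS]/tlift /tsum.
elim: (repr x) => [|p s IH]; first by rewrite !big_nil tlift0.
by rewrite !big_cons tliftD // tlift_pure // IH.
Qed.

Lemma tens_ind (P : tens -> Prop) : P 0 -> (forall x y, P x -> P y -> P (x + y)) ->
  (forall v w, P (tpure v w)) -> forall x, P x.
Proof.
move=> P0 PD Pp x; rewrite (tpure_sum x).
by elim: (repr x) => [|p s IH]; rewrite ?big_nil // big_cons; apply: PD.
Qed.

End Tensor.

Definition tmap (k : fieldType) (V W V' W' : lmodType k)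
    (f : V -> V') (g : W -> W') : tens V W -> tens V' W' :=
  tlift (fun v w => tpure (f v) (g w) : tens V' W').

Section TensorAlgebra.
Variables (k : fieldType) (A B : algType k).
Local Notation AB := (tens A B).

Definition tmul_aux (y : AB) (a : A) (b : B) : AB :=
  tlift (fun c d => tpure (a * c) (b * d) : AB) y.
Definition tmul (x y : AB) : AB := tlift (tmul_aux y) x.
Definition tone : AB := tpure 1 1.

Lemma tmul_in_bilin a b : bilin (fun c d => tpure (a * c) (b * d) : AB).
Proof.
have [L M] := tpure_bilin A B; split=> [d|c] e x y /=.
  by rewrite mulrDr -scalerAr L.
by rewrite mulrDr -scalerAr M.
Qed.

Lemma tmul_auxD a b e x y :
  tmul_aux (e *: x + y) a b = e *: tmul_aux x a b + tmul_aux y a b.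
Proof. exact: (tlift_lin (tmul_in_bilin a b)). Qed.

Lemma tmul_aux_pure a b c d : tmul_aux (tpure c d) a b = tpure (a * c) (b * d).
Proof. by rewrite /tmul_aux tlift_pure //; apply: tmul_in_bilin. Qed.

Lemma tmul_aux_bilin y : bilin (tmul_aux y).
Proof.
have [L M] := tpure_bilin A B.
have tmul_aux0 a b : tmul_aux 0 a b = 0.
  by have := tmul_auxD a b (-1) 0 0; rewrite scaler0 addr0 scaleN1r addNr.
split=> [b|a] e x x' /=; elim/tens_ind: y => [|y y' IH IH'|c d].
- by rewrite !tmul_aux0 scaler0 addr0.
- rewrite -[y]scale1r !tmul_auxD !scale1r IH IH' scalerDr.
  by rewrite addrACA.
- by rewrite !tmul_aux_pure mulrDl -scalerAl L.
- by rewrite !tmul_aux0 scaler0 addr0.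
- rewrite -[y]scale1r !tmul_auxD !scale1r IH IH' scalerDr.
  by rewrite addrACA.
- by rewrite !tmul_aux_pure mulrDl -scalerAl M.
Qed.

Lemma tmul_linl y : linear (tmul^~ y).
Proof. exact: (tlift_lin (tmul_aux_bilin y)). Qed.

Lemma tmul_pure a b c d : tmul (tpure a b) (tpure c d) = tpure (a * c) (b * d).
Proof.
rewrite /tmul tlift_pure ?tmul_aux_pure //; exact: tmul_aux_bilin.
Qed.

Lemma tmul_linr x : linear (tmul x).
Proof.
have mulDl u v y : tmul (u + v) y = tmul u y + tmul v y.
  by have /= := tmul_linl y 1 u v; rewrite !scale1r.
have mul0l y : tmul 0 y = 0.
  by have /= := tmul_linl y (-1) 0 0; rewrite scaler0 addr0 scaleN1r addNr.
move=> e y y'; elim/tens_ind: x => [|u v IH IH'|a b].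
- by rewrite !mul0l scaler0 addr0.
- by rewrite !mulDl IH IH' scalerDr addrACA.
by rewrite /tmul !tlift_pure ?tmul_auxD //; exact: tmul_aux_bilin.
Qed.

Lemma tmulDl : left_distributive tmul +%R.
Proof. by move=> u v y; have /= := tmul_linl y 1 u v; rewrite !scale1r. Qed.
Lemma tmulDr : right_distributive tmul +%R.
Proof. by move=> x u v; have /= := tmul_linr x 1 u v; rewrite !scale1r. Qed.
Lemma tmul0l y : tmul 0 y = 0.
Proof.
by have /= := tmul_linl y (-1) 0 0; rewrite scaler0 addr0 scaleN1r addNr.
Qed.
Lemma tmul0r y : tmul y 0 = 0.
Proof.
by have /= := tmul_linr y (-1) 0 0; rewrite scaler0 addr0 scaleN1r addNr.
Qed.

Lemma tmulA : associative tmul.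
Proof.
move=> x y z; elim/tens_ind: x => [|x x' IH IH'|a b]; rewrite ?tmul0l //.
  by rewrite !tmulDl IH IH'.
elim/tens_ind: y => [|x x' IH IH'|c d]; rewrite ?(tmul0l, tmul0r) //.
  by rewrite !(tmulDl, tmulDr) IH IH'.
elim/tens_ind: z => [|x x' IH IH'|e f]; rewrite ?tmul0r //.
  by rewrite !tmulDr IH IH'.
by rewrite !tmul_pure !mulrA.
Qed.
Lemma tmul1l : left_id tone tmul.
Proof.
move=> z; elim/tens_ind: z => [|x x' IH IH'|e f]; rewrite ?tmul0r //.
  by rewrite !tmulDr IH IH'.
by rewrite tmul_pure !mul1r.
Qed.
Lemma tmul1r : right_id tone tmul.
Proof.
move=> z; elim/tens_ind: z => [|x x' IH IH'|e f]; rewrite ?tmul0l //.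
  by rewrite !tmulDl IH IH'.
by rewrite tmul_pure !mulr1.
Qed.

Lemma tone_neq0 : tone != 0.
Proof.
have [f f1] := functional_neq0 (oner_neq0 A).
have [g g1] := functional_neq0 (oner_neq0 B).
pose h (a : A) (b : B) : k^o := f a * g b.
have Hh : bilin h.
  split=> [b|a] c x y; rewrite /h linearP /=; first by rewrite mulrDl scalerAl.
  by rewrite mulrDr scalerAr.
apply/eqP => /(congr1 (tlift h)).
rewrite tlift_pure // [RHS](tlift0 Hh) /h f1 g1 mulr1.
exact/eqP/oner_neq0.
Qed.

HB.instance Definition _ := GRing.Zmodule_isNzRing.Build AB
  tmulA tmul1l tmul1r tmulDl tmulDr tone_neq0.

Lemma tscalerAl (e : k) (x y : AB) : e *: (x * y) = (e *: x) * y.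
Proof.
by apply: esym; have /= := tmul_linl y e x 0; rewrite addr0 tmul0l addr0.
Qed.
HB.instance Definition _ := GRing.Lmodule_isLalgebra.Build k AB tscalerAl.

Lemma tscalerAr (e : k) (x y : AB) : e *: (x * y) = x * (e *: y).
Proof.
by apply: esym; have /= := tmul_linr x e y 0; rewrite addr0 tmul0r addr0.
Qed.
HB.instance Definition _ := GRing.Lalgebra_isAlgebra.Build k AB tscalerAr.

Lemma tensM (a c : A) (b d : B) :
  (tpure a b : AB) * tpure c d = tpure (a * c) (b * d).
Proof. exact: tmul_pure. Qed.

End TensorAlgebra.

Section ConverseAlgebra.
Variables (k : fieldType) (A : algType k).
HB.instance Definition _ := GRing.Lmodule.copy (A^c) A.

Lemma conv_scalerAl (e : k) (x y : A^c) :
  e *: (x * y : A^c) = (e *: x : A^c) * y :> A^c.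
Proof. exact: (@scalerAr _ A e y x). Qed.
HB.instance Definition _ := GRing.Lmodule_isLalgebra.Build k A^c conv_scalerAl.

Lemma conv_scalerAr (e : k) (x y : A^c) :
  e *: (x * y : A^c) = x * (e *: y : A^c) :> A^c.
Proof. exact: (@scalerAl _ A e y x). Qed.
HB.instance Definition _ := GRing.Lalgebra_isAlgebra.Build k A^c conv_scalerAr.
End ConverseAlgebra.

Inductive ugen := gK | gKi | gE | gF.
HB.instance Definition _ := gen_eqMixin ugen.
HB.instance Definition _ := gen_choiceMixin ugen.

Section QuantumGroup.
Variables (k : fieldType) (q : k).

Definition uq_rels (B : algType k) (g : ugen -> B) : Prop :=
  [/\ g gK * g gKi = 1, g gKi * g gK = 1,
      g gK * g gE = q ^+ 2 *: (g gE * g gK),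
      g gK * g gF = q ^- 2 *: (g gF * g gK) &
      g gE * g gF - g gF * g gE = (q - q^-1)^-1 *: (g gK - g gKi)].

(* The free algebra on ugen: formal linear combinations of words. *)
Definition ufree := seq (k * seq ugen).

Definition ueval (B : algType k) (g : ugen -> B) (s : ufree) : B :=
  \sum_(p <- s) p.1 *: \prod_(l <- p.2) g l.

(* Two noncommutative polynomials agree modulo the ideal generated by the
   relations iff they agree in every algebra where the relations hold. *)
Definition ueq (s t : ufree) : bool :=
  `[< forall (B : algType k) (g : ugen -> B), uq_rels g ->
        ueval g s = ueval g t >].

Lemma ueq_refl : reflexive ueq. Proof. by move=> s; apply/asboolP. Qed.
Lemma ueq_sym : symmetric ueq.
Proof.
by move=> s t; apply/asboolP/asboolP => H X f Hf; rewrite (H X f Hf).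
Qed.
Lemma ueq_trans : transitive ueq.
Proof.
move=> t s u /asboolP H1 /asboolP H2; apply/asboolP => X f Hf.
by rewrite (H1 X f Hf) (H2 X f Hf).
Qed.
Canonical ueq_equiv := EquivRel ueq ueq_refl ueq_sym ueq_trans.

Definition Uq : Type := {eq_quot ueq}.
HB.instance Definition _ := Choice.on Uq.
HB.instance Definition _ := EqQuotient.on Uq.

Definition ulift (B : algType k) (g : ugen -> B) (x : Uq) : B :=
  ueval g (repr x).

Lemma ulift_pi (B : algType k) (g : ugen -> B) s : uq_rels g ->
  ulift g (\pi_Uq s) = ueval g s.
Proof.
move=> Hg; rewrite /ulift.
suff /eqquotP/asboolP : repr (\pi_Uq s) = s %[mod Uq] by apply.
by rewrite reprK.
Qed.

Lemma Uq_ext (x y : Uq) :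
  (forall (B : algType k) (g : ugen -> B), uq_rels g -> ulift g x = ulift g y) ->
  x = y.
Proof.
move=> H; rewrite -[x]reprK -[y]reprK; apply/eqquotP/asboolP => X f Hf.
exact: H.
Qed.

Definition uzero : Uq := \pi_Uq [::].
Definition uone : Uq := \pi_Uq [:: (1, [::])].
Definition ugenq (l : ugen) : Uq := \pi_Uq [:: (1, [:: l])].
Definition uadd (x y : Uq) : Uq := \pi_Uq (repr x ++ repr y).
Definition uscale (c : k) (x : Uq) : Uq :=
  \pi_Uq [seq (c * p.1, p.2) | p <- repr x].
Definition uopp : Uq -> Uq := uscale (-1).
Definition umul (x y : Uq) : Uq :=
  \pi_Uq [seq (p.1 * r.1, p.2 ++ r.2) | p <- repr x, r <- repr y].

Section Val.
Variables (B : algType k) (g : ugen -> B) (Hg : uq_rels g).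
Lemma ulift0 : ulift g uzero = 0.
Proof. by rewrite ulift_pi // /ueval big_nil. Qed.
Lemma ulift1 : ulift g uone = 1.
Proof. by rewrite ulift_pi // /ueval big_seq1 /= big_nil scale1r. Qed.
Lemma ulift_gen l : ulift g (ugenq l) = g l.
Proof. by rewrite ulift_pi // /ueval big_seq1 /= big_seq1 scale1r. Qed.
Lemma uliftD x y : ulift g (uadd x y) = ulift g x + ulift g y.
Proof. by rewrite ulift_pi // /ueval big_cat. Qed.
Lemma uliftZ c x : ulift g (uscale c x) = c *: ulift g x.
Proof.
rewrite ulift_pi // /ueval big_map scaler_sumr; apply: eq_bigr => p _ /=.
by rewrite scalerA.
Qed.
Lemma uliftN x : ulift g (uopp x) = - ulift g x.
Proof. by rewrite uliftZ scaleN1r. Qed.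
Lemma uliftM x y : ulift g (umul x y) = ulift g x * ulift g y.
Proof.
rewrite ulift_pi // /ueval big_allpairs_dep /= big_distrlr /=.
apply: eq_bigr => p _; apply: eq_bigr => r _.
by rewrite big_cat /= -scalerAr -scalerAl scalerA mulrC.
Qed.
End Val.

Let uE := (uliftD, ulift0, ulift1, uliftN, uliftZ, uliftM).

Lemma uaddA : associative uadd.
Proof. by move=> x y z; apply: Uq_ext => X f Hf; rewrite !uE // addrA. Qed.
Lemma uaddC : commutative uadd.
Proof. by move=> x y; apply: Uq_ext => X f Hf; rewrite !uE // addrC. Qed.
Lemma uadd0 : left_id uzero uadd.
Proof. by move=> x; apply: Uq_ext => X f Hf; rewrite !uE // add0r. Qed.
Lemma uaddN : left_inverse uzero uopp uadd.
Proof. by move=> x; apply: Uq_ext => X f Hf; rewrite !uE // addNr. Qed.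
HB.instance Definition _ := GRing.isZmodule.Build Uq uaddA uaddC uadd0 uaddN.

Lemma uscaleA a b x : uscale a (uscale b x) = uscale (a * b) x.
Proof. by apply: Uq_ext => X f Hf; rewrite !uE // scalerA. Qed.
Lemma uscale1 : left_id 1 uscale.
Proof. by move=> x; apply: Uq_ext => X f Hf; rewrite !uE // scale1r. Qed.
Lemma uscaleDr : right_distributive uscale +%R.
Proof. by move=> a x y; apply: Uq_ext => X f Hf; rewrite !uE // scalerDr. Qed.
Lemma uscaleDl x : {morph uscale^~ x : a b / a + b}.
Proof. by move=> a b; apply: Uq_ext => X f Hf; rewrite !uE // scalerDl. Qed.
HB.instance Definition _ :=
  GRing.Zmodule_isLmodule.Build k Uq uscaleA uscale1 uscaleDr uscaleDl.

Lemma umulA : associative umul.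
Proof. by move=> x y z; apply: Uq_ext => X f Hf; rewrite !uE // mulrA. Qed.
Lemma umul1l : left_id uone umul.
Proof. by move=> x; apply: Uq_ext => X f Hf; rewrite !uE // mul1r. Qed.
Lemma umul1r : right_id uone umul.
Proof. by move=> x; apply: Uq_ext => X f Hf; rewrite !uE // mulr1. Qed.
Lemma umulDl : left_distributive umul +%R.
Proof. by move=> a x y; apply: Uq_ext => X f Hf; rewrite !uE // mulrDl. Qed.
Lemma umulDr : right_distributive umul +%R.
Proof. by move=> a x y; apply: Uq_ext => X f Hf; rewrite !uE // mulrDr. Qed.

Lemma uone_neq0 : uone != 0.
Proof.
pose eps (l : ugen) : k^o := match l with gK | gKi => 1 | _ => 0 end.
have Heps : uq_rels eps.
  by split; rewrite /eps ?(mulr1, mul0r, mulr0, subrr, scaler0).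
apply/eqP => /(congr1 (ulift eps)); rewrite ulift1 // (ulift0 Heps).
exact/eqP/oner_neq0.
Qed.

HB.instance Definition _ := GRing.Zmodule_isNzRing.Build Uq
  umulA umul1l umul1r umulDl umulDr uone_neq0.

Lemma uscalerAl (e : k) (x y : Uq) : e *: (x * y) = (e *: x) * y.
Proof. by apply: Uq_ext => X f Hf; rewrite !uE // scalerAl. Qed.
HB.instance Definition _ := GRing.Lmodule_isLalgebra.Build k Uq uscalerAl.
Lemma uscalerAr (e : k) (x y : Uq) : e *: (x * y) = x * (e *: y).
Proof. by apply: Uq_ext => X f Hf; rewrite !uE // scalerAr. Qed.
HB.instance Definition _ := GRing.Lalgebra_isAlgebra.Build k Uq uscalerAr.

Lemma ulift_linear (B : algType k) (g : ugen -> B) :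
  uq_rels g -> linear (ulift g : Uq -> B).
Proof. by move=> Hg c x y; rewrite uliftD // uliftZ. Qed.

Lemma ulift_mult (B : algType k) (g : ugen -> B) (x y : Uq) :
  uq_rels g -> ulift g (x * y) = ulift g x * ulift g y.
Proof. by move=> Hg; rewrite uliftM. Qed.

Lemma ugenq_rels : uq_rels ugenq.
Proof.
by split; apply: Uq_ext => X f Hf; have [? ? ? ? ?] := Hf;
  rewrite !uE // !ulift_gen.
Qed.

Lemma Uq_repr (x : Uq) :
  x = \sum_(p <- repr x) p.1 *: \prod_(l <- p.2) ugenq l.
Proof.
apply: Uq_ext => X f Hf; rewrite [LHS]/ulift /ueval.
elim: (repr x) => [|p s IH]; first by rewrite !big_nil ulift0.
rewrite !big_cons uliftD // uliftZ // IH; congr (_ *: _ + _).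
elim: p.2 => [|l w IHw]; first by rewrite !big_nil ulift1.
by rewrite !big_cons uliftM // ulift_gen // IHw.
Qed.

Lemma Uq_ind (P : Uq -> Prop) :
  (forall c x y, P x -> P y -> P (c *: x + y)) ->
  P 0 -> P 1 -> (forall l x, P x -> P (ugenq l * x)) -> forall x, P x.
Proof.
move=> PL P0 P1 Pg x; rewrite (Uq_repr x).
elim: (repr x) => [|p s IH]; rewrite ?big_nil // big_cons.
apply: PL => //; elim: p.2 => [|l w IHw]; rewrite ?big_nil // big_cons.
exact: Pg.
Qed.

End QuantumGroup.

Section Span.
Variables (k : fieldType) (V : lmodType k).

Definition in_span (b : seq V) (v : V) : Prop :=
  exists c : nat -> k, v = \sum_(i < size b) c i *: b`_i.

Lemma in_span_lin b (e : k) u v :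
  in_span b u -> in_span b v -> in_span b (e *: u + v).
Proof.
move=> [c ->] [d ->]; exists (fun i => e * c i + d i).
rewrite scaler_sumr -big_split; apply: eq_bigr => i _ /=.
by rewrite scalerA scalerDl.
Qed.
Lemma in_span0 b : in_span b 0.
Proof. by exists (fun=> 0); rewrite big1 // => i _; rewrite scale0r. Qed.
Lemma in_spanD b u v : in_span b u -> in_span b v -> in_span b (u + v).
Proof. by move=> hu hv; rewrite -[u]scale1r; apply: in_span_lin. Qed.
Lemma in_spanZ b (e : k) u : in_span b u -> in_span b (e *: u).
Proof.
by move=> hu; rewrite -[e *: u]addr0; apply: in_span_lin => //; apply: in_span0.
Qed.
Lemma in_span_mem b v : v \in b -> in_span b v.
Proof.
move=> vb; have ib : (index v b < size b)%N by rewrite index_mem.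
exists (fun i => (i == index v b)%:R).
rewrite (bigD1 (Ordinal ib)) //= eqxx scale1r nth_index // big1 ?addr0 // => i ni.
by rewrite -(inj_eq val_inj) /= in ni; rewrite (negPf ni) scale0r.
Qed.
Lemma in_span_sub b b' v : (forall u, u \in b -> in_span b' u) ->
  in_span b v -> in_span b' v.
Proof.
move=> H [c ->]; elim/big_ind: _ => [|x y|i _]; first exact: in_span0.
  exact: in_spanD.
by apply/in_spanZ/H/mem_nth.
Qed.
End Span.

Section Hopf.
Variables (k : fieldType) (q : k).
Local Notation U := (Uq q).
Local Notation UU := (tens U U).

Definition uK : U := ugenq q gK.
Definition uKi : U := ugenq q gKi.
Definition uE : U := ugenq q gE.
Definition uF : U := ugenq q gF.

(* The power K^z, z : int. *)
Definition uKz (z : int) : U :=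
  match z with Posz n => uK ^+ n | Negz n => uKi ^+ n.+1 end.

Definition casimir : U :=
  (q - q^-1) ^+ 2 *: (uF * uE) + q *: uK + q^-1 *: uKi.

Definition Delta_gen (l : ugen) : UU :=
  match l with
  | gK => tpure uK uK
  | gKi => tpure uKi uKi
  | gE => tpure uE uK + tpure 1 uE
  | gF => tpure uF 1 + tpure uKi uF
  end.
Definition Delta : U -> UU := ulift Delta_gen.

Definition antipode_gen (l : ugen) : U^c :=
  match l with
  | gK => uKi
  | gKi => uK
  | gE => - (uE * uKi : U)
  | gF => - (uK * uF : U)
  end.
Definition antipode : U -> U := ulift antipode_gen.

(* The left adjoint action h |> x. *)
Definition ad (h x : U) : U :=
  tlift (fun h1 h2 => h1 * x * antipode h2) (Delta h).

Definition locally_finite (x : U) : Prop :=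
  fin_dim (fun y => exists h, y = ad h x).

Hypothesis q0 : q != 0.

Lemma KKi : uK * uKi = 1. Proof. by have [] := ugenq_rels q. Qed.
Lemma KiK : uKi * uK = 1. Proof. by have [] := ugenq_rels q. Qed.
Lemma KE : uK * uE = q ^+ 2 *: (uE * uK).
Proof. by have [] := ugenq_rels q. Qed.
Lemma KF : uK * uF = q ^- 2 *: (uF * uK).
Proof. by have [] := ugenq_rels q. Qed.
Lemma EF : uE * uF = uF * uE + (q - q^-1)^-1 *: (uK - uKi).
Proof.
have [_ _ _ _ H] := ugenq_rels q.
by apply/eqP; rewrite addrC -subr_eq; apply/eqP.
Qed.
Let q20 : q ^+ 2 != 0. Proof. exact: expf_neq0. Qed.
Lemma KiE : uKi * uE = q ^- 2 *: (uE * uKi).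
Proof.
have H : uE * uKi = q ^+ 2 *: (uKi * uE).
  by rewrite -[uE in LHS]mul1r -KiK -(mulrA _ uK) KE -scalerAr -scalerAl
    -!mulrA KKi mulr1.
by rewrite H scalerA mulVf // scale1r.
Qed.
Lemma KiF : uKi * uF = q ^+ 2 *: (uF * uKi).
Proof.
have H : uF * uKi = q ^- 2 *: (uKi * uF).
  by rewrite -[uF in LHS]mul1r -KiK -(mulrA _ uK) KF -scalerAr -scalerAl
    -!mulrA KKi mulr1.
by rewrite H scalerA mulfV // scale1r.
Qed.

Lemma mKKi x : x * uK * uKi = x. Proof. by rewrite -mulrA KKi mulr1. Qed.
Lemma mKiK x : x * uKi * uK = x. Proof. by rewrite -mulrA KiK mulr1. Qed.
Lemma mKE x : x * uK * uE = q ^+ 2 *: (x * uE * uK).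
Proof. by rewrite -mulrA KE -scalerAr mulrA. Qed.
Lemma mKF x : x * uK * uF = q ^- 2 *: (x * uF * uK).
Proof. by rewrite -mulrA KF -scalerAr mulrA. Qed.
Lemma mKiE x : x * uKi * uE = q ^- 2 *: (x * uE * uKi).
Proof. by rewrite -mulrA KiE -scalerAr mulrA. Qed.
Lemma mKiF x : x * uKi * uF = q ^+ 2 *: (x * uF * uKi).
Proof. by rewrite -mulrA KiF -scalerAr mulrA. Qed.

Let tL (a b : U) e x y : tpure (e *: x + y) b = e *: tpure x b + tpure y b :> UU.
Proof. exact: (tpure_bilin U U).1. Qed.
Let tDl (b x y : U) : tpure (x + y) b = tpure x b + tpure y b :> UU.
Proof. by rewrite -[x]scale1r tL // !scale1r. Qed.
Let tDr (b x y : U) : tpure b (x + y) = tpure b x + tpure b y :> UU.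
Proof. by rewrite -[x in LHS]scale1r (tpure_bilin U U).2 scale1r. Qed.
Let tZl e (x b : U) : tpure (e *: x) b = e *: tpure x b :> UU.
Proof. exact: bilinZl (tpure_bilin U U). Qed.
Let tZr e (x b : U) : tpure b (e *: x) = e *: tpure b x :> UU.
Proof. exact: bilinZr (tpure_bilin U U). Qed.
Let tBl (b x y : U) : tpure (x - y) b = tpure x b - tpure y b :> UU.
Proof. by rewrite tDl -scaleN1r tZl scaleN1r. Qed.
Let tBr (b x y : U) : tpure b (x - y) = tpure b x - tpure b y :> UU.
Proof. by rewrite tDr -scaleN1r tZr scaleN1r. Qed.

Lemma comm_sum (R : pzRingType) (x y z w : R) :
  (x + y) * (z + w) - (z + w) * (x + y) =
  (x * z - z * x) + (x * w - w * x) + ((y * z - z * y) + (y * w - w * y)).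
Proof.
rewrite !mulrDl !mulrDr !opprD.
rewrite [X in _ + X](AC (2*2) ((1*3)*(2*4))) /=.
by rewrite [LHS](AC ((2*2)*(2*2)) (((1*5)*(2*6))*((3*7)*(4*8)))) /=.
Qed.

Lemma Delta_rels : uq_rels q Delta_gen.
Proof.
split; rewrite /Delta_gen.
- by rewrite tensM KKi.
- by rewrite tensM KiK.
- by rewrite mulrDr mulrDl !tensM KE tZl tZr mulr1 mul1r scalerDr.
- by rewrite mulrDr mulrDl !tensM KF tZl tZr mulr1 mul1r KKi KiK scalerDr.
- rewrite comm_sum !tensM !mulr1 !mul1r KiE KF !(tZl, tZr) !subrr addr0 add0r.
  rewrite -tBl -tBr !EF !(addrC (uF * uE)) !addrK tZl tZr tBl tBr.
  by rewrite -scalerDr addrA subrK.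
Qed.

Lemma antipode_rels : uq_rels q antipode_gen.
Proof.
have cM (x y : U^c) : x * y = (y : U) * (x : U) :> U by [].
split; rewrite /antipode_gen.
- exact: KKi.
- exact: KiK.
- rewrite !cM mulrN mulNr scalerN; congr (- _).
  by rewrite mulrA KiE -scalerAl scalerA mulfV // scale1r.
- rewrite !cM mulrN mulNr scalerN; congr (- _).
  by rewrite !mulrA KiK mul1r KF -scalerAl mKKi.
- rewrite !cM !mulrNN !mulrA mKiK.
  rewrite (_ : uK * uF * uE * uKi = uF * uE); last first.
    by rewrite KF -!scalerAl mKE -scalerAl mKKi scalerA mulVf // scale1r.
  rewrite EF opprD addrA subrr add0r.
  by rewrite -scalerN opprB.
Qed.

Lemma antipodeM x y : antipode (x * y) = antipode y * antipode x.
Proof. exact: (ulift_mult x y antipode_rels). Qed.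
Lemma antipode_lin : linear antipode.
Proof. exact: (ulift_linear antipode_rels). Qed.
Lemma antipodeP c x y : antipode (c *: x + y) = c *: antipode x + antipode y.
Proof. exact: antipode_lin. Qed.
Lemma antipode1 : antipode 1 = 1.
Proof. exact: (ulift1 antipode_rels). Qed.
Lemma antipode_ugen l : antipode (ugenq q l) = antipode_gen l.
Proof. exact: (ulift_gen antipode_rels). Qed.
Lemma Delta_lin : linear Delta.
Proof. exact: (ulift_linear Delta_rels). Qed.
Lemma DeltaM x y : Delta (x * y) = Delta x * Delta y.
Proof. exact: (ulift_mult x y Delta_rels). Qed.
Lemma Delta1 : Delta 1 = 1.
Proof. exact: (ulift1 Delta_rels). Qed.
Lemma Delta_ugen l : Delta (ugenq q l) = Delta_gen l.
Proof. exact: (ulift_gen Delta_rels). Qed.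

Let sandwich x (h1 h2 : U) : U := h1 * x * antipode h2.
Let sandwich_bilin x : bilin (sandwich x).
Proof.
split=> [h2|h1] c y z /=; rewrite /sandwich.
  by rewrite !mulrDl -!scalerAl.
by rewrite antipodeP mulrDr scalerAr.
Qed.
Let adE h x : ad h x = tlift (sandwich x) (Delta h). Proof. by []. Qed.

Lemma ad_linl x : linear (ad^~ x).
Proof.
by move=> c g h; rewrite !adE Delta_lin (tlift_lin (sandwich_bilin x)).
Qed.
Let sandwich_linr z : linear (fun x => tlift (sandwich x) z).
Proof.
move=> c x y; elim/tens_ind: z => [|z z' IH IH'|a b].
- by rewrite !(tlift0 (sandwich_bilin _)) scaler0 addr0.
- by rewrite !(tliftD (sandwich_bilin _)) IH IH' scalerDr addrACA.
rewrite !(tlift_pure (sandwich_bilin _)) /sandwich mulrDr mulrDl.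
by rewrite -scalerAr -scalerAl.
Qed.
Lemma ad_linr h : linear (ad h).
Proof. by move=> c x y; rewrite !adE sandwich_linr. Qed.

Lemma ad1 x : ad 1 x = x.
Proof.
by rewrite adE Delta1 tlift_pure // /sandwich antipode1 mulr1 mul1r.
Qed.

Lemma adM g h x : ad (g * h) x = ad g (ad h x).
Proof.
rewrite !adE DeltaM; elim/tens_ind: (Delta g) => [|z z' IH IH'|a b].
- by rewrite mul0r !(tlift0 (sandwich_bilin _)).
- by rewrite mulrDl !(tliftD (sandwich_bilin _)) IH IH'.
rewrite [RHS](tlift_pure (sandwich_bilin _)).
elim/tens_ind: (Delta h) => [|z z' IH IH'|c d].
- by rewrite mulr0 !(tlift0 (sandwich_bilin _)) /sandwich mulr0 mul0r.
- rewrite mulrDr !(tliftD (sandwich_bilin _)) IH IH' /sandwich.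
  by rewrite mulrDr mulrDl.
by rewrite tensM !(tlift_pure (sandwich_bilin _)) /sandwich antipodeM !mulrA.
Qed.

Lemma ad_K x : ad uK x = uK * x * uKi.
Proof.
by rewrite adE Delta_ugen tlift_pure // /sandwich antipode_ugen.
Qed.
Lemma ad_Ki x : ad uKi x = uKi * x * uK.
Proof.
by rewrite adE Delta_ugen tlift_pure // /sandwich antipode_ugen.
Qed.
Lemma ad_E x : ad uE x = uE * x * uKi - x * uE * uKi.
Proof.
rewrite adE Delta_ugen tliftD // !tlift_pure // /sandwich !antipode_ugen /=.
by rewrite mul1r mulrN mulrA.
Qed.
Lemma ad_F x : ad uF x = uF * x - uKi * x * uK * uF.
Proof.
rewrite adE Delta_ugen tliftD // !tlift_pure // /sandwich !antipode_ugen /=.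
by rewrite antipode1 mulr1 mulrN !mulrA.
Qed.

Definition ad2 (x y : U) (w : UU) : U := tlift (fun a b => ad a x * ad b y) w.
Let ad2_bilin x y : bilin (fun a b => ad a x * ad b y).
Proof.
split=> [b|a] c u v /=; first by rewrite ad_linl mulrDl scalerAl.
by rewrite ad_linl mulrDr scalerAr.
Qed.

Let ad2D u v z z' : ad2 u v (z + z') = ad2 u v z + ad2 u v z'.
Proof. exact: (tliftD (ad2_bilin u v)). Qed.
Let ad2p u v a b : ad2 u v (tpure a b) = ad a u * ad b v.
Proof. exact: (tlift_pure (ad2_bilin u v)). Qed.
Let ad2L u v c z z' : ad2 u v (c *: z + z') = c *: ad2 u v z + ad2 u v z'.
Proof. exact: (tlift_lin (ad2_bilin u v)). Qed.
Let ad20 u v : ad2 u v 0 = 0. Proof. exact: (tlift0 (ad2_bilin u v)). Qed.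

Lemma ad_mul h x y : ad h (x * y) = ad2 x y (Delta h).
Proof.
have adD g u v : ad g (u + v) = ad g u + ad g v.
  by rewrite -[u]scale1r ad_linr !scale1r.
have ad0 g : ad g 0 = 0.
  by have := ad_linr g (-1) 0 0; rewrite scaler0 addr0 scaleN1r addNr.
have Hgen l u v : ad (ugenq q l) (u * v) = ad2 u v (Delta (ugenq q l)).
  rewrite Delta_ugen; case: l; rewrite /= ?ad2D !ad2p ?ad1 -?[ugenq _ _]/uK.
  - by rewrite !ad_K !mulrA mKiK.
  - by rewrite -[ugenq q gKi]/uKi !ad_Ki !mulrA mKKi.
  - rewrite -[ugenq q gE]/uE ad_K !ad_E mulrBl mulrBr !mulrA !mKiK.
    by rewrite addrA subrK.
  - rewrite -[ugenq q gF]/uF ad_Ki !ad_F mulrBl mulrBr !mulrA !mKKi.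
    by rewrite addrA subrK.
have step l w : ad (ugenq q l) (ad2 x y w) = ad2 x y (Delta (ugenq q l) * w).
  elim/tens_ind: w => [|z z' IH IH'|a b].
  - by rewrite mulr0 ad20 ad0.
  - by rewrite mulrDr !ad2D adD IH IH'.
  rewrite ad2p Hgen; elim/tens_ind: (Delta _) => [|z z' IH IH'|c d].
  - by rewrite mul0r !ad20.
  - by rewrite mulrDl !ad2D IH IH'.
  by rewrite tensM !ad2p !adM.
elim/Uq_ind: h => [c g h IH IH'|||l h IH].
- by rewrite ad_linl IH IH' Delta_lin ad2L.
- have D0 : Delta 0 = 0.
    by have := Delta_lin (-1) 0 0; rewrite scaler0 addr0 scaleN1r addNr.
  rewrite D0 ad20.
  by have := ad_linl (x * y) (-1) 0 0; rewrite scaler0 addr0 scaleN1r addNr.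
- by rewrite Delta1 ad2p !ad1.
by rewrite adM IH step DeltaM.
Qed.

Lemma lf_ad h x : locally_finite x -> locally_finite (ad h x).
Proof.
by move=> [b Hb]; exists b => y [g ->]; apply: Hb; exists (g * h); rewrite adM.
Qed.

Lemma lf_lin c x y :
  locally_finite x -> locally_finite y -> locally_finite (c *: x + y).
Proof.
move=> [b Hb] [b' Hb']; exists (b ++ b') => _ [h ->]; rewrite ad_linr.
apply: in_span_lin.
  apply: (@in_span_sub _ _ b); last by apply: Hb; exists h.
  by move=> u ub; apply: in_span_mem; rewrite mem_cat ub.
apply: (@in_span_sub _ _ b'); last by apply: Hb'; exists h.
by move=> u ub; apply: in_span_mem; rewrite mem_cat ub orbT.
Qed.

Lemma lf_mul x y :
  locally_finite x -> locally_finite y -> locally_finite (x * y).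
Proof.
move=> [b Hb] [b' Hb']; exists [seq u * v | u <- b, v <- b'] => _ [h ->].
rewrite ad_mul; elim/tens_ind: (Delta h) => [|z z' IH IH'|g g'].
- by rewrite ad20; apply: in_span0.
- by rewrite ad2D; apply: in_spanD.
rewrite ad2p.
have [c ->] := Hb _ (ex_intro _ g erefl).
have [c' ->] := Hb' _ (ex_intro _ g' erefl).
rewrite mulr_suml; elim/big_ind: _ => [|u v|i _]; first exact: in_span0.
  exact: in_spanD.
rewrite mulr_sumr; elim/big_ind: _ => [|u v|j _]; first exact: in_span0.
  exact: in_spanD.
rewrite -scalerAl -scalerAr; do 2 apply: in_spanZ.
by apply/in_span_mem/allpairs_f; apply: mem_nth.
Qed.

Lemma lf_stable (b : seq U) :
  (forall l u, u \in b -> in_span b (ad (ugenq q l) u)) ->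
  forall u, u \in b -> locally_finite u.
Proof.
move=> Hb; have Hs l v : in_span b v -> in_span b (ad (ugenq q l) v).
  move=> [c ->]; elim/big_ind: _ => [|x y Hx Hy|i _].
  - have -> : ad (ugenq q l) 0 = 0.
      have := ad_linr (ugenq q l) (-1) 0 0.
      by rewrite scaler0 addr0 scaleN1r addNr.
    exact: in_span0.
  - by rewrite -[x]scale1r ad_linr scale1r; apply: in_spanD.
  rewrite -[_ *: _]addr0 ad_linr; apply: in_span_lin.
    by apply/Hb/mem_nth.
  have -> : ad (ugenq q l) 0 = 0.
    have := ad_linr (ugenq q l) (-1) 0 0.
    by rewrite scaler0 addr0 scaleN1r addNr.
  exact: in_span0.
move=> u ub; exists b => _ [h ->].
elim/Uq_ind: h => [c g h IH IH'|||l h IH].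
- by rewrite ad_linl; apply: in_span_lin.
- have -> : ad 0 u = 0.
    by have := ad_linl u (-1) 0 0; rewrite scaler0 addr0 scaleN1r addNr.
  exact: in_span0.
- by rewrite ad1; apply: in_span_mem.
by rewrite adM; apply: Hs.
Qed.

Lemma lf_one : locally_finite 1.
Proof.
apply: (@lf_stable [:: 1]); last by rewrite inE.
move=> l u; rewrite inE => /eqP ->; case: l.
- by rewrite ad_K mulr1 KKi; apply: in_span_mem; rewrite inE.
- by rewrite ad_Ki mulr1 KiK; apply: in_span_mem; rewrite inE.
- by rewrite ad_E mulr1 mul1r subrr; apply: in_span0.
- by rewrite ad_F !mulr1 KiK mul1r subrr; apply: in_span0.
Qed.

Hypothesis q1 : q - q^-1 != 0.

Let nf1 (A B C : U) (s t : k) : A - s *: (A + t *: (B - C)) =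
  (1 - s) *: A + (- (s * t)) *: B + (s * t) *: C.
Proof.
rewrite scalerDr scalerA scalerBr opprD opprB addrA scalerBl scale1r.
by rewrite scaleNr -[RHS]addrA (addrC (- _) (_ *: C)).
Qed.
Let nf2 (A B C : U) (r x y z e : k) :
  r *: (x *: A + y *: B + z *: C) + e *: B =
  (r * x) *: A + (r * y + e) *: B + (r * z) *: C.
Proof. by rewrite !scalerDr !scalerA scalerDl addrAC addrA. Qed.
Let nf4 (A B C : U) (s t : k) : A + t *: (B - C) - s *: A =
  (1 - s) *: A + t *: B + (- t) *: C.
Proof. by rewrite addrAC scalerBl scale1r scalerBr scaleNr addrA. Qed.
Let nf3 (A B C : U) (d c s t u r : k) :
  d *: (A + c *: (s *: B - t *: C)) + u *: B + r *: C =
  d *: A + (d * c * s + u) *: B + (r - d * c * t) *: C.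
Proof.
rewrite scalerDr scalerA scalerBr !scalerA scalerDl scalerBl -!addrA.
by congr (_ + (_ + _)); rewrite addrCA (addrC (r *: C)).
Qed.
Let q21 : q * q - 1 != 0.
Proof.
have -> : q * q - 1 = q * (q - q^-1) by rewrite mulrBr mulfV.
by rewrite mulf_neq0.
Qed.

Lemma casimirKK : uK * casimir = casimir * uK.
Proof.
have KFE : uK * (uF * uE) = uF * uE * uK.
  by rewrite mulrA KF -scalerAl mKE scalerA mulVf // scale1r.
by rewrite /casimir !mulrDr !mulrDl -!scalerAr -!scalerAl KKi KiK KFE.
Qed.
Lemma casimirE : uE * casimir = casimir * uE.
Proof.
rewrite /casimir !mulrDr !mulrDl -!scalerAr -!scalerAl !mulrA EF KE KiE.
rewrite mulrDl -scalerAl mulrBl KE KiE nf3 !scalerA.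
by congr (_ *: _ + _ *: _ + _ *: _); field; rewrite q21 q0.
Qed.
Lemma casimirF : uF * casimir = casimir * uF.
Proof.
rewrite /casimir !mulrDr !mulrDl -!scalerAr -!scalerAl -!(mulrA uF uE) EF KF KiF.
rewrite mulrDr -scalerAr mulrBr -[uF * uK in RHS]scale1r.
rewrite -[uF * uKi in RHS]scale1r !scalerA nf3 !mulrA.
by congr (_ *: _ + _ *: _ + _ *: _); field; rewrite ?q21 q0.
Qed.

Lemma lf_gens u : u \in [:: uE; uF * uK; uK; casimir] -> locally_finite u.
Proof.
move: u; apply: lf_stable; set b := [:: _; _; _; _].
have bE : in_span b uE by apply: in_span_mem; rewrite !inE eqxx.
have bF : in_span b (uF * uK) by apply: in_span_mem; rewrite !inE eqxx !orbT.
have bK : in_span b uK by apply: in_span_mem; rewrite !inE eqxx !orbT.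
have bL : in_span b casimir by apply: in_span_mem; rewrite !inE eqxx !orbT.
pose c := (q - q^-1)^-1.
have adFE : ad uF uE = (q^-1 * c) *: casimir + (- (c * (1 + q ^- 2))) *: uK.
  rewrite ad_F KiE -!scalerAl mKiK EF nf1 nf2.
  by congr (_ *: _ + _ *: _ + _ *: _); rewrite /c; field; rewrite ?q21 ?q0.
have adEF : ad uE (uF * uK) = (- (q * c)) *: casimir + (c * (q ^+ 2 + 1)) *: uK.
  rewrite ad_E mulrA mKKi mKE -scalerAl mKKi EF nf2.
  rewrite nf4.
  by congr (_ *: _ + _ *: _ + _ *: _); rewrite /c; field; rewrite ?q21 ?q0.
move=> l u; rewrite !inE => /or4P[] /eqP ->; case: l.
- by rewrite ad_K KE -scalerAl mKKi; apply: in_spanZ.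
- by rewrite ad_Ki KiE -scalerAl mKiK; apply: in_spanZ.
- by rewrite ad_E subrr; apply: in_span0.
- by rewrite adFE; apply: in_spanD; apply: in_spanZ.
- by rewrite ad_K mulrA KF -!scalerAl mKKi; apply: in_spanZ.
- by rewrite ad_Ki mulrA KiF -!scalerAl mKiK; apply: in_spanZ.
- by rewrite adEF; apply: in_spanD; apply: in_spanZ.
- rewrite ad_F !mulrA KiF -!scalerAl mKiK mKF scalerA mulfV //.
  by rewrite scale1r subrr; apply: in_span0.
- by rewrite ad_K mKKi.
- by rewrite ad_Ki KiK mul1r.
- rewrite ad_E mKKi KE -!scalerAl mKKi -[X in X - _]scale1r -scalerBl.
  exact: in_spanZ.
- rewrite ad_F KiK mul1r KF -[X in X - _]scale1r -scalerBl.
  exact: in_spanZ.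
- by rewrite ad_K casimirKK mKKi.
- by rewrite ad_Ki -mulrA -casimirKK mulrA KiK mul1r.
- by rewrite ad_E casimirE subrr; apply: in_span0.
- rewrite ad_F -(mulrA _ casimir) -casimirKK mulrA KiK mul1r casimirF subrr.
  exact: in_span0.
Qed.

End Hopf.

(* V^(x)(m+1), bracketed to the right. *)
Fixpoint tpow (k : fieldType) (V : lmodType k) (m : nat) : lmodType k :=
  if m is m'.+1 then tens V (tpow V m') else V.

(* f 0 (x) f 1 (x) ... (x) f m *)
Fixpoint tpow_pure (k : fieldType) (V : lmodType k) (m : nat) :
    (nat -> V) -> tpow V m :=
  match m with
  | 0 => fun f => f 0%N
  | m'.+1 => fun f => tpure (f 0%N) (tpow_pure m' (fun j => f j.+1))
  end.

(* The graph of the algebra morphism with prescribed values on generators. *)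
Inductive alg_graph (k : fieldType) (A B : algType k) (G : A -> B -> Prop) :
    A -> B -> Prop :=
| AlgGen x y : G x y -> alg_graph G x y
| AlgOne : alg_graph G 1 1
| AlgLin c x y x' y' : alg_graph G x y -> alg_graph G x' y' ->
    alg_graph G (c *: x + x') (c *: y + y')
| AlgMul x y x' y' : alg_graph G x y -> alg_graph G x' y' ->
    alg_graph G (x * x') (y * y').

Section OverCq.
Variable R : realType.

Definition Cq : fieldType := {fraction {poly R[i]}}.
Definition q : Cq := tofrac 'X.

Lemma q_neq0 : q != 0.
Proof. by rewrite /q tofrac_eq0 polyX_eq0. Qed.

Lemma q_qV_neq0 : q - q^-1 != 0.
Proof.
apply/eqP => H; have : q * (q - q^-1) = 0 by rewrite H mulr0.
rewrite mulrBr mulfV ?q_neq0 // => /eqP.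
rewrite subr_eq0 /q -tofracM -tofrac1 tofrac_eq => /eqP /(congr1 (fun p => size (polyseq p))).
by rewrite -expr2 size_polyXn size_poly1.
Qed.

Definition qint (j : nat) : Cq := (q ^+ j - q ^- j) / (q - q^-1).
Definition qfact (i : nat) : Cq := \prod_(1 <= j < i.+1) qint j.

Local Notation U := (Uq q).
Local Notation K := (uK q).
Local Notation E := (uE q).
Local Notation F := (uF q).

Definition lfU : {pred U} := fun x => `[< locally_finite x >].

Lemma lfU_closed : GRing.subsemialg_closed lfU.
Proof.
have lf0 : locally_finite (0 : U).
  have := lf_lin q_neq0 (-1) (lf_one q_neq0) (lf_one q_neq0).
  by rewrite scaleN1r addNr.
split; first exact/asboolP/lf_one/q_neq0.
- split; first exact/asboolP.
  move=> x y /asboolP lx /asboolP ly; apply/asboolP.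
  by rewrite -[x]scale1r; exact: (lf_lin q_neq0 1 lx ly).
- move=> c x /asboolP lx; apply/asboolP.
  by rewrite -[_ *: _]addr0; exact: (lf_lin q_neq0 c lx lf0).
- move=> x y /asboolP lx /asboolP ly; apply/asboolP.
  exact: (lf_mul q_neq0 lx ly).
Qed.

Record Ulf := MkUlf { ulf_val :> U; ulf_valP : ulf_val \in lfU }.
HB.instance Definition _ := [isSub for ulf_val].
HB.instance Definition _ := [Choice of Ulf by <:].
HB.instance Definition _ :=
  GRing.SubChoice_isSubAlgebra.Build Cq U lfU Ulf lfU_closed.

Fact Elf_subproof : E \in lfU.
Proof. by apply/asboolP/(lf_gens q_neq0 q_qV_neq0); rewrite !inE eqxx. Qed.
Fact FKlf_subproof : F * K \in lfU.
Proof. by apply/asboolP/(lf_gens q_neq0 q_qV_neq0); rewrite !inE eqxx ?orbT. Qed.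
Fact Klf_subproof : K \in lfU.
Proof. by apply/asboolP/(lf_gens q_neq0 q_qV_neq0); rewrite !inE eqxx ?orbT. Qed.
Fact Llf_subproof : casimir q \in lfU.
Proof. by apply/asboolP/(lf_gens q_neq0 q_qV_neq0); rewrite !inE eqxx ?orbT. Qed.
Definition Elf : Ulf := MkUlf Elf_subproof.
Definition FKlf : Ulf := MkUlf FKlf_subproof.
Definition Klf : Ulf := MkUlf Klf_subproof.
Definition Lambda : Ulf := MkUlf Llf_subproof.

Fact adlf_subproof (h : U) (x : Ulf) : ad h x \in lfU.
Proof.
by apply/asboolP/(lf_ad q_neq0)/asboolP; exact: ulf_valP.
Qed.
Definition adlf (h : U) (x : Ulf) : Ulf := MkUlf (adlf_subproof h x).

(* The action of U on tensor powers, through iterated coproducts. *)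
Fixpoint act (m : nat) (h : U) : tpow Ulf m -> tpow Ulf m :=
  match m with
  | 0 => adlf h
  | m'.+1 => fun t =>
      tlift (fun h1 h2 =>
        tmap (adlf h1) (@act m' h2) t : tens Ulf (tpow Ulf m')) (Delta h)
  end.

(* homogU d is the degree d component for |E| = 1, |F| = -1, |K| = 0. *)
Inductive homogU : int -> U -> Prop :=
| HomogOne : homogU 0 1
| HomogK : homogU 0 K
| HomogKi : homogU 0 (uKi q)
| HomogE : homogU 1 E
| HomogF : homogU (-1) F
| HomogZero d : homogU d 0
| HomogLin d c x y : homogU d x -> homogU d y -> homogU d (c *: x + y)
| HomogMul d e x y : homogU d x -> homogU e y -> homogU (d + e) (x * y).

Fixpoint homog (m : nat) (d : int) : tpow Ulf m -> Prop :=
  match m with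
  | 0 => fun x : Ulf => homogU d x
  | m'.+1 => fun t => exists s : seq (int * Ulf * tpow Ulf m'),
      (forall e a b, (e, a, b) \in s -> homogU e a /\ homog (d - e) b) /\
      t = \sum_(p <- s) tpure p.1.2 p.2
  end.

(* Theta = \sum_i u_ i (x) v_ i, with the scalar put in the first factor. *)
Definition u_ (i : nat) : U :=
  (q ^+ (i * i.-1)./2 * (q - q^-1) ^+ i / qfact i) *: E ^+ i.
Definition v_ (i : nat) : U := F ^+ i.

(* Delta, as a map U^lf -> U (x) U^lf *)
Definition Delta_lf_graph (x : Ulf) (y : tens U Ulf) : Prop :=
  tmap id ulf_val y = Delta (ulf_val x).
Definition Delta_lf : {linear Ulf -> tens U Ulf} := lin_of Delta_lf_graph.

(* The triples (a, b, d) of s stand for x_(1), x_(2), |x_(2)|. *)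
Definition bDelta_graph (x : Ulf) (z : tens Ulf Ulf) : Prop :=
  exists s : seq (U * Ulf * int),
    [/\ forall a b d, (a, b, d) \in s -> homogU d b,
        Delta_lf x = \sum_(p <- s) tpure p.1.1 p.1.2 &
        sums_to (fun i => \sum_(p <- s)
            tpure (p.1.1 * antipode (uKz q (i%:Z + p.2) * v_ i))
                  (adlf (u_ i) p.1.2))
          (tmap ulf_val id z : tens U Ulf)].
Definition bDelta : {linear Ulf -> tens Ulf Ulf} := lin_of bDelta_graph.

Fixpoint bDelta_iter (m : nat) : Ulf -> tpow Ulf m :=
  match m with
  | 0 => id
  | m'.+1 => fun x => tmap id (bDelta_iter m') (bDelta x)
  end.

(* phi m is the unbraiding map for m.+2 tensor factors. *)
Definition phi_graph (m : nat) (t : tens Ulf (tpow Ulf m))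
    (y : tens U (tpow Ulf m)) : Prop :=
  exists a b d, [/\ homog d b, t = tpure a b &
    sums_to (fun i => tpure (ulf_val a * uKz q (i%:Z + d) * v_ i)
                            (act (u_ i) b)) y].
Definition phi (m : nat) : {linear tens Ulf (tpow Ulf m) -> tens U (tpow Ulf m)} :=
  lin_of (@phi_graph m).

(* gamma m is the map for m.+1 tensor factors. *)
Fixpoint gamma (m : nat) : tpow Ulf m -> tpow U m :=
  match m with
  | 0 => ulf_val
  | m'.+1 => fun t => tmap id (@gamma m') (phi m' t)
  end.

Definition tauL_gen (x : Ulf) (y : tens U Ulf) : Prop :=
  [\/ x = Elf /\ y = tpure K Elf,
      x = FKlf /\ y = tpure (uKi q) FKlf - q *: tpure F Lambda
         + (q * (q + q^-1)) *: tpure F Klf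
         - (q^-1 * (q - q^-1) ^+ 2) *: tpure (F ^+ 2 * K) Elf,
      x = Klf /\ y = tpure 1 Klf
         - (q^-1 * (q - q^-1) ^+ 2) *: tpure (F * K) Elf |
      x = Lambda /\ y = tpure 1 Lambda].
Definition tauL : {linear Ulf -> tens U Ulf} := lin_of (alg_graph tauL_gen).

(* U^(x)c (x) U^lf *)
Fixpoint mixed (c : nat) : lmodType Cq :=
  if c is c'.+1 then tens U (mixed c') else Ulf.

(* id^(x)c (x) f *)
Fixpoint on_last (f : Ulf -> tens U Ulf) (c : nat) : mixed c -> mixed c.+1 :=
  match c with
  | 0 => f
  | c'.+1 => tmap id (@on_last f c')
  end.

(* A subset {i_1 < ... < i_k} of {1, ..., n} is the increasing list of its
   elements. *)
Definition AW_alpha (A : seq nat) (i : nat) : Ulf -> tens U Ulf :=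
  if i \in A then Delta_lf else tauL.

(* (id^(x)(c-1) (x) alpha_c) o ... o (id (x) alpha_2) o alpha_1 *)
Fixpoint AW_comp (A : seq nat) (c : nat) : Ulf -> mixed c :=
  match c with
  | 0 => id
  | c'.+1 => fun x => @on_last (AW_alpha A c'.+1) c' (AW_comp A c' x)
  end.

(* The map z |-> z (x) 1^(x)(m - c) from U^(x)c (x) U^lf to U^(x)(m+1); it is
   only used for c <= m. *)
Fixpoint pad (c m : nat) : mixed c -> tpow U m :=
  match c, m with
  | 0, 0 => ulf_val
  | 0, m'.+1 => fun x => tpure (ulf_val x) (tpow_pure m' (fun=> 1))
  | c'.+1, 0 => fun=> 0
  | c'.+1, m'.+1 => tmap id (@pad c' m')
  end.

Definition AW_gen (n : nat) (A : seq nat) : tpow U n.-1 :=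
  pad n.-1 (AW_comp A (last 0%N A).-1 Lambda).

(* z |-> z_A : the j-th factor goes to position i_j, the others are 1. *)
Definition place_graph (n : nat) (A : seq nat)
    (t : tpow Ulf (size A).-1) (y : tpow Ulf n.-1) : Prop :=
  exists f : nat -> Ulf,
    t = tpow_pure (size A).-1 f /\
    y = tpow_pure n.-1 (fun p => if p.+1 \in A then f (index p.+1 A) else 1).
Definition place (n : nat) (A : seq nat) :
  {linear tpow Ulf (size A).-1 -> tpow Ulf n.-1} := lin_of (@place_graph n A).

End OverCq.

(* Main.v *)
(* A graph extends to a linear map as soon as its linear span is single-valued
   (Zorn). For phi and bDelta this holds because the degree d of an element is read
   off from the action of K, whose eigenvalues q^(2d) are distinct.

   Up to U-equivariance everything reduces to three facts about the span of K, FK,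
   E and Lambda: (a) phi (bDelta x) = Delta x, since the antipode in bDelta cancels
   the quasi-R-matrix in phi; (b) phi (1 (x) x) = tauL x; (c) bDelta commutes with
   the action of E. By (c), x |-> place (bDelta^(k-1) x) is equivariant and
   preserves degrees, so it commutes with phi, and the recursion defining gamma
   turns each occupied position into Delta by (a) and each empty one into tauL
   by (b). *)
From HB Require Import structures.
From mathcomp Require Import all_boot all_order all_algebra.
From mathcomp Require Import boolp classical_sets reals.
From mathcomp Require Import ring.
Require Import Defs.

Set Implicit Arguments.
Unset Strict Implicit.
Unset Printing Implicit Defensive.

Import GRing.Theory.

Local Open Scope ring_scope.

(** * Linear extension *)

(** A [lin_of] map is 0 until its graph is shown consistent, so each map needs a certificate before
    it can be evaluated: for [Delta_lf] the injectivity of U (x) U^lf -> U (x) U, for [tauL] and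
    [place] an independently defined linear map whose graph contains the given one, for [phi] and
    [bDelta] the eigenvalue argument. The sums over i are infinite only in form: [u_ i] is a
    multiple of E^i, and three applications of E kill every entry of the matrix L. On the span of
    these entries the facts reduce to finite checks on four elements. The exception is (b): tauL is
    prescribed as an algebra morphism, so its very consistency needs x |-> phi (1 (x) x) to be
    multiplicative on the subalgebra generated by E, FK, K and Lambda, which comes from the
    q-binomial identity for powers of E. Commuting with phi asks so little of a map because phi sees
    its second factor only through its degree and the action of E. *)

Section LinearExtension.
Variables (k : fieldType) (V W : lmodType k).

Inductive lin_span (G : V -> W -> Prop) : V -> W -> Prop :=
| LinSpan0 : lin_span G 0 0
| LinSpanS c x y x' y' : G x y -> lin_span G x' y' ->
    lin_span G (c *: x + x') (c *: y + y').

Lemma lin_span_gen (G : V -> W -> Prop) x y : G x y -> lin_span G x y.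
Proof.
move=> Gxy; have := LinSpanS 1 Gxy (LinSpan0 G).
by rewrite !scale1r !addr0.
Qed.

Lemma lin_span_lin (G : V -> W -> Prop) c x y x' y' :
  lin_span G x y -> lin_span G x' y' ->
  lin_span G (c *: x + x') (c *: y + y').
Proof.
move=> + H'; elim=> [|e u v u' v' Guv _ IH]; first by rewrite !scaler0 !add0r.
by rewrite !scalerDr !scalerA -!addrA; apply: LinSpanS.
Qed.

Lemma lin_span_sub (G H : V -> W -> Prop) :
  (forall x y, G x y -> H x y) ->
  forall x y, lin_span G x y -> lin_span H x y.
Proof.
move=> GH x y; elim=> [|c u v u' v' Guv _ IH]; first exact: LinSpan0.
by apply: LinSpanS => //; apply: GH.
Qed.

(** Zorn runs over sets of additional pairs that keep the span single-valued. For a maximal set the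
    span is total: a vector outside its domain could still be sent to 0. *)
Lemma linear_extension (G : V -> W -> Prop) :
  (forall w, lin_span G 0 w -> w = 0) ->
  exists f : {linear V -> W}, forall x y, G x y -> f x = y.
Proof.
move=> G0.
pose J (A : set (V * W)) x y := G x y \/ A (x, y).
pose P (A : set (V * W)) := forall w, lin_span (J A) 0 w -> w = 0.
have [F FP Ftot|A [PA Amax]] := @Zorn_bigcup _ P.
  (* An element of the span uses finitely many pairs, so one member of the chain carries them all;
     the first alternative, no additional pair used, covers the empty chain. *)
  have H x y : lin_span (J (\bigcup_(X in F) X)%classic) x y ->
      lin_span G x y \/ exists2 X, F X & lin_span (J X) x y.
    elim=> [|c u v u' v' Juv _ IH]; first by left; apply: LinSpan0.
    case: Juv => [Guv|[X FX Xuv]].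
      case: IH => [IH|[X FX IH]]; first by left; apply: LinSpanS.
      by right; exists X => //; apply: LinSpanS => //; left.
    right; case: IH => [IH|[Y FY IH]].
      exists X => //; apply: LinSpanS; first by right.
      by apply: lin_span_sub IH; left.
    have [XY|YX] := Ftot _ _ FX FY.
      by exists Y => //; apply: LinSpanS => //; right; apply: XY.
    exists X => //; apply: LinSpanS; first by right.
    by apply: lin_span_sub IH => x' y' [|/YX]; [left|right].
  by move=> w /H [/G0 //|[X FX]]; apply: FP.
have total x : exists y, lin_span (J A) x y.
  apply: contrapT => nx.
  apply: (Amax (A `|` [set (x, 0)])%classic).
    split=> [u Au|/(_ (x, 0))]; first by left.
    move=> H; apply: nx; exists 0; apply: lin_span_gen; right.
    by apply: H; right.
  have H u v : lin_span (J (A `|` [set (x, 0)])%classic) u v ->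
      exists c u', u = c *: x + u' /\ lin_span (J A) u' v.
    elim=> [|c a b a' b' Jab _ [e [u' [-> IH]]]].
      by exists 0, 0; rewrite scale0r addr0; split=> //; apply: LinSpan0.
    have {}Jab : J A a b \/ (a, b) = (x, 0).
      by case: Jab => [Gab|[Aab|/= ->]]; [left; left|left; right|right].
    case: Jab => [Jab|[-> ->]].
      by exists e, (c *: a + u'); rewrite addrCA; split=> //; apply: LinSpanS.
    by exists (c + e), u'; rewrite scalerDl addrA scaler0 add0r.
  move=> w /H [c [u [cu Ju]]].
  have [c0|c0] := eqVneq c 0.
    by move: cu Ju; rewrite c0 scale0r add0r => <-; apply: PA.
  case: nx; exists (- c^-1 *: w + 0).
  have -> : x = - c^-1 *: u + 0.
    have /eqP := esym cu; rewrite addrC addr_eq0 => /eqP ->.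
    by rewrite addr0 scaleNr scalerN opprK scalerA mulVf // scale1r.
  by apply: lin_span_lin => //; apply: LinSpan0.
pose f x := projT1 (cid (total x)).
have fP x : lin_span (J A) x (f x) by rewrite /f; case: cid.
have fE x y : lin_span (J A) x y -> f x = y.
  move=> Jxy; apply/eqP; rewrite -subr_eq0; apply/eqP/PA.
  have := lin_span_lin (-1) Jxy (fP x).
  by rewrite !scaleN1r addNr [- y + _]addrC.
have flin : linear f by move=> c x y; apply: fE; apply: lin_span_lin.
pose lf := GRing.isLinear.Build _ _ _ _ f flin.
pose g : {linear V -> W} := HB.pack f lf.
by exists g => x y Gxy; apply: fE; apply: lin_span_gen; left.
Qed.

Lemma lin_ofE (G : V -> W -> Prop) x y :
  (forall w, lin_span G 0 w -> w = 0) -> G x y -> lin_of G x = y.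
Proof.
move=> /linear_extension ex; rewrite /lin_of.
by case: pselect => // ex'; case: (cid ex') => /= f; apply.
Qed.

Lemma lin_separation (x y : V) :
  (forall f : {linear V -> k^o}, f x = f y) -> x = y.
Proof.
move=> H; apply/eqP; rewrite -subr_eq0; apply/eqP; apply: contrapT => /eqP n0.
have [f] := functional_neq0 n0.
by rewrite linearB [f x]H subrr => /esym/eqP; rewrite oner_eq0.
Qed.

End LinearExtension.

Section Linear.
Variables (k : fieldType) (V W : lmodType k) (f : V -> W).
Hypothesis lf : linear f.
Lemma lin0 : f 0 = 0.
Proof. by have := lf (-1) 0 0; rewrite scaler0 addr0 scaleN1r addNr. Qed.
Lemma linD x y : f (x + y) = f x + f y.
Proof. by have := lf 1 x y; rewrite !scale1r. Qed.
Lemma linZ c x : f (c *: x) = c *: f x.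
Proof. by have := lf c x 0; rewrite lin0 !addr0. Qed.
Lemma lin_sum I (r : seq I) (P : pred I) (F : I -> V) :
  f (\sum_(i <- r | P i) F i) = \sum_(i <- r | P i) f (F i).
Proof. by elim/big_rec2: _ => [|i x y _ <-]; rewrite ?lin0 ?linD. Qed.
End Linear.

(** The relation inverse to f has a single-valued span because f is injective; extending it replaces
    the choice of a complement of the image. *)
Lemma linear_retraction (k : fieldType) (V W : lmodType k) (f : V -> W) :
  linear f -> injective f -> exists g : {linear W -> V}, cancel f g.
Proof.
move=> lf fI; have [w H|g Hg] := @linear_extension _ _ _ (fun w v => w = f v).
  have {H} : f w = 0.
    elim: H => [|c x y x' y' -> _ <-]; first exact: lin0.
    by rewrite -lf.
  by rewrite -(lin0 lf) => /fI.
by exists g => x; apply: Hg.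
Qed.

(** * Tensor products of linear maps *)

Section TensorMaps.
Variable k : fieldType.
Implicit Types V W X : lmodType k.

Lemma tpureDl V W (x y : V) (b : W) : tpure (x + y) b = tpure x b + tpure y b.
Proof. exact: (linD ((tpure_bilin V W).1 b)). Qed.
Lemma tpureDr V W (a : V) (x y : W) : tpure a (x + y) = tpure a x + tpure a y.
Proof. exact: (linD ((tpure_bilin V W).2 a)). Qed.
Lemma tpureZl V W c (x : V) (b : W) : tpure (c *: x) b = c *: tpure x b.
Proof. exact: (linZ ((tpure_bilin V W).1 b)). Qed.
Lemma tpureZr V W c (a : V) (x : W) : tpure a (c *: x) = c *: tpure a x.
Proof. exact: (linZ ((tpure_bilin V W).2 a)). Qed.
Lemma tpure0l V W (b : W) : tpure (0 : V) b = 0.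
Proof. exact: (lin0 ((tpure_bilin V W).1 b)). Qed.
Lemma tpure0r V W (a : V) : tpure a (0 : W) = 0.
Proof. exact: (lin0 ((tpure_bilin V W).2 a)). Qed.
Lemma tpureNl V W (x : V) (b : W) : tpure (- x) b = - tpure x b.
Proof. by rewrite -scaleN1r tpureZl scaleN1r. Qed.
Lemma tpureNr V W (a : V) (x : W) : tpure a (- x) = - tpure a x.
Proof. by rewrite -scaleN1r tpureZr scaleN1r. Qed.

Lemma tpure_sumr V W I (r : seq I) (F : I -> W) (a : V) :
  tpure a (\sum_(i <- r) F i) = \sum_(i <- r) tpure a (F i).
Proof. exact: (lin_sum ((tpure_bilin V W).2 a)). Qed.

Lemma tens_lin_ext V W X (f g : tens V W -> X) : linear f -> linear g ->
  (forall a b, f (tpure a b) = g (tpure a b)) -> f =1 g.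
Proof.
move=> lf lg H x; elim/tens_ind: x => [|x y IH IH'|//]; first by rewrite !lin0.
by rewrite !linD ?IH ?IH'.
Qed.

Section Map.
Variables (V W V' W' : lmodType k) (f : V -> V') (g : W -> W').
Hypotheses (lf : linear f) (lg : linear g).
Lemma tmap_bilin : bilin (fun v w => tpure (f v) (g w) : tens V' W').
Proof.
by split=> [w|v] c x y; rewrite ?lf ?lg (tpureDl, tpureDr) (tpureZl, tpureZr).
Qed.
Lemma tmap_pure a b : tmap f g (tpure a b) = tpure (f a) (g b).
Proof. exact: (tlift_pure tmap_bilin). Qed.
Lemma tmap_lin : linear (tmap f g).
Proof. exact: (tlift_lin tmap_bilin). Qed.
End Map.

Lemma id_lin V : linear (@id V). Proof. by []. Qed.

Lemma tmap_comp (V W V' W' V2 W2 : lmodType k) (f : V -> V') (g : W -> W')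
    (f' : V' -> V2) (g' : W' -> W2) :
  linear f -> linear g -> linear f' -> linear g' ->
  forall x, tmap f' g' (tmap f g x) = tmap (f' \o f) (g' \o g) x.
Proof.
move=> lf lg lf' lg'.
have c1 : linear (f' \o f) by move=> c x y /=; rewrite lf lf'.
have c2 : linear (g' \o g) by move=> c x y /=; rewrite lg lg'.
apply: tens_lin_ext.
- by move=> c x y; rewrite !tmap_lin.
- exact: tmap_lin.
by move=> a b; rewrite !tmap_pure.
Qed.

Lemma tmap_ext (V W V' W' : lmodType k) (f f' : V -> V') (g g' : W -> W') :
  f =1 f' -> g =1 g' -> tmap f g =1 tmap f' g'.
Proof.
by move=> ef eg x; congr (tmap _ _ x); apply: funext.
Qed.

(** Tensoring retractions of f and g gives a retraction of [tmap f g]. It lets identities between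
    tensors with factors in U^lf be tested in U. *)
Lemma tmap_inj (V W V' W' : lmodType k) (f : V -> V') (g : W -> W') :
  linear f -> linear g -> injective f -> injective g -> injective (tmap f g).
Proof.
move=> lf lg fI gI.
have [f' fK] := linear_retraction lf fI.
have [g' gK] := linear_retraction lg gI.
have f'l : linear f' by move=> c x y; rewrite linearP.
have g'l : linear g' by move=> c x y; rewrite linearP.
apply: (can_inj (g := tmap f' g')) => x; rewrite tmap_comp //.
have -> : f' \o f = id by apply: funext => y /=; rewrite fK.
have -> : g' \o g = id by apply: funext => y /=; rewrite gK.
apply: (tens_lin_ext (g := id)) => //; first exact: tmap_lin.
by move=> a b; rewrite tmap_pure.
Qed.

End TensorMaps.

(** * Sums whose terms depend on an eigenvalue *)

Section EigenDecomposition.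
Variables (k : fieldType) (V W : lmodType k) (kappa : V -> V) (lam : int -> k).
Hypotheses (lkappa : linear kappa) (lamI : injective lam).
Variable s : seq (int * V).
Hypothesis eigen : forall p, p \in s -> kappa p.2 = lam p.1 *: p.2.
Hypothesis sum0 : \sum_(p <- s) p.2 = 0.

Lemma eigen_poly0 (P : {poly k}) : \sum_(p <- s) P.[lam p.1] *: p.2 = 0.
Proof.
have Hn n : \sum_(p <- s) lam p.1 ^+ n *: p.2 = 0.
  elim: n => [|n IH].
    by apply: etrans sum0; apply: eq_bigr => p _; rewrite expr0 scale1r.
  have := congr1 kappa IH; rewrite (lin0 lkappa) (lin_sum lkappa).
  apply: etrans; rewrite !big_seq.
  apply: eq_bigr => p ps; rewrite (linZ lkappa) eigen // scalerA.
  by rewrite -exprSr.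
under eq_bigr do rewrite horner_coef scaler_suml.
rewrite exchange_big big1 //= => i _.
under eq_bigr do rewrite -scalerA.
by rewrite -scaler_sumr Hn scaler0.
Qed.

(** P vanishes at every eigenvalue present except [lam d], so applying P(kappa) to the relation
    leaves a nonzero multiple of the component of eigenvalue [lam d]. *)
Lemma eigen_component0 d : \sum_(p <- s | p.1 == d) p.2 = 0.
Proof.
pose P := \prod_(e <- undup (unzip1 s) | e != d) ('X - (lam e)%:P).
have Pe e : e \in unzip1 s -> e != d -> P.[lam e] = 0.
  move=> es ned; apply/eqP; rewrite /P horner_prod prodf_seq_eq0.
  apply/hasP; exists e; first by rewrite mem_undup.
  by rewrite ned hornerXsubC subrr eqxx.
have Pd : P.[lam d] != 0.
  rewrite /P horner_prod prodf_seq_neq0; apply/allP => e _; apply/implyP => ned.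
  by rewrite hornerXsubC subr_eq0 (inj_eq lamI) eq_sym.
have := eigen_poly0 P; rewrite (bigID (fun p => p.1 == d)) /=.
rewrite [X in _ + X]big_seq_cond [X in _ + X]big1 ?addr0 => [|p /andP[ps np]].
  rewrite (eq_bigr (fun p => P.[lam d] *: p.2)) => [|p /eqP -> //].
  rewrite -scaler_sumr => /eqP; rewrite scaler_eq0 (negPf Pd) /=.
  by move/eqP.
by rewrite Pe ?scale0r // map_f.
Qed.

(** This makes sums with terms depending on degrees, as in phi and bDelta, independent of the chosen
    expression: [M d] acts on the component of degree d, and every component of 0 vanishes. *)
Lemma eigen_map0 (M : int -> V -> W) : (forall d, linear (M d)) ->
  \sum_(p <- s) M p.1 p.2 = 0.
Proof.
move=> lM; pose D := undup (unzip1 s).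
transitivity (\sum_(p <- s) \sum_(d <- D | p.1 == d) M d p.2).
  rewrite !big_seq; apply: eq_bigr => p ps.
  have pD : p.1 \in D by rewrite mem_undup map_f.
  rewrite (eq_bigl (pred1 p.1)) => [|d]; last by rewrite eq_sym.
  by rewrite -big_filter filter_pred1_uniq ?undup_uniq // big_seq1.
rewrite (exchange_big_dep predT) //= big1 // => d _.
by rewrite -(lin_sum (lM d)) eigen_component0 (lin0 (lM d)).
Qed.
End EigenDecomposition.

(** [field] asks for nonzero denominators in polynomial form. *)
Lemma sub_inv_neq0 (k : fieldType) (x : k) :
  x != 0 -> x - x^-1 != 0 -> x * x - 1 != 0.
Proof.
move=> x0; apply: contraNneq => H.
have -> : x - x^-1 = x^-1 * (x * x - 1) by rewrite mulrBr mulr1 mulrA mulVf ?mul1r.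
by rewrite H mulr0.
Qed.

(* Stated in the normal form to which u_rec reduces. *)
Lemma u_rec_coef (k : fieldType) (q x a b c : k) :
  q != 0 -> q - q^-1 != 0 -> a != 0 -> x != 0 -> q * x - (q * x)^-1 != 0 ->
  (1 - (q * x)^-1 / (q * x)) *
  (c * x * ((q - q^-1) * b) *
   (a^-1 * ((q * x - (q * x)^-1)^-1 / (q - q^-1)^-1))) =
  q^-1 * ((q - q^-1) * ((q - q^-1) * (q - q^-1) ^+ 0)) * (c * b / a).
Proof.
move=> q0 Q a0 x0 X; have Q0 := sub_inv_neq0 q0 Q.
have X0 : q * x * (q * x) - 1 != 0 by rewrite sub_inv_neq0 ?mulf_neq0.
by field; rewrite a0 q0 Q0 x0 X0.
Qed.

Lemma tpow_lin_ext (k : fieldType) (V X : lmodType k) m (f g : tpow V m.+1 -> X) :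
  linear f -> linear g -> (forall a b, f (tpure a b) = g (tpure a b)) -> f =1 g.
Proof. exact: tens_lin_ext. Qed.

Lemma sums_toP (V : zmodType) (s : nat -> V) v : sums_to s v ->
  exists N, forall n, (N <= n)%N -> v = \sum_(i < n) s i.
Proof.
move=> [N sN ->]; exists N => n leNn; rewrite -(subnK leNn).
elim: (n - N)%N => [//|m IH]; rewrite addSn big_ord_recr /= -IH sN ?addr0 //.
exact: leq_addl.
Qed.

Section GradedSum.
Variables (k : fieldType) (V W : lmodType k) (kappa : V -> V) (lam : int -> k).
Hypotheses (lkappa : linear kappa) (lamI : injective lam).
Variable M : nat -> int -> V -> W.
Hypothesis lM : forall i d, linear (M i d).

(** A linear relation containing the graph of phi and, after [Delta_lf] on the argument and the
    inclusion on the value, that of bDelta. The equation is demanded for all large n so that two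
    truncation bounds can be merged into their maximum. *)
Definition graded_sum (x : V) (y : W) : Prop :=
  exists s : seq (int * V),
    [/\ forall p, p \in s -> kappa p.2 = lam p.1 *: p.2,
        x = \sum_(p <- s) p.2 &
        exists N, forall n, (N <= n)%N ->
          y = \sum_(i < n) \sum_(p <- s) M i p.1 p.2].

Lemma graded_sum_nil : graded_sum 0 0.
Proof.
exists [::]; split=> //; first by rewrite big_nil.
by exists 0%N => n _; rewrite big1 // => i _; rewrite big_nil.
Qed.

Lemma graded_sum_lin c x y x' y' :
  graded_sum x y -> graded_sum x' y' -> graded_sum (c *: x + x') (c *: y + y').
Proof.
move=> [s [Hs -> [N HN]]] [s' [Hs' -> [N' HN']]].
exists ([seq (p.1, c *: p.2) | p <- s] ++ s'); split.
- move=> p; rewrite mem_cat => /orP[/mapP[p' /Hs H ->]|/Hs' //] /=.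
  by rewrite (linZ lkappa) H !scalerA mulrC.
- by rewrite big_cat big_map scaler_sumr.
exists (maxn N N') => n; rewrite geq_max => /andP[/HN -> /HN' ->].
rewrite scaler_sumr -big_split; apply: eq_bigr => i _ /=.
rewrite big_cat big_map scaler_sumr; congr (_ + _).
by apply: eq_bigr => p _; rewrite (linZ (lM _ _)).
Qed.

Lemma graded_sum0 y : graded_sum 0 y -> y = 0.
Proof.
move=> [s [Hs s0 [N HN]]]; rewrite (HN N) // big1 // => i _.
exact: (eigen_map0 lkappa lamI Hs (esym s0)).
Qed.
End GradedSum.

Section TriangleSum.
Variable V : zmodType.

Lemma sum_ord_zero_tail (f : nat -> V) m n : (n <= m)%N ->
  (forall i, (n <= i)%N -> f i = 0) -> \sum_(i < m) f i = \sum_(i < n) f i.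
Proof.
move=> /subnK <- f0; elim: (m - n)%N => [//|p IH].
by rewrite addSn big_ord_recr /= IH f0 ?addr0 // leq_addl.
Qed.

(** Cauchy product of two finitely supported families; the bound N + M is the index at which [u_]
    annihilates a product in [u_mul_nilp]. *)
Lemma sum_triangle (f : nat -> nat -> V) N M :
  (forall i j, (N <= i)%N || (M <= j)%N -> f i j = 0) ->
  \sum_(n < N + M) \sum_(i < n.+1) f i (n - i)%N = \sum_(i < N) \sum_(j < M) f i j.
Proof.
move=> f0; transitivity (\sum_(i < N + M) \sum_(j < N + M - i) f i j).
  elim: (N + M)%N => [|P IH]; first by rewrite !big_ord0.
  rewrite big_ord_recr IH /=.
  transitivity (\sum_(i < P.+1) (\sum_(j < P - i) f i j + f i (P - i)%N)).
    rewrite big_split /=; congr (_ + _).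
    by rewrite [RHS]big_ord_recr /= subnn big_ord0 addr0.
  apply: eq_bigr => -[i lti] _ /=; rewrite subSn //.
  by rewrite big_ord_recr.
rewrite (@sum_ord_zero_tail (fun i => \sum_(j < N + M - i) f i j) _ N) ?leq_addr //.
  apply: eq_bigr => -[i lti] _ /=; apply: sum_ord_zero_tail => [|j Mj].
    by rewrite addnC -addnBA ?leq_addr // ltnW.
  by rewrite f0 // Mj orbT.
by move=> i Ni; rewrite big1 // => j _; rewrite f0 // Ni.
Qed.
End TriangleSum.

(** A linear form is presented as a bare function with its equations, so that its values on atoms
    can afterwards be generalized to scalars. *)
Lemma lin_separation_scalar (k : fieldType) (V : lmodType k) (x y : V) :
  (forall f : V -> k, (forall u v, f (u + v) = f u + f v) ->
     (forall c u, f (c *: u) = c * f u) -> (forall u, f (- u) = - f u) ->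
     f 0 = 0 -> f x = f y) -> x = y.
Proof.
move=> H; apply: lin_separation => f; apply: (H f) => [u v|c u|u|].
- by rewrite linearD.
- by rewrite linearZ.
- by rewrite linearN.
- by rewrite linear0.
Qed.

Ltac push_linear f fD fZ fN f0 :=
  let y := fresh "y" in let H := fresh "H" in
  let subst_value t pf r :=
    (assert (H : t = r) by exact pf; revert H; generalize t; intros y H; subst y) in
  repeat match goal with
  | |- context [f (@Algebra.add ?S ?u ?v)] =>
      subst_value (f (@Algebra.add S u v)) (fD u v) (f u + f v)
  | |- context [f (@GRing.scale ?S ?T ?c ?u)] =>
      subst_value (f (@GRing.scale S T c u)) (fZ c u) (c * f u)
  | |- context [f (@Algebra.opp ?S ?u)] =>
      subst_value (f (@Algebra.opp S u)) (fN u) (- f u)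
  | |- context [f (@Algebra.zero ?S)] =>
      assert (H : f (@Algebra.zero S) = 0) by exact f0;
      revert H; generalize (f (@Algebra.zero S)); intros y H; subst y
  end.

(* Reduces an identity between linear combinations to one between scalars by
   applying an arbitrary linear form; the matching is purely syntactic, since
   unification would unfold the operations of the quotient types. *)
Ltac lin_eq_with tac :=
  apply: lin_separation_scalar;
  let f := fresh "f" in let fD := fresh "fD" in let fZ := fresh "fZ" in
  let fN := fresh "fN" in let f0 := fresh "f0" in
  move=> f fD fZ fN f0; push_linear f fD fZ fN f0; clear fD fZ fN f0;
  repeat match goal with |- context [f ?x] =>
    let y := fresh "y" in generalize (f x); intro y end;
  tac.

Ltac q_field :=
  repeat match goal with H : is_true (_ - _^-1 != 0) |- _ =>
    apply sub_inv_neq0 in H; [|assumption] end;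
  field; rewrite ?andbT; repeat (apply/andP; split); try by [].

Ltac lin_eq_k := lin_eq_with q_field.

(** * Identities in the quantum group *)

Section QuantumGroupIdentities.
Variables (k : fieldType) (q : k).
Hypotheses (q0 : q != 0) (q1 : q - q^-1 != 0).
Local Notation U := (Uq q).
Local Notation K := (uK q).
Local Notation Ki := (uKi q).
Local Notation E := (uE q).
Local Notation F := (uF q).
Local Notation eta := (q^-1 * (q - q^-1) ^+ 2).

Lemma mEF (x : U) :
  x * E * F = x * F * E + (q - q^-1)^-1 *: (x * K) - (q - q^-1)^-1 *: (x * Ki).
Proof. by rewrite -mulrA EF mulrDr mulrA -scalerAr mulrBr scalerBr addrA. Qed.

(* Stated on U so that all products refer to one and the same ring structure. *)
Lemma mulrZ_U c (x y : U) : x * (c *: y) = c *: (x * y).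
Proof. exact/esym/scalerAr. Qed.
Lemma mulZr_U c (x y : U) : c *: x * y = c *: (x * y).
Proof. exact/esym/scalerAl. Qed.

(** Oriented towards the order F, E, K of a PBW basis. Each relation also occurs behind a prefix,
    since products are associated to the left. *)
Definition U_nf := ((KKi q, KiK q, @mKKi _ q, @mKiK _ q),
  (KE q, KF q, EF q, KiE q0, KiF q0),
  (@mKE _ q, @mKF _ q, mEF, @mKiE _ q q0, @mKiF _ q q0),
  (@mulr1 U, @mul1r U, @scalerA _ U),
  (@mulrDl U, @mulrDr U, @mulNr U, @mulrN U, @mulrA U),
  (mulrZ_U, mulZr_U),
  (@scalerDr _ U, @scalerN _ U)).

Lemma ad_E_FK : ad E (F * K) = - (q / (q - q^-1)) *: casimir q +
  ((q ^+ 2 + 1) / (q - q^-1)) *: K.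
Proof.
rewrite ad_E // /casimir !U_nf.
lin_eq_k.
Qed.

Lemma KF2 : K * F ^+ 2 = q ^- 4 *: (F ^+ 2 * K).
Proof. by rewrite !expr2 !U_nf; lin_eq_k. Qed.

(* With D this element, put L = ((K, FK), (q^-2 eta E, D)): the braided coproduct
   is comultiplication of this matrix, Delta(L_ij) = sum_k L_ik (x) L_kj, and
   Lambda = q D + q^-1 K is its quantum trace. *)
Definition casimir_entry : U := q^-1 *: casimir q - q ^- 2 *: K.

Lemma casimir_entryE : casimir_entry = Ki + eta *: (E * F).
Proof.
rewrite /casimir_entry /casimir EF.
lin_eq_k.
Qed.

Lemma antipode_K : antipode K = Ki. Proof. exact: (antipode_ugen q0 gK). Qed.
Lemma antipode_Ki : antipode Ki = K. Proof. exact: (antipode_ugen q0 gKi). Qed.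
Lemma antipode_F : antipode F = - q ^- 2 *: (F * K).
Proof.
by rewrite scaleNr -KF; exact: (antipode_ugen q0 gF).
Qed.

Lemma antipode_KF : antipode (K * F) = - q ^- 2 *: F.
Proof. by rewrite (antipodeM q0) antipode_F antipode_K -scalerAl mKKi. Qed.

Lemma antipode_KF2 : antipode (K * F ^+ 2) = q ^- 6 *: (F ^+ 2 * K).
Proof.
rewrite expr2 !(antipodeM q0) antipode_F antipode_K !U_nf.
lin_eq_k.
Qed.

Lemma FKF : F * K * F = q ^- 2 *: (F ^+ 2 * K).
Proof. by rewrite expr2 mKF. Qed.
Lemma KiE_FFK : Ki * E * (F ^+ 2 * K) = q ^+ 2 *: (E * F * F).
Proof. by rewrite expr2 !U_nf; lin_eq_k. Qed.
Lemma KiE_FK : Ki * E * (F * K) = E * F.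
Proof. by rewrite !U_nf; lin_eq_k. Qed.
Lemma KiE_K : Ki * E * K = q ^- 2 *: E.
Proof. by rewrite !U_nf; lin_eq_k. Qed.

Lemma tpureM_U (a b c d : U) :
  (tpure a b : tens U U) * tpure c d = tpure (a * c) (b * d).
Proof. exact: tensM. Qed.

(** The terms are grouped so that the right factors are the entries D, K, E, FK of L, up to
    scalars. *)
Lemma Delta_casimir_entry : Delta casimir_entry =
  tpure Ki casimir_entry + tpure (eta *: (E * F)) K
  + (tpure (eta *: F) E + tpure (eta *: (Ki * E)) (F * K)).
Proof.
have L := Delta_lin q0.
have DE : Delta E = tpure E K + tpure 1 E := Delta_ugen q0 gE.
have DF : Delta F = tpure F 1 + tpure Ki F := Delta_ugen q0 gF.
have DKi : Delta Ki = tpure Ki Ki := Delta_ugen q0 gKi.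
rewrite {1}casimir_entryE (linD L) (linZ L) (DeltaM q0) DE DF DKi casimir_entryE.
rewrite mulrDr !mulrDl !tpureM_U !mulr1 !mul1r KF (KiE q0).
rewrite !(tpureDl, tpureDr, tpureZl, tpureZr).
lin_eq_k.
Qed.

Lemma KKF : K * K * F = q ^- 4 *: (F * K * K).
Proof. by rewrite !U_nf; lin_eq_k. Qed.
Lemma KKFF : K * K * F ^+ 2 = q ^- 8 *: (F ^+ 2 * K * K).
Proof. by rewrite expr2 !U_nf; lin_eq_k. Qed.
Lemma FKKF : F * K * K * F = q ^- 4 *: (F ^+ 2 * K * K).
Proof. by rewrite expr2 !U_nf; lin_eq_k. Qed.
Lemma EKF : E * K * F = q ^- 2 *: (E * F * K).
Proof. exact: mKF. Qed.
Lemma EKFF : E * K * F ^+ 2 = q ^- 4 *: (E * F * F * K).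
Proof. by rewrite expr2 !U_nf; lin_eq_k. Qed.
Lemma casimir_entry_K : casimir_entry * K = (1 : U) + eta *: (E * F * K).
Proof. by rewrite casimir_entryE mulrDl KiK -scalerAl. Qed.
Lemma casimir_entry_KF :
  casimir_entry * K * F = F + (q ^- 2 * eta) *: (E * F * F * K).
Proof. by rewrite casimir_entryE !U_nf; lin_eq_k. Qed.

End QuantumGroupIdentities.

Lemma quartic_neq0 (k : fieldType) (x : k) :
  x * x - 1 != 0 -> x * x + 1 != 0 -> x ^+ 2 ^+ 2 - 1 != 0.
Proof.
move=> h1 h2; have -> : x ^+ 2 ^+ 2 - 1 = (x * x - 1) * (x * x + 1) by ring.
by rewrite mulf_neq0.
Qed.

Lemma tpow_pure_ext (k : fieldType) (V : lmodType k) m (f g : nat -> V) :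
  (forall i, (i <= m)%N -> f i = g i) -> tpow_pure m f = tpow_pure m g.
Proof.
elim: m f g => [|m IH] f g H /=; first exact: H.
by rewrite H // (IH _ (fun j => g j.+1)) // => i im; apply: H.
Qed.

Lemma tpow_pure_lin_ext (k : fieldType) (V X : lmodType k) m (f g : tpow V m -> X) :
  linear f -> linear g -> (forall h, f (tpow_pure m h) = g (tpow_pure m h)) ->
  f =1 g.
Proof.
elim: m f g => [|m IH] f g lf lg H; first by move=> x; exact: (H (fun=> x)).
apply: (tpow_lin_ext lf lg) => a b; move: b.
apply: (IH (fun b => f (tpure a b)) (fun b => g (tpure a b))).
- by move=> c x y; rewrite tpureDr tpureZr; apply: lf.
- by move=> c x y; rewrite tpureDr tpureZr; apply: lg.
by move=> h; apply: (H (fun j => if j is j'.+1 then h j' else a)).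
Qed.

(** * The locally finite part *)

Section OverCq.
Variable R : realType.
Local Notation q := (q R).
Local Notation U := (Uq q).
Local Notation K := (uK q).
Local Notation Ki := (uKi q).
Local Notation E := (uE q).
Local Notation F := (uF q).
Local Notation D := (casimir_entry q).
Local Notation Ulf := (Ulf R).
Local Notation Elf := (Elf R).
Local Notation FKlf := (FKlf R).
Local Notation Klf := (Klf R).
Local Notation Lambda := (Lambda R).
Local Notation u_ := (@u_ R).
Local Notation v_ := (@v_ R).
#[local] Hint Resolve id_lin : core.
#[local] Hint Extern 0 (is_true (Defs.q _ != 0)) => exact: q_neq0 : core.

(** * q is not a root of unity *)

Lemma q_unity n : q ^+ n = 1 -> n = 0%N.
Proof.
rewrite /Defs.q -tofracXn -tofrac1 => /eqP; rewrite tofrac_eq => /eqP.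
by move/(congr1 (fun p => size (polyseq p))); rewrite size_polyXn size_poly1 => -[].
Qed.

(* Otherwise [//] tries to compute in the fraction field. *)
#[local] Opaque Defs.q.

Lemma q_expI : injective (fun d : int => (q ^+ 2) ^ d).
Proof.
have q20 : q ^+ 2 != 0 by rewrite expf_neq0 ?q_neq0.
have H (d : int) : (q ^+ 2) ^ d = 1 -> d = 0.
  have Hn n : (q ^+ 2) ^+ n = 1 -> n = 0%N.
    by rewrite -exprM => /q_unity /eqP; rewrite muln_eq0 /= => /eqP.
  case: d => n; first by move/Hn ->.
  by rewrite NegzE -exprnN -invr1 => /invr_inj /Hn.
move=> d e /= Hde; apply/eqP; rewrite -subr_eq0; apply/eqP/H.
by rewrite expfzDr // Hde -expfzDr // subrr.
Qed.

Lemma q2V_neq1 n : 1 - (q ^- 2) ^+ n.+1 != 0.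
Proof.
rewrite subr_eq0 eq_sym exprVn; apply/eqP => H.
have /q_unity : q ^+ (2 * n.+1) = 1.
  by rewrite exprM; apply: (can_inj invrK); rewrite H invr1.
by rewrite mulnS.
Qed.

Lemma qint_neq0 n : qint R n.+1 != 0.
Proof.
rewrite /qint mulf_neq0 ?invr_neq0 ?q_qV_neq0 //.
have -> : q ^+ n.+1 - q ^- n.+1 = q ^+ n.+1 * (1 - (q ^- 2) ^+ n.+1).
  rewrite mulrBr mulr1 exprVn -exprM mulSn mul1n exprD invfM mulrA.
  by rewrite mulfV ?mul1r // expf_neq0 ?q_neq0.
by rewrite mulf_neq0 ?q2V_neq1 ?expf_neq0 ?q_neq0.
Qed.

Lemma qfact_neq0 n : qfact R n != 0.
Proof.
rewrite /qfact big_add1 big_mkord; apply/prodf_neq0 => i _; exact: qint_neq0.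
Qed.

Definition eta : Cq R := q^-1 * (q - q^-1) ^+ 2.

Lemma eta_neq0 : eta != 0.
Proof. by rewrite mulf_neq0 ?invr_neq0 ?expf_neq0 ?q_neq0 ?q_qV_neq0. Qed.

Lemma u_0 : u_ 0 = 1.
Proof.
by rewrite /u_ /qfact big_geq // invr1 !expr0 !mulr1 scale1r.
Qed.

(** The ratio of [u_ i.+1] to E [u_ i] is q^i (q - q^-1) / [i+1], and [i+1] (q - q^-1) = q^(i+1) (1
    - q^(-2i-2)). Below, [u_] enters only through [u_0] and this recursion. *)
Lemma u_rec i : (1 - (q ^- 2) ^+ i.+1) *: u_ i.+1 = eta *: (E * u_ i).
Proof.
rewrite /u_ -scalerAr -exprS !scalerA; congr (_ *: _).
have -> : (i.+1 * i.+1.-1)./2 = ((i * i.-1)./2 + i)%N.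
  case: i => [//|i]; rewrite -[i.+2.-1]/i.+1 -[i.+1.-1]/i.
  have -> : (i.+2 * i.+1 = i.+1 * i + i.+1.*2)%N.
    by rewrite -muln2 -mulnDr mulnC addn2.
  by rewrite halfD odd_double andbF doubleK.
have -> : qfact R i.+1 = qfact R i * qint R i.+1.
  by rewrite /qfact big_nat_recr.
have f0 := qfact_neq0 i; have i0 := qint_neq0 i; move: i0.
rewrite /qint /eta exprVn -exprM mulSn mul1n !exprD !invfM !exprS.
have x0 : q ^+ i != 0 by rewrite expf_neq0 ?q_neq0.
have q0 := q_neq0 R; have qq := q_qV_neq0 R.
move: (qfact R i) (q ^+ i) ((q - q^-1) ^+ i) (q ^+ (i * i.-1)./2) f0 x0.
move=> a x b c a0 x0 i0.
apply: (@u_rec_coef (Cq R) q x a b c q0 qq a0 x0).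
by apply: contraNneq i0 => ->; rewrite mul0r.
Qed.

Lemma ulf_lin : linear (@ulf_val R). Proof. by []. Qed.
Lemma ulf_inj : injective (@ulf_val R). Proof. exact: val_inj. Qed.

(** * The action of U on tensor powers, and degrees as eigenvalues of K *)

Lemma adlf_linl x : linear (fun h : U => adlf h x).
Proof.
by move=> c g h; apply: ulf_inj; rewrite ulf_lin; exact: (ad_linl (q_neq0 R)).
Qed.
Lemma adlf_linr (h : U) : linear (@adlf R h).
Proof.
by move=> c x y; apply: ulf_inj; rewrite ulf_lin; exact: (ad_linr (q_neq0 R)).
Qed.

#[local] Hint Resolve ulf_lin adlf_linr : core.

Lemma adlf1 x : adlf (1 : U) x = x.
Proof. by apply: ulf_inj; exact: (ad1 (q_neq0 R)). Qed.
Lemma adlfM (g h : U) x : adlf (g * h) x = adlf g (adlf h x).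
Proof. by apply: ulf_inj; exact: (adM (q_neq0 R)). Qed.

Lemma act_bilin m : (forall t, linear (fun h : U => @act R m h t)) /\
  (forall h : U, linear (@act R m h)).
Proof.
elim: m => [|m [IHl IHr]] /=; first by split; [apply: adlf_linl|apply: adlf_linr].
have ml (h1 h2 : U) : linear (tmap (@adlf R h1) (@act R m h2)).
  by apply: tmap_lin; [apply: adlf_linr|apply: IHr].
have B t : bilin (fun h1 h2 : U => tmap (@adlf R h1) (@act R m h2) t).
  split=> [h2|h1] c g h; elim/tens_ind: t => [|x y IH IH'|a b] /=.
  - by rewrite !(lin0 (ml _ _)) scaler0 addr0.
  - by rewrite !(linD (ml _ _)) IH IH' scalerDr addrACA.
  - by rewrite !tmap_pure // adlf_linl tpureDl tpureZl.
  - by rewrite !(lin0 (ml _ _)) scaler0 addr0.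
  - by rewrite !(linD (ml _ _)) IH IH' scalerDr addrACA.
  - by rewrite !tmap_pure // IHl tpureDr tpureZr.
split=> [t|h] c x y.
  by rewrite (Delta_lin (q_neq0 R)) (tlift_lin (B t)).
elim/tens_ind: (Delta h) => [|z z' IH IH'|a b].
- by rewrite !(lin0 (tlift_lin (B _))) scaler0 addr0.
- by rewrite !(linD (tlift_lin (B _))) IH IH' scalerDr addrACA.
by rewrite !tlift_pure // ml.
Qed.

Lemma act_linl m t : linear (fun h : U => @act R m h t).
Proof. exact: (act_bilin m).1. Qed.
Lemma act_linr m (h : U) : linear (@act R m h).
Proof. exact: (act_bilin m).2. Qed.

#[local] Hint Resolve act_linr : core.

Lemma act_pure_bilin m (a : Ulf) (b : tpow Ulf m) :
  bilin (fun h1 h2 : U => tpure (adlf h1 a) (act h2 b)).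
Proof.
split=> [h2|h1] c g h /=; first by rewrite adlf_linl tpureDl tpureZl.
by rewrite act_linl tpureDr tpureZr.
Qed.

Lemma act_pure m (h : U) (a : Ulf) (b : tpow Ulf m) :
  act (m := m.+1) h (tpure a b) =
  tlift (fun h1 h2 : U => tpure (adlf h1 a) (act h2 b)) (Delta h).
Proof.
rewrite /=; congr tlift; apply: funext => h1; apply: funext => h2.
by rewrite tmap_pure.
Qed.

Lemma actM m (g h : U) (t : tpow Ulf m) : act (g * h) t = act g (act h t).
Proof.
elim: m g h t => [|m IH] g h t; first exact: adlfM.
have lgh : linear (fun t => act (m := m.+1) g (act h t)).
  by move=> c x y; rewrite !act_linr.
move: t; apply: (tpow_lin_ext (act_linr _) lgh) => a b.
rewrite !act_pure DeltaM //.
have B := act_pure_bilin a b.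
elim/tens_ind: (Delta h) => [|z z' IHz IHz'|h1 h2].
- by rewrite mulr0 !(lin0 (tlift_lin B)) (lin0 (act_linr g)).
- by rewrite mulrDr !(linD (tlift_lin B)) (linD (act_linr g)) IHz IHz'.
rewrite (tlift_pure B); cbv beta; rewrite act_pure.
have B' := act_pure_bilin (adlf h1 a) (act h2 b).
elim/tens_ind: (Delta g) => [|z z' IHz IHz'|g1 g2].
- by rewrite mul0r (lin0 (tlift_lin B)) (lin0 (tlift_lin B')).
- by rewrite mulrDl (linD (tlift_lin B)) (linD (tlift_lin B')) IHz IHz'.
by rewrite tensM !tlift_pure // adlfM IH.
Qed.

Lemma act1 m (t : tpow Ulf m) : act (1 : U) t = t.
Proof.
elim: m t => [|m IH] t; first exact: adlf1.
move: t; apply: (tpow_lin_ext (act_linr _) (@id_lin _ _)) => a b.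
rewrite act_pure Delta1 // tlift_pure ?adlf1 ?IH //.
exact: act_pure_bilin.
Qed.

Lemma Delta_K : Delta K = tpure K K. Proof. exact: Delta_ugen. Qed.
Lemma Delta_E : Delta E = tpure E K + tpure 1 E.
Proof. exact: Delta_ugen. Qed.
Lemma Delta_F : Delta F = tpure F 1 + tpure (uKi q) F.
Proof. exact: Delta_ugen. Qed.

Lemma act_K_pure m (a : Ulf) (b : tpow Ulf m) :
  act (m := m.+1) K (tpure a b) = tpure (adlf K a) (act K b).
Proof.
by rewrite act_pure Delta_K tlift_pure //; apply: act_pure_bilin.
Qed.

Lemma act_E_pure m (a : Ulf) (b : tpow Ulf m) :
  act (m := m.+1) E (tpure a b) = tpure (adlf E a) (act K b) + tpure a (act E b).
Proof.
have B := act_pure_bilin a b.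
by rewrite act_pure Delta_E tliftD // !tlift_pure // adlf1.
Qed.

Lemma homogU_K d (x : U) : homogU d x -> K * x = (q ^+ 2) ^ d *: (x * K).
Proof.
have q2 : q ^+ 2 != 0 by rewrite expf_neq0 ?q_neq0.
elim=> [||||||{}d c {}x y _ IH _ IH'|{}d e {}x y _ IH _ IH'].
- by rewrite mulr1 mul1r scale1r.
- by rewrite scale1r.
- by rewrite KKi KiK scale1r.
- exact: KE.
- exact: KF.
- by move=> ?; rewrite mulr0 mul0r scaler0.
- by rewrite mulrDr mulrDl -scalerAl -scalerAr IH IH' scalerDr !scalerA mulrC.
- rewrite mulrA IH -scalerAl -(mulrA x K) IH' -scalerAr scalerA mulrA.
  by rewrite expfzDr.
Qed.

Lemma homog_adK d (x : Ulf) : homogU d (ulf_val x) -> adlf K x = (q ^+ 2) ^ d *: x.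
Proof.
move=> /homogU_K H; apply: ulf_inj.
rewrite (linZ ulf_lin) -[ulf_val (adlf K x)]/(ad K (ulf_val x)).
by rewrite (ad_K (q_neq0 R)) H -scalerAl mKKi.
Qed.

Lemma homog_K m d (t : tpow Ulf m) : homog d t -> act K t = (q ^+ 2) ^ d *: t.
Proof.
have q2 : q ^+ 2 != 0 by rewrite expf_neq0 ?q_neq0.
elim: m d t => [|m IH] d t; first exact: homog_adK.
move=> [s [Hs ->]]; rewrite (lin_sum (act_linr K)) scaler_sumr !big_seq.
apply: eq_bigr => -[[e a] b] /Hs[Ha Hb].
rewrite act_K_pure (homog_adK Ha) (IH _ _ Hb) tpureZl tpureZr scalerA.
by rewrite -expfzDr // addrC subrK.
Qed.

Lemma homog_lin m d c (x y : tpow Ulf m) :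
  homog d x -> homog d y -> homog d (c *: x + y).
Proof.
case: m x y => [|m] x y; first exact: HomogLin.
move=> [s [Hs ->]] [s' [Hs' ->]].
exists ([seq (p.1.1, c *: p.1.2, p.2) | p <- s] ++ s'); split.
  move=> e a b; rewrite mem_cat => /orP[|/Hs' //].
  move=> /mapP[[[e' a'] b'] /Hs[Ha Hb] [-> -> ->]]; split=> //.
  by have := HomogLin c Ha (HomogZero R e'); rewrite addr0.
rewrite big_cat big_map scaler_sumr; congr (_ + _).
by apply: eq_bigr => p _; rewrite tpureZl.
Qed.

Lemma homog_pure m d e (a : Ulf) (b : tpow Ulf m) :
  homogU e (ulf_val a) -> homog d b -> homog (m := m.+1) (e + d) (tpure a b).
Proof.
move=> Ha Hb; exists [:: (e, a, b)]; split; last by rewrite big_seq1.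
by move=> e' a' b'; rewrite inE => /eqP[-> -> ->]; rewrite addrC addKr.
Qed.

(** * Evaluating Delta, phi and bDelta *)

Lemma tmap_ulf_r_inj : injective (tmap (@id U) (@ulf_val R)).
Proof. by apply: tmap_inj => //; apply: ulf_inj. Qed.
Lemma tmap_ulf_l_inj : injective (tmap (@ulf_val R) (@id Ulf)).
Proof. by apply: tmap_inj => //; apply: ulf_inj. Qed.

(** Two candidates for y agree because U (x) U^lf embeds in U (x) U. *)
Lemma Delta_lfE x (y : tens U Ulf) :
  tmap id (@ulf_val R) y = Delta (ulf_val x) -> Delta_lf R x = y.
Proof.
apply: (lin_ofE (G := @Delta_lf_graph R)) => w H.
apply: tmap_ulf_r_inj.
rewrite (lin0 (tmap_lin (@id_lin _ U) ulf_lin)).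
transitivity (Delta (ulf_val (0 : Ulf))); last exact: lin0 (Delta_lin (q_neq0 R)).
elim: H => [|c x0 y0 x' y' H _ IH].
  by rewrite (lin0 (tmap_lin _ _)) // (lin0 (Delta_lin (q_neq0 R))).
rewrite tmap_lin // IH H (ulf_lin c x0 x').
by rewrite (Delta_lin (q_neq0 R)).
Qed.

Definition qdeg (d : int) : Cq R := (q ^+ 2) ^ d.

Definition phi_term m (i : nat) (d : int) :
    tens Ulf (tpow Ulf m) -> tens U (tpow Ulf m) :=
  tmap (fun a => ulf_val a * uKz q (i%:Z + d) * v_ i) (act (u_ i)).

Lemma phi_factor_lin i d : linear (fun a : Ulf => ulf_val a * uKz q (i%:Z + d) * v_ i).
Proof. by move=> c x y; rewrite ulf_lin !mulrDl -!scalerAl. Qed.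

Lemma phi_term_lin m i d : linear (@phi_term m i d).
Proof. by apply: tmap_lin; [exact: phi_factor_lin|exact: act_linr]. Qed.

Lemma phiE m (a : Ulf) d (b : tpow Ulf m) y : homog d b ->
  sums_to (fun i => tpure (ulf_val a * uKz q (i%:Z + d) * v_ i) (act (u_ i) b)) y ->
  phi R m (tpure a b) = y.
Proof.
move=> hb sy; apply: (lin_ofE (G := @phi_graph R m)); last by exists a, b, d.
(* K acts on the second factor only, because d is the degree of b alone. *)
have lk : linear (tmap (@id Ulf) (@act R m K)) by apply: tmap_lin.
move=> w H; apply: (graded_sum0 lk q_expI (@phi_term_lin m)).
elim: H => [|c x0 y0 x' y' [a' [b' [d' [hb' -> /sums_toP[N HN]]]]] _ IH].
  exact: graded_sum_nil.
apply: graded_sum_lin IH => //; first exact: phi_term_lin.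
exists [:: (d', tpure a' b')]; split.
- move=> p; rewrite inE => /eqP -> /=.
  by rewrite tmap_pure // (homog_K hb') tpureZr.
- by rewrite big_seq1.
exists N => n /HN ->; apply: eq_bigr => i _; rewrite big_seq1 /=.
by rewrite /phi_term tmap_pure //; exact: phi_factor_lin.
Qed.

Definition bDelta_term (i : nat) (d : int) : tens U Ulf -> tens U Ulf :=
  tmap (fun a => a * antipode (uKz q (i%:Z + d) * v_ i)) (adlf (u_ i)).

Lemma bDelta_factor_lin i d :
  linear (fun a : U => a * antipode (uKz q (i%:Z + d) * v_ i)).
Proof. by move=> c x y; rewrite !mulrDl -!scalerAl. Qed.

Lemma bDelta_term_lin i d : linear (@bDelta_term i d).
Proof. by apply: tmap_lin; [exact: bDelta_factor_lin|exact: adlf_linr]. Qed.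

Lemma bDeltaE x z : @bDelta_graph R x z -> bDelta R x = z.
Proof.
apply: (lin_ofE (G := @bDelta_graph R)) => w H.
have li : linear (tmap (@ulf_val R) (@id Ulf)) by apply: tmap_lin.
apply: tmap_ulf_l_inj.
rewrite (lin0 li).
have lk : linear (tmap (@id U) (@adlf R K)) by apply: tmap_lin.
(* Consistency is tested with [Delta_lf x] in place of x, since the graph depends on x only through
   it. *)
apply: (graded_sum0 lk q_expI bDelta_term_lin).
have lD : linear (@Delta_lf R) by move=> c u v; rewrite linearP.
rewrite -(lin0 lD); elim: H => [|c x0 y0 x' y' [s [hs es /sums_toP[N HN]]] _ IH].
  by rewrite (lin0 lD) (lin0 li); apply: graded_sum_nil.
rewrite lD li; apply: graded_sum_lin IH => //; first exact: bDelta_term_lin.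
exists [seq (p.2, tpure p.1.1 p.1.2) | p <- s]; split.
- move=> _ /mapP[[[a b] d] /hs hb ->] /=.
  by rewrite tmap_pure // (homog_adK hb) tpureZr.
- by rewrite es big_map.
exists N => n /HN ->; apply: eq_bigr => i _; rewrite big_map /=.
apply: eq_bigr => p _.
by rewrite /bDelta_term tmap_pure //; exact: bDelta_factor_lin.
Qed.

(** * Commutation of the terms of the quasi-R-matrix with K and E *)

Lemma q2_neq0 : q ^+ 2 != 0. Proof. by rewrite expf_neq0. Qed.

Lemma qdegD d e : qdeg (d + e) = qdeg d * qdeg e.
Proof. by rewrite /qdeg expfzDr // q2_neq0. Qed.
Lemma qdegX d n : qdeg (d * n%:Z) = qdeg d ^+ n.
Proof. by rewrite /qdeg -exprz_exp. Qed.

Lemma uKzS z : uKz q (z + 1) = uKz q z * K.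
Proof.
case: z => [n|[|n]].
- by rewrite addrC -intS /= exprSr.
- by rewrite /= KiK.
have -> : Negz n.+1 + 1 = Negz n by rewrite !NegzE -addn1 PoszD opprD addrK.
by rewrite /= [in RHS]exprSr -mulrA KiK mulr1.
Qed.

Lemma uKzP z : uKz q (z - 1) = uKz q z * Ki.
Proof. by rewrite -{2}(subrK 1 z) uKzS -mulrA KKi mulr1. Qed.

Lemma uKzD y z : uKz q (y + z) = uKz q y * uKz q z.
Proof.
elim/int_rect: z => [|n IH|n IH]; first by rewrite addr0 /= expr0 mulr1.
- by rewrite -addn1 PoszD addrA !uKzS IH mulrA.
by rewrite -addn1 PoszD opprD addrA !uKzP IH mulrA.
Qed.

Lemma uKz_F z : F * uKz q z = qdeg z *: (uKz q z * F).
Proof.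
have FK : F * K = q ^+ 2 *: (K * F).
  by rewrite KF scalerA mulfV ?scale1r ?q2_neq0.
have FKi : F * Ki = q ^- 2 *: (Ki * F).
  by rewrite (KiF (q_neq0 R)) scalerA mulVf ?scale1r ?q2_neq0.
elim/int_rect: z => [|n IH|n IH].
- by rewrite /= mulr1 mul1r scale1r.
- rewrite -addn1 PoszD uKzS mulrA IH -scalerAl -(mulrA _ F K) FK -scalerAr scalerA.
  by rewrite -(mulrA _ K F) qdegD.
rewrite -addn1 PoszD opprD uKzP mulrA IH -scalerAl -(mulrA _ F Ki) FKi -scalerAr.
by rewrite scalerA -(mulrA _ Ki F) qdegD.
Qed.

Lemma v_uKz i z : v_ i * uKz q z = qdeg (z * i%:Z) *: (uKz q z * v_ i).
Proof.
rewrite qdegX /Defs.v_; elim: i => [|i IH]; first by rewrite !expr0 mulr1 mul1r scale1r.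
rewrite [F ^+ i.+1]exprSr -(mulrA _ F (uKz q z)) uKz_F -scalerAr (mulrA (F ^+ i)) IH.
by rewrite -scalerAl scalerA -exprS (mulrA _ _ F).
Qed.

(** A normalized q-integer: (1 - q^(-2i)) / (1 - q^-2), divided by q - q^-1. It is the factor in
    [E_u], and its addition law [rcoefD] drives the q-binomial identity. *)
Definition rcoef (i : nat) : Cq R := (1 - qdeg (- i%:Z)) / eta.

Lemma rcoef0 : rcoef 0 = 0.
Proof. by rewrite /rcoef subrr mul0r. Qed.

Lemma qdegNn n : qdeg (- n%:Z) = (q ^- 2) ^+ n.
Proof. by rewrite /qdeg -exprnN exprVn. Qed.

Lemma rcoef_neq0 i : rcoef i.+1 != 0.
Proof.
apply: mulf_neq0; first by rewrite qdegNn; exact: q2V_neq1.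
by apply: invr_neq0; exact: eta_neq0.
Qed.

Lemma rcoefD i j : rcoef (i + j) = rcoef i + qdeg (- i%:Z) * rcoef j.
Proof.
rewrite /rcoef mulrA -mulrDl mulrBr mulr1 -qdegD -opprD -PoszD addrA subrK.
by [].
Qed.

Lemma E_u i : E * u_ i = rcoef i.+1 *: u_ i.+1.
Proof.
rewrite /rcoef mulrC -scalerA qdegNn u_rec scalerA mulVf ?scale1r //.
exact: eta_neq0.
Qed.

Lemma act_E_u m i (t : tpow Ulf m) :
  act E (act (u_ i) t) = rcoef i.+1 *: act (u_ i.+1) t.
Proof. by rewrite -actM E_u (linZ (act_linl _)). Qed.

Lemma act_u0 m (t : tpow Ulf m) : act (u_ 0) t = t.
Proof. by rewrite u_0 act1. Qed.

Lemma act_uS m i (t : tpow Ulf m) :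
  act (u_ i.+1) t = (rcoef i.+1)^-1 *: act E (act (u_ i) t).
Proof. by rewrite act_E_u scalerA mulVf ?scale1r ?rcoef_neq0. Qed.

Lemma act_u_ge m N i (t : tpow Ulf m) :
  (N <= i)%N -> act (u_ N) t = 0 -> act (u_ i) t = 0.
Proof.
move=> leNi t0; rewrite -(subnK leNi); elim: (i - N)%N => [//|j IH].
by rewrite addSn act_uS IH (lin0 (act_linr _)) scaler0.
Qed.

Lemma homogU_u d i (b : Ulf) : homogU d (ulf_val b) ->
  adlf K (adlf (u_ i) b) = qdeg (d + i%:Z) *: adlf (u_ i) b.
Proof.
move=> hb; elim: i => [|i IH]; first by rewrite u_0 adlf1 addr0 (homog_adK hb).
have := @act_uS 0 i b; rewrite /= => ->.
rewrite (linZ (adlf_linr _)) -adlfM KE (linZ (adlf_linl _)) adlfM IH.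
rewrite (linZ (adlf_linr _)) !scalerA; congr (_ *: _).
have -> : d + i.+1%:Z = (d + i%:Z) + 1 by rewrite -addn1 PoszD addrA.
by rewrite (qdegD _ 1) -mulrA mulrC (mulrC (q ^+ 2)).
Qed.

Lemma ad_E_mul (b c : Ulf) :
  adlf E (b * c) = adlf E b * adlf K c + b * adlf E c.
Proof.
apply: ulf_inj; change (ad E (ulf_val b * ulf_val c) =
  ad E (ulf_val b) * ad K (ulf_val c) + ulf_val b * ad E (ulf_val c)).
rewrite !(ad_E (q_neq0 R)) (ad_K (q_neq0 R)) mulrBl mulrBr !mulrA !mKiK.
by rewrite addrA subrK.
Qed.

Definition ucoef (e : int) (i j : nat) : Cq R := qdeg ((e + j%:Z) * i%:Z).

(** Delta E = E (x) K + 1 (x) E gives E(bc) = (E b)(K c) + b (E c), where K rescales homogeneous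
    elements. Applying E to the case n yields the terms of the case n + 1 twice, with weights
    [rcoef i] and q^(-2i) [rcoef (n.+1 - i)], which add up to [rcoef n.+1]. *)
Lemma u_mul e (b c : Ulf) n : homogU e (ulf_val c) ->
  adlf (u_ n) (b * c) = \sum_(i < n.+1)
    ucoef e i (n - i) *: (adlf (u_ i) b * adlf (u_ (n - i)) c).
Proof.
move=> hc.
have EB i x : adlf E (adlf (u_ i) x) = rcoef i.+1 *: adlf (u_ i.+1) x.
  exact: (@act_E_u 0).
elim: n => [|n IH].
  by rewrite big_ord1 subnn u_0 !adlf1 /ucoef mulr0 scale1r.
have := congr1 (adlf E) IH; rewrite EB (lin_sum (adlf_linr _)).
pose t i := ucoef e i (n.+1 - i) *: (adlf (u_ i) b * adlf (u_ (n.+1 - i)) c).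
have -> : \sum_(i < n.+1) adlf E (ucoef e i (n - i) *:
      (adlf (u_ i) b * adlf (u_ (n - i)) c)) =
    \sum_(i < n.+1) rcoef i.+1 *: t i.+1 +
    \sum_(i < n.+1) (qdeg (- i%:Z) * rcoef (n.+1 - i)) *: t i.
  rewrite -big_split; apply: eq_bigr => -[i lin] _ /=.
  rewrite ltnS in lin.
  rewrite (linZ (adlf_linr _)) ad_E_mul !EB (homogU_u _ hc) scalerDr /t subSS.
  rewrite -subSn //; congr (_ + _).
    rewrite -scalerAl -scalerAr !scalerA; congr (_ *: _).
    rewrite mulrAC mulrC; congr (_ * _); rewrite /ucoef -qdegD; congr (qdeg _).
    by rewrite -(addn1 i) PoszD mulrDr mulr1 addrC.
  rewrite -scalerAr !scalerA; congr (_ *: _).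
  rewrite [RHS]mulrAC; congr (_ * _); rewrite /ucoef -qdegD; congr (qdeg _).
  rewrite subSn // -(addn1 (n - i)) PoszD (addrA e) [in RHS]mulrDl mul1r.
  by rewrite [RHS]addrC addrK.
(* Both sums may run over all n + 2 indices: the added term has weight [rcoef 0], which is 0. *)
have -> : \sum_(i < n.+1) rcoef i.+1 *: t i.+1 = \sum_(i < n.+2) rcoef i *: t i.
  by rewrite [RHS]big_ord_recl /= rcoef0 scale0r add0r.
have -> : \sum_(i < n.+1) (qdeg (- i%:Z) * rcoef (n.+1 - i)) *: t i =
    \sum_(i < n.+2) (qdeg (- i%:Z) * rcoef (n.+1 - i)) *: t i.
  by rewrite [RHS]big_ord_recr /= subnn rcoef0 mulr0 scale0r addr0.
rewrite -big_split /= => H.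
apply: (scalerI (rcoef_neq0 n)); rewrite H scaler_sumr.
apply: eq_bigr => -[i lin] _ /=; rewrite -scalerDl -rcoefD subnKC //.
Qed.

Lemma phi_sum m N (a : Ulf) d (b : tpow Ulf m) :
  homog d b -> act (u_ N) b = 0 ->
  phi R m (tpure a b) =
  \sum_(i < N) tpure (ulf_val a * uKz q (i%:Z + d) * v_ i) (act (u_ i) b).
Proof.
move=> hb b0; apply: (phiE hb); exists N => // i Ni.
by rewrite (act_u_ge Ni b0) tpure0r.
Qed.

Lemma adlf_uS i (x : Ulf) :
  adlf (u_ i.+1) x = (rcoef i.+1)^-1 *: adlf E (adlf (u_ i) x).
Proof. exact: (@act_uS 0). Qed.
Lemma adlf_u0 (x : Ulf) : adlf (u_ 0) x = x.
Proof. exact: (@act_u0 0). Qed.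

(** * Multiplicativity of x |-> phi (1 (x) x) *)

Definition tau (x : Ulf) : tens U Ulf := phi R 0 (tpure 1 x).

Lemma tau_lin : linear tau.
Proof. by move=> c x y; rewrite /tau tpureDr tpureZr linearP. Qed.

Lemma tau_sum N d (b : Ulf) : homogU d (ulf_val b) -> adlf (u_ N) b = 0 ->
  tau b = \sum_(i < N) tpure (uKz q (i%:Z + d) * v_ i) (adlf (u_ i) b).
Proof.
move=> hb b0; rewrite /tau (@phi_sum 0 N 1 d b) //.
by apply: eq_bigr => i _; rewrite mul1r.
Qed.

Lemma adlf_u_ge N i (b : Ulf) :
  (N <= i)%N -> adlf (u_ N) b = 0 -> adlf (u_ i) b = 0.
Proof. exact: (@act_u_ge 0). Qed.

Lemma u_mul_nilp N M e (b c : Ulf) : homogU e (ulf_val c) ->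
  adlf (u_ N) b = 0 -> adlf (u_ M) c = 0 -> adlf (u_ (N + M)) (b * c) = 0.
Proof.
move=> hc b0 c0; rewrite (u_mul _ _ hc) big1 // => -[i lti] _ /=.
have [Ni|iN] := leqP N i; first by rewrite (adlf_u_ge Ni b0) mul0r scaler0.
rewrite (@adlf_u_ge M _ c) ?mulr0 ?scaler0 //.
by rewrite -(leq_add2l i) subnKC // leq_add2r ltnW.
Qed.

(* The q-binomial identity u_mul makes x |-> phi (1 (x) x) multiplicative; since
   it takes the prescribed values on the generators, it is tauL. *)
Lemma tauM_homog N M d e (b c : Ulf) :
  homogU d (ulf_val b) -> homogU e (ulf_val c) ->
  adlf (u_ N) b = 0 -> adlf (u_ M) c = 0 -> tau (b * c) = tau b * tau c.
Proof.
move=> hb hc b0 c0.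
have hbc : homogU (d + e) (ulf_val (b * c)) by apply: HomogMul.
rewrite (tau_sum hbc (u_mul_nilp hc b0 c0)) (tau_sum hb b0) (tau_sum hc c0).
pose f i j : tens U Ulf := tpure (uKz q (i%:Z + d) * v_ i) (adlf (u_ i) b) *
  tpure (uKz q (j%:Z + e) * v_ j) (adlf (u_ j) c).
rewrite big_distrlr /= -(@sum_triangle _ f); last first.
  move=> i j /orP[Ni|Mj]; rewrite /f.
    by rewrite (adlf_u_ge Ni b0) tpure0r mul0r.
  by rewrite (adlf_u_ge Mj c0) tpure0r mulr0.
apply: eq_bigr => -[n _] _ /=; rewrite (u_mul _ _ hc) tpure_sumr.
apply: eq_bigr => -[i lti] _ /=; rewrite /f tensM tpureZr -tpureZl.
(* Moving F^i past K^(j+e) costs q^(2i(j+e)), which is exactly [ucoef e i j]. *)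
congr tpure; rewrite !mulrA -(mulrA _ (v_ i) (uKz _ _)) v_uKz.
rewrite -scalerAr -scalerAl (mulrA _ (uKz _ _) (v_ i)) -uKzD.
rewrite -(mulrA _ (v_ i) (v_ _)) /Defs.v_ -exprD subnKC //.
rewrite /ucoef (addrC e) addrACA -PoszD subnKC //.
Qed.

(** Sums of homogeneous elements on which E is nilpotent, so that [tau] is given by finite sums.
    They form a subalgebra containing E, FK, K and Lambda, hence cover every argument in the graph
    of tauL. *)
Inductive nilp_graded : Ulf -> Prop :=
| NilpGraded0 : nilp_graded 0
| NilpGradedS N d b x : homogU d (ulf_val b) -> adlf (u_ N) b = 0 ->
    nilp_graded x -> nilp_graded (b + x).

Lemma nilp_gradedD x y : nilp_graded x -> nilp_graded y -> nilp_graded (x + y).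
Proof.
move=> + Hy; elim=> [|N d b z hb b0 _ IH]; first by rewrite add0r.
by rewrite -addrA; apply: NilpGradedS hb b0 IH.
Qed.

Lemma nilp_gradedZ c x : nilp_graded x -> nilp_graded (c *: x).
Proof.
elim=> [|N d b z hb b0 _ IH]; first by rewrite scaler0; apply: NilpGraded0.
rewrite scalerDr; apply: (@NilpGradedS N d _ _ _ _ IH).
  by have := HomogLin c hb (HomogZero R d); rewrite addr0.
by rewrite (linZ (adlf_linr _)) b0 scaler0.
Qed.

Lemma nilp_graded_homog N d b : homogU d (ulf_val b) -> adlf (u_ N) b = 0 ->
  nilp_graded b.
Proof.
by move=> hb b0; rewrite -[b]addr0; apply: NilpGradedS hb b0 NilpGraded0.
Qed.

Lemma nilp_gradedM x y : nilp_graded x -> nilp_graded y ->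
  nilp_graded (x * y) /\ tau (x * y) = tau x * tau y.
Proof.
move=> + Hy; elim=> [|N d b z hb b0 _ [IHn IHt]].
  by rewrite mul0r (lin0 tau_lin) mul0r; split=> //; apply: NilpGraded0.
rewrite mulrDl !(linD tau_lin) mulrDl IHt.
suff [Hn ->] : nilp_graded (b * y) /\ tau (b * y) = tau b * tau y.
  by split=> //; apply: nilp_gradedD.
elim: Hy => [|M e c w hc c0 _ [IHn' IHt']].
  by rewrite mulr0 (lin0 tau_lin) mulr0; split=> //; apply: NilpGraded0.
rewrite mulrDr !(linD tau_lin) mulrDr IHt' (tauM_homog hb hc b0 c0); split=> //.
apply: nilp_gradedD => //; apply: (@nilp_graded_homog (N + M) (d + e)).
  exact: HomogMul.
exact: u_mul_nilp hc b0 c0.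
Qed.

Lemma nilp_graded1 : nilp_graded 1 /\ tau 1 = 1.
Proof.
have u1 : adlf (u_ 1) 1 = 0 :> Ulf.
  rewrite adlf_uS adlf_u0; apply: ulf_inj.
  rewrite (linZ ulf_lin) -[ulf_val _]/(ad E 1) (ad_E (q_neq0 R)).
  by rewrite mulr1 mul1r subrr scaler0.
have h1 : homogU 0 (ulf_val (1 : Ulf)) by apply: HomogOne.
split; first exact: nilp_graded_homog h1 u1.
by rewrite (tau_sum h1 u1) big_ord1 u_0 adlf1 mul1r.
Qed.

Lemma q2D1_neq0 : q * q + 1 != 0.
Proof.
apply/eqP => H; suff /q_unity : q ^+ 4 = 1 by [].
have /eqP := H; rewrite addr_eq0 => /eqP H2.
by rewrite (exprM q 2 2) (expr2 q) H2 expr2 mulrNN mulr1.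
Qed.

(* [field] does not terminate on the concrete field Cq R, hence the generalization. *)
Ltac cq_generalize :=
  match goal with |- context [Defs.q ?R] =>
    move: (q_neq0 R) (q_qV_neq0 R) q2D1_neq0; rewrite ?/eta;
    generalize (Defs.q R);
    repeat match goal with y : GRing.Field.sort (Cq _) |- _ => revert y end;
    generalize (Cq R); clear
  end.

Ltac cq_field := cq_generalize; intros k; intros; q_field.

Ltac lin_eq := lin_eq_with cq_field.

(** * The entries of L under E, up to scalars: FK -> K - D -> E -> 0 *)

Definition Dlf : Ulf := q^-1 *: Lambda - q^-2 *: Klf.

Lemma ulfD (x y : Ulf) : ulf_val (x + y) = ulf_val x + ulf_val y. Proof. by []. Qed.
Lemma ulfN (x : Ulf) : ulf_val (- x) = - ulf_val x. Proof. by []. Qed.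
Lemma ulfZ c (x : Ulf) : ulf_val (c *: x) = c *: ulf_val x. Proof. by []. Qed.
Lemma ulf_ad h (x : Ulf) : ulf_val (adlf h x) = ad h (ulf_val x). Proof. by []. Qed.

Lemma ulf_E : ulf_val Elf = E. Proof. by []. Qed.
Lemma ulf_FK : ulf_val FKlf = F * K. Proof. by []. Qed.
Lemma ulf_K : ulf_val Klf = K. Proof. by []. Qed.
Lemma ulf_L : ulf_val Lambda =
  (q - q^-1) ^+ 2 *: (F * E) + q *: K + q^-1 *: Ki.
Proof. by []. Qed.

Definition ulfE := (ulfD, ulfN, ulfZ, ulf_ad, ulf_E, ulf_FK, ulf_K, ulf_L).

Lemma adE_E : adlf E Elf = 0.
Proof. by apply: ulf_inj; rewrite !ulfE (ad_E (q_neq0 R)) subrr. Qed.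

Lemma adE_K : adlf E Klf = (1 - q ^+ 2) *: Elf.
Proof.
apply: ulf_inj; rewrite !ulfE (ad_E (q_neq0 R)) KE mKKi -scalerAl mKKi.
lin_eq.
Qed.

Lemma adE_L : adlf E Lambda = 0.
Proof.
apply: ulf_inj; rewrite ulf_ad (ad_E (q_neq0 R)).
by rewrite (casimirE (q_neq0 R) (q_qV_neq0 R)) subrr.
Qed.

Lemma adE_D : adlf E Dlf = (1 - q ^- 2) *: Elf.
Proof.
rewrite /Dlf (linD (adlf_linr _)) -scaleNr !(linZ (adlf_linr _)) adE_L adE_K.
lin_eq.
Qed.

Lemma adE_FK : adlf E FKlf = (q ^+ 2 / (q - q^-1)) *: (Klf - Dlf).
Proof.
have -> : adlf E FKlf = - (q / (q - q^-1)) *: Lambda +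
    ((q ^+ 2 + 1) / (q - q^-1)) *: Klf.
  by apply: ulf_inj; exact: (ad_E_FK (q_neq0 R) (q_qV_neq0 R)).
rewrite /Dlf.
lin_eq.
Qed.

#[local] Opaque tpure tadd tscale topp tzero.

Lemma rcoef1V : (rcoef 1)^-1 = q - q^-1.
Proof.
rewrite /rcoef qdegNn expr1 invfM invrK /eta.
cq_field.
Qed.

Lemma rcoef2V : (rcoef 2)^-1 = eta / (1 - (q ^- 2) ^+ 2).
Proof. by rewrite /rcoef qdegNn invfM invrK mulrC. Qed.

Lemma u1E (x : Ulf) : adlf (u_ 1) x = (q - q^-1) *: adlf E x.
Proof. by rewrite adlf_uS adlf_u0 rcoef1V. Qed.

Lemma u2E (x : Ulf) :
  adlf (u_ 2) x = (eta / (1 - (q ^- 2) ^+ 2)) *: adlf E (adlf (u_ 1) x).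
Proof. by rewrite adlf_uS rcoef2V. Qed.

Lemma u1_E : adlf (u_ 1) Elf = 0.
Proof. by rewrite u1E adE_E scaler0. Qed.
Lemma u1_L : adlf (u_ 1) Lambda = 0.
Proof. by rewrite u1E adE_L scaler0. Qed.
Lemma u1_K : adlf (u_ 1) Klf = - (q ^+ 2 * eta) *: Elf.
Proof. by rewrite u1E adE_K; lin_eq. Qed.
Lemma u1_D : adlf (u_ 1) Dlf = eta *: Elf.
Proof. by rewrite u1E adE_D; lin_eq. Qed.
Lemma u1_FK : adlf (u_ 1) FKlf = q ^+ 2 *: (Klf - Dlf).
Proof. by rewrite u1E adE_FK; lin_eq. Qed.
Lemma u2_K : adlf (u_ 2) Klf = 0.
Proof. by rewrite u2E u1_K (linZ (adlf_linr _)) adE_E !scaler0. Qed.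
Lemma u2_D : adlf (u_ 2) Dlf = 0.
Proof. by rewrite u2E u1_D (linZ (adlf_linr _)) adE_E !scaler0. Qed.
Lemma u2_FK : adlf (u_ 2) FKlf = - (q ^+ 4 * eta) *: Elf.
Proof.
rewrite u2E u1_FK (linZ (adlf_linr _)) (linD (adlf_linr _)).
rewrite -scaleN1r (linZ (adlf_linr _)) adE_K adE_D.
lin_eq.
(* Clearing the denominator 1 - q^-4 of [u2E] leaves q^4 - 1 to be nonzero. *)
by apply: quartic_neq0.
Qed.
Lemma u3_FK : adlf (u_ 3) FKlf = 0.
Proof. by rewrite adlf_uS u2_FK (linZ (adlf_linr _)) adE_E !scaler0. Qed.

Lemma homogU_Z d c (x : U) : homogU d x -> homogU d (c *: x).
Proof. by move=> hx; have := HomogLin c hx (HomogZero R d); rewrite addr0. Qed.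
Lemma homogU_D d (x y : U) : homogU d x -> homogU d y -> homogU d (x + y).
Proof. by move=> hx hy; rewrite -[x]scale1r; apply: HomogLin. Qed.

Lemma homog_E : homogU 1 (ulf_val Elf). Proof. exact: HomogE. Qed.
Lemma homog_Klf : homogU 0 (ulf_val Klf). Proof. exact: HomogK. Qed.
Lemma homog_FK : homogU (-1) (ulf_val FKlf).
Proof. exact: (HomogMul (HomogF R) (HomogK R)). Qed.
Lemma homog_L : homogU 0 (ulf_val Lambda).
Proof.
have FE := HomogMul (HomogF R) (HomogE R).
rewrite ulf_L; apply: homogU_D; [apply: homogU_D|]; apply: homogU_Z => //.
  exact: HomogK.
exact: HomogKi.
Qed.
Lemma homog_D : homogU 0 (ulf_val Dlf).
Proof.
rewrite /Dlf ulfD ulfN !ulfZ -scaleNr.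
by apply: homogU_D; apply: homogU_Z; [exact: homog_L|exact: homog_Klf].
Qed.

(** * The morphism tauL *)

Lemma tau_E : tau Elf = tpure K Elf.
Proof.
by rewrite (tau_sum homog_E u1_E) big_ord1 u_0 adlf1 /= expr1 mulr1.
Qed.

Lemma tau_L : tau Lambda = tpure 1 Lambda.
Proof.
by rewrite (tau_sum homog_L u1_L) big_ord1 u_0 adlf1 /= expr0 mulr1.
Qed.

Lemma tau_K : tau Klf = tpure 1 Klf + tpure (K * F) (adlf (u_ 1) Klf).
Proof.
by rewrite (tau_sum homog_Klf u2_K) big_ord_recl big_ord1 u_0 adlf1 /= expr0 mulr1.
Qed.

Lemma tau_FK : tau FKlf = tpure Ki FKlf + tpure F (adlf (u_ 1) FKlf)
  + tpure (K * F ^+ 2) (adlf (u_ 2) FKlf).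
Proof.
rewrite (tau_sum homog_FK u3_FK) !big_ord_recl big_ord0 u_0 adlf1 addr0 addrA.
by rewrite /= expr0 mulr1 mul1r.
Qed.

Lemma tau_gens (x : Ulf) y : @tauL_gen R x y -> nilp_graded x /\ tau x = y.
Proof.
case=> -[-> ->]; split.
- exact: nilp_graded_homog homog_E u1_E.
- exact: tau_E.
- exact: nilp_graded_homog homog_FK u3_FK.
- rewrite tau_FK u1_FK u2_FK (KF2 (q_neq0 R) (q_qV_neq0 R)) /Dlf.
  rewrite !(tpureDl, tpureDr, tpureZl, tpureZr, tpureNl, tpureNr).
  lin_eq.
- exact: nilp_graded_homog homog_Klf u2_K.
- rewrite tau_K u1_K KF !(tpureDl, tpureDr, tpureZl, tpureZr, tpureNl, tpureNr).
  lin_eq.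
- exact: nilp_graded_homog homog_L u1_L.
- exact: tau_L.
Qed.

(** By induction over [alg_graph], every pair of the graph lies on the graph of the linear map
    [tau], which makes it consistent. *)
Lemma tauLE x y : alg_graph (@tauL_gen R) x y -> tauL R x = y.
Proof.
have H z w : alg_graph (@tauL_gen R) z w -> nilp_graded z /\ tau z = w.
  elim=> [||c z1 w1 z2 w2 _ [n1 <-] _ [n2 <-]|z1 w1 z2 w2 _ [n1 <-] _ [n2 <-]].
  - exact: tau_gens.
  - exact: nilp_graded1.
  - by split; rewrite ?tau_lin //; apply/nilp_gradedD/n2/nilp_gradedZ.
  - exact: nilp_gradedM.
apply: (lin_ofE (G := alg_graph (@tauL_gen R))) => w Hw.
rewrite -(lin0 tau_lin); elim: Hw => [|c x0 y0 x' y' /H[_ <-] _ ->].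
  by rewrite (lin0 tau_lin).
by rewrite tau_lin.
Qed.

Lemma tauL_gens x y : @tauL_gen R x y -> tauL R x = tau x.
Proof. by move=> Hxy; have [_ ->] := tau_gens Hxy; apply/tauLE/AlgGen. Qed.

Lemma tauL_E : tauL R Elf = tau Elf. Proof. by apply: tauL_gens; apply: Or41. Qed.
Lemma tauL_FK : tauL R FKlf = tau FKlf. Proof. by apply: tauL_gens; apply: Or42. Qed.
Lemma tauL_K : tauL R Klf = tau Klf. Proof. by apply: tauL_gens; apply: Or43. Qed.
Lemma tauL_L : tauL R Lambda = tau Lambda. Proof. by apply: tauL_gens; apply: Or44. Qed.
Lemma tauL_D : tauL R Dlf = tau Dlf.
Proof.
have L : linear (tauL R) by exact: linearP.
rewrite /Dlf -scaleNr (linD L) (linD tau_lin) !(linZ L) !(linZ tau_lin).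
by rewrite tauL_L tauL_K.
Qed.

Lemma ulf_Dlf : ulf_val Dlf = D.
Proof. by rewrite /Dlf ulfD ulfN !ulfZ. Qed.

Lemma D_E : D = Ki + eta *: (E * F).
Proof. exact: (casimir_entryE (q_neq0 R) (q_qV_neq0 R)). Qed.

Lemma tmap_r_pure (a : U) (x : Ulf) :
  tmap id (@ulf_val R) (tpure a x) = tpure a (ulf_val x).
Proof. exact: tmap_pure. Qed.
Lemma tmap_r_lin : linear (tmap (@id U) (@ulf_val R)).
Proof. exact: tmap_lin. Qed.
Lemma tmap_l_pure (a x : Ulf) :
  tmap (@ulf_val R) (@id Ulf) (tpure a x) = tpure (ulf_val a) x.
Proof. exact: tmap_pure. Qed.
Lemma tmap_l_lin : linear (tmap (@ulf_val R) (@id Ulf)).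
Proof. exact: tmap_lin. Qed.

(** * Coproduct and braided coproduct of the entries of L *)

Lemma Delta_lf_K : Delta_lf R Klf = tpure K Klf.
Proof. by apply: Delta_lfE; rewrite tmap_r_pure Delta_K. Qed.

Lemma Delta_lf_E : Delta_lf R Elf = tpure E Klf + tpure (1 : U) Elf.
Proof.
by apply: Delta_lfE; rewrite (linD tmap_r_lin) !tmap_r_pure Delta_E.
Qed.

Lemma Delta_lf_FK : Delta_lf R FKlf = tpure (F * K) Klf + tpure (1 : U) FKlf.
Proof.
apply: Delta_lfE; rewrite (linD tmap_r_lin) !tmap_r_pure ulf_FK ulf_K.
rewrite (DeltaM (q_neq0 R)) Delta_F Delta_K mulrDl !tensM mul1r.
by rewrite KiK.
Qed.

Lemma Delta_lf_D : Delta_lf R Dlf =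
  tpure Ki Dlf + tpure (eta *: (E * F)) Klf
  + (tpure (eta *: F) Elf + tpure (eta *: (Ki * E)) FKlf).
Proof.
apply: Delta_lfE; rewrite !(linD tmap_r_lin) !tmap_r_pure ulf_Dlf ulf_FK ulf_K.
by rewrite (Delta_casimir_entry (q_neq0 R) (q_qV_neq0 R)).
Qed.

Definition bDelta_summand (i : nat) (p : U * Ulf * int) : tens U Ulf :=
  tpure (p.1.1 * antipode (uKz q (i%:Z + p.2) * v_ i)) (adlf (u_ i) p.1.2).

Lemma bDelta_summandE i (a : U) (b : Ulf) d : bDelta_summand i (a, b, d) =
  tpure (a * antipode (uKz q (i%:Z + d) * v_ i)) (adlf (u_ i) b).
Proof. by []. Qed.

(** When [u_ 3] kills every right factor, as it does for the entries of L, only i = 0, 1, 2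
    contribute. *)
Lemma bDelta_graphP (x : Ulf) (z : tens Ulf Ulf) (s : seq (U * Ulf * int)) :
  (forall a b d, (a, b, d) \in s -> homogU d (ulf_val b)) ->
  Delta_lf R x = \sum_(p <- s) tpure p.1.1 p.1.2 ->
  (forall p, p \in s -> adlf (u_ 3) p.1.2 = 0) ->
  tmap (@ulf_val R) id z = \sum_(p <- s) bDelta_summand 0 p +
    \sum_(p <- s) bDelta_summand 1 p + \sum_(p <- s) bDelta_summand 2 p ->
  bDelta R x = z.
Proof.
move=> hs es s0 ez; apply: bDeltaE; exists s; split=> //.
exists 3 => [i ni|]; last by rewrite !big_ord_recr big_ord0 /= add0r; exact: ez.
rewrite big_seq big1 // => p ps.
by rewrite (adlf_u_ge ni (s0 _ ps)) tpure0r.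
Qed.

Lemma antipode_00 : antipode (uKz q (0%:Z + 0) * v_ 0) = 1.
Proof. by rewrite /= !expr0 mulr1 (antipode1 (q_neq0 R)). Qed.
Lemma antipode_01 : antipode (uKz q (0%:Z + 1) * v_ 0) = Ki.
Proof. by rewrite /= expr1 mulr1 (antipode_K (q_neq0 R)). Qed.
Lemma antipode_0N1 : antipode (uKz q (0%:Z + -1) * v_ 0) = K.
Proof. by rewrite /= expr1 mulr1 (antipode_Ki (q_neq0 R)). Qed.
Lemma antipode_10 : antipode (uKz q (1%:Z + 0) * v_ 1) = - q ^- 2 *: F.
Proof. by rewrite /= /Defs.v_ !expr1 (antipode_KF (q_neq0 R)). Qed.
Lemma antipode_1N1 : antipode (uKz q (1%:Z + -1) * v_ 1) = - q ^- 2 *: (F * K).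
Proof. by rewrite /= /Defs.v_ expr0 expr1 mul1r (antipode_F (q_neq0 R)). Qed.
Lemma antipode_2N1 : antipode (uKz q (2%:Z + -1) * v_ 2) = q ^- 6 *: (F ^+ 2 * K).
Proof.
rewrite /= /Defs.v_ expr1; exact: (antipode_KF2 (q_neq0 R) (q_qV_neq0 R)).
Qed.

Lemma u2_E : adlf (u_ 2) Elf = 0. Proof. exact: (@adlf_u_ge 1 2 _ isT u1_E). Qed.
Lemma u3_E : adlf (u_ 3) Elf = 0. Proof. exact: (@adlf_u_ge 1 3 _ isT u1_E). Qed.
Lemma u3_K : adlf (u_ 3) Klf = 0. Proof. exact: (@adlf_u_ge 2 3 _ isT u2_K). Qed.
Lemma u3_D : adlf (u_ 3) Dlf = 0. Proof. exact: (@adlf_u_ge 2 3 _ isT u2_D). Qed.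

Lemma bDelta_K : bDelta R Klf =
  tpure Klf Klf + (q ^- 2 * eta) *: tpure FKlf Elf.
Proof.
apply: (@bDelta_graphP _ _ [:: (K, Klf, 0)]).
- by move=> a b d; rewrite inE => /eqP[_ -> ->]; exact: homog_Klf.
- by rewrite big_seq1 Delta_lf_K.
- by move=> p; rewrite inE => /eqP ->; exact: u3_K.
rewrite !big_seq1 !bDelta_summandE u2_K tpure0r addr0 u1_K adlf_u0.
rewrite antipode_00 antipode_10 mulr1 mulrZ_U KF.
rewrite (linD tmap_l_lin) (linZ tmap_l_lin) !tmap_l_pure ulf_K ulf_FK.
rewrite !(tpureZl, tpureZr).
lin_eq.
Qed.

Lemma bDelta_E : bDelta R Elf = tpure Elf Klf + tpure Dlf Elf.
Proof.
apply: (@bDelta_graphP _ _ [:: (E, Klf, 0); (1, Elf, 1)]).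
- move=> a b d; rewrite !inE => /orP[] /eqP[_ -> ->].
    exact: homog_Klf.
  exact: homog_E.
- by rewrite big_cons big_seq1 Delta_lf_E.
- by move=> p; rewrite !inE => /orP[] /eqP ->; [exact: u3_K|exact: u3_E].
rewrite !big_cons !big_nil !bDelta_summandE u2_K u1_E u2_E !tpure0r !addr0.
rewrite u1_K !adlf_u0 antipode_00 antipode_10 antipode_01 mulr1 mul1r mulrZ_U.
rewrite (linD tmap_l_lin) !tmap_l_pure ulf_Dlf ulf_E D_E.
move: Dlf => d'.
rewrite !(tpureZl, tpureZr, tpureDl).
lin_eq.
Qed.

Lemma bDelta_FK : bDelta R FKlf = tpure Klf FKlf + tpure FKlf Dlf.
Proof.
apply: (@bDelta_graphP _ _ [:: (F * K, Klf, 0); (1, FKlf, -1)]).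
- move=> a b d; rewrite !inE => /orP[] /eqP[_ -> ->].
    exact: homog_Klf.
  exact: homog_FK.
- by rewrite big_cons big_seq1 Delta_lf_FK.
- by move=> p; rewrite !inE => /orP[] /eqP ->; [exact: u3_K|exact: u3_FK].
rewrite !big_cons !big_nil !bDelta_summandE u2_K !tpure0r !addr0.
rewrite u1_K u1_FK u2_FK !adlf_u0.
rewrite antipode_00 antipode_10 antipode_0N1 antipode_1N1 antipode_2N1.
rewrite mulr1 !mul1r mulrZ_U FKF.
rewrite (linD tmap_l_lin) !tmap_l_pure ulf_K ulf_FK.
(* D in a right factor is kept as an atom, lest the linearity rewrites unfold it into Lambda and
   K. *)
move: Dlf => d'.
rewrite !(tpureZl, tpureZr, tpureDr, tpureNr).
lin_eq.
Qed.

Lemma bDelta_D : bDelta R Dlf =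
  (q ^- 2 * eta) *: tpure Elf FKlf + tpure Dlf Dlf.
Proof.
apply: (@bDelta_graphP _ _ [:: (Ki, Dlf, 0); (eta *: (E * F), Klf, 0);
  (eta *: F, Elf, 1); (eta *: (Ki * E), FKlf, -1)]).
- move=> a b d; rewrite !inE => /or4P[] /eqP[_ -> ->].
  + exact: homog_D.
  + exact: homog_Klf.
  + exact: homog_E.
  + exact: homog_FK.
- by rewrite !big_cons big_nil addr0 Delta_lf_D !addrA.
- move=> p; rewrite !inE => /or4P[] /eqP ->.
  + exact: u3_D.
  + exact: u3_K.
  + exact: u3_E.
  + exact: u3_FK.
rewrite !big_cons !big_nil !bDelta_summandE u1_E u2_K u2_D u2_E !tpure0r !addr0.
rewrite u1_K u1_D u1_FK u2_FK !adlf_u0.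
rewrite antipode_00 antipode_10 antipode_01 antipode_0N1 antipode_1N1 antipode_2N1.
rewrite !mulr1 !mulrZ_U !mulZr_U (KiE_FFK (q_neq0 R) (q_qV_neq0 R)).
rewrite (KiE_FK (q_neq0 R) (q_qV_neq0 R)) (KiE_K (q_neq0 R) (q_qV_neq0 R)).
rewrite (KiF (q_neq0 R)).
rewrite (linD tmap_l_lin) (linZ tmap_l_lin) !tmap_l_pure ulf_Dlf ulf_E D_E.
move: Dlf => d'.
rewrite !(tpureZl, tpureZr, tpureDr, tpureDl, tpureNr).
lin_eq.
Qed.

(** * The span of the entries of L *)

(* The entries of the matrix L span an ad-stable subspace, preserved by Delta,
   bDelta and tauL in their last tensor factor; U^lf itself is never described. *)
Inductive in_casimir_module : Ulf -> Prop :=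
| InCasimir0 : in_casimir_module 0
| InCasimirK : in_casimir_module Klf
| InCasimirFK : in_casimir_module FKlf
| InCasimirE : in_casimir_module Elf
| InCasimirD : in_casimir_module Dlf
| InCasimirLin c x y : in_casimir_module x -> in_casimir_module y ->
    in_casimir_module (c *: x + y).

Local Notation in4 := in_casimir_module.

Lemma in4_Z c x : in4 x -> in4 (c *: x).
Proof. by move=> hx; rewrite -[_ *: _]addr0; apply: InCasimirLin hx InCasimir0. Qed.

Lemma in4_adE x : in4 x -> in4 (adlf E x).
Proof.
elim=> [|||||c {}x y _ IH _ IH'].
- by rewrite (lin0 (adlf_linr _)); apply: InCasimir0.
- by rewrite adE_K; apply/in4_Z/InCasimirE.
- rewrite adE_FK; apply: in4_Z; rewrite -[_ - _]addrC -scaleN1r.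
  by apply: InCasimirLin; [exact: InCasimirD|exact: InCasimirK].
- by rewrite adE_E; apply: InCasimir0.
- by rewrite adE_D; apply/in4_Z/InCasimirE.
- by rewrite (adlf_linr _ c x y); apply: InCasimirLin.
Qed.

Lemma in4_u i x : in4 x -> in4 (adlf (u_ i) x).
Proof.
move=> hx; elim: i => [|i IH]; first by rewrite adlf_u0.
by rewrite adlf_uS; apply/in4_Z/in4_adE.
Qed.

Lemma in4_ext (Y : lmodType (Cq R)) (f g : Ulf -> Y) : linear f -> linear g ->
  f Klf = g Klf -> f FKlf = g FKlf -> f Elf = g Elf -> f Dlf = g Dlf ->
  forall x, in4 x -> f x = g x.
Proof.
move=> lf lg eK eF eE eD x; elim=> [|||||c {}x y _ IH _ IH'] //.
  by rewrite !lin0.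
by rewrite lf lg IH IH'.
Qed.

Inductive tens_in4 (V : lmodType (Cq R)) : tens V Ulf -> Prop :=
| TensIn4Pure a x : in4 x -> tens_in4 (tpure a x)
| TensIn4D y z : tens_in4 y -> tens_in4 z -> tens_in4 (y + z).

Lemma tens_in4_ext (V Y : lmodType (Cq R)) (f g : tens V Ulf -> Y) :
  linear f -> linear g -> (forall a x, in4 x -> f (tpure a x) = g (tpure a x)) ->
  forall z, tens_in4 z -> f z = g z.
Proof.
move=> lf lg H z; elim=> [a x|{}z w _ IH _ IH']; first exact: H.
by rewrite !linD ?IH ?IH'.
Qed.

Lemma bDelta_lin : linear (bDelta R). Proof. exact: linearP. Qed.
Lemma Delta_lf_lin : linear (Delta_lf R). Proof. exact: linearP. Qed.
Lemma phi_lin m : linear (phi R m). Proof. exact: linearP. Qed.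
Lemma tauL_lin : linear (tauL R). Proof. exact: linearP. Qed.

Lemma tens_in4_0 (V : lmodType (Cq R)) : tens_in4 (0 : tens V Ulf).
Proof. by rewrite -(tpure0l _ (0 : Ulf)); apply/TensIn4Pure/InCasimir0. Qed.
Lemma tens_in4Z (V : lmodType (Cq R)) c (z : tens V Ulf) :
  tens_in4 z -> tens_in4 (c *: z).
Proof.
elim=> [a x hx|{}z w _ IH _ IH']; first by rewrite -tpureZl; apply: TensIn4Pure.
by rewrite scalerDr; apply: TensIn4D.
Qed.

Lemma tens_in4_map (V : lmodType (Cq R)) (f : Ulf -> tens V Ulf) : linear f ->
  tens_in4 (f Klf) -> tens_in4 (f FKlf) -> tens_in4 (f Elf) -> tens_in4 (f Dlf) ->
  forall x, in4 x -> tens_in4 (f x).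
Proof.
move=> lf fK fF fE fD x; elim=> [|||||c {}x y _ IH _ IH'] //.
  by rewrite lin0 //; exact: tens_in4_0.
by rewrite lf; apply: TensIn4D IH'; apply: tens_in4Z.
Qed.

Lemma bDelta_in4 x : in4 x -> tens_in4 (bDelta R x).
Proof.
apply: tens_in4_map; first exact: bDelta_lin.
- rewrite bDelta_K; apply: TensIn4D; [|apply: tens_in4Z]; apply: TensIn4Pure.
    exact: InCasimirK.
  exact: InCasimirE.
- rewrite bDelta_FK; apply: TensIn4D; apply: TensIn4Pure.
    exact: InCasimirFK.
  exact: InCasimirD.
- rewrite bDelta_E; apply: TensIn4D; apply: TensIn4Pure.
    exact: InCasimirK.
  exact: InCasimirE.
- rewrite bDelta_D; apply: TensIn4D; [apply: tens_in4Z|]; apply: TensIn4Pure.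
    exact: InCasimirFK.
  exact: InCasimirD.
Qed.

Lemma Delta_lf_in4 x : in4 x -> tens_in4 (Delta_lf R x).
Proof.
have pK (a : U) := TensIn4Pure a InCasimirK.
have pF (a : U) := TensIn4Pure a InCasimirFK.
have pE (a : U) := TensIn4Pure a InCasimirE.
have pD (a : U) := TensIn4Pure a InCasimirD.
apply: tens_in4_map; first exact: Delta_lf_lin.
- by rewrite Delta_lf_K.
- by rewrite Delta_lf_FK; apply: TensIn4D.
- by rewrite Delta_lf_E; apply: TensIn4D.
- by rewrite Delta_lf_D; do 2?apply: TensIn4D.
Qed.

(** On each of the four entries tauL is a sum of terms a (x) [u_ i] x, and the span is stable under
    E. *)
Lemma tauL_in4 x : in4 x -> tens_in4 (tauL R x).
Proof.
have p i x0 (a : U) : in4 x0 -> tens_in4 (tpure a (adlf (u_ i) x0)).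
  by move=> hx; apply/TensIn4Pure/in4_u.
have pu (n : nat) x0 (f : nat -> U) : in4 x0 ->
    tens_in4 (\sum_(i < n) tpure (f i) (adlf (u_ i) x0)).
  move=> hx; elim: n => [|n IH]; first by rewrite big_ord0; exact: tens_in4_0.
  by rewrite big_ord_recr; apply: TensIn4D => //; apply: p.
apply: tens_in4_map; first exact: tauL_lin.
- rewrite tauL_K (tau_sum homog_Klf u2_K).
  exact: (pu _ _ (fun i => uKz q (i%:Z + 0) * v_ i) InCasimirK).
- rewrite tauL_FK (tau_sum homog_FK u3_FK).
  exact: (pu _ _ (fun i => uKz q (i%:Z + -1) * v_ i) InCasimirFK).
- rewrite tauL_E (tau_sum homog_E u1_E).
  exact: (pu _ _ (fun i => uKz q (i%:Z + 1) * v_ i) InCasimirE).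
- rewrite tauL_D (tau_sum homog_D u2_D).
  exact: (pu _ _ (fun i => uKz q (i%:Z + 0) * v_ i) InCasimirD).
Qed.

Lemma tau_eq x : in4 x -> tauL R x = tau x.
Proof.
apply: in4_ext; [exact: tauL_lin|exact: tau_lin|..].
- exact: tauL_K.
- exact: tauL_FK.
- exact: tauL_E.
- exact: tauL_D.
Qed.

(** The cancellation is verified entry by entry, from the values of phi on a (x) K, a (x) FK, a (x)
    E and a (x) D with a arbitrary. *)
Lemma phi0_bDelta x : in4 x -> phi R 0 (bDelta R x) = Delta_lf R x.
Proof.
have q0 := q_neq0 R; have q1 := q_qV_neq0 R.
have phi0_sum N a d (b : Ulf) : homogU d (ulf_val b) -> adlf (u_ N) b = 0 ->
    phi R 0 (tpure a b) =
    \sum_(i < N) tpure (ulf_val a * uKz q (i%:Z + d) * v_ i) (adlf (u_ i) b).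
  exact: (@phi_sum 0).
have pE a : phi R 0 (tpure a Elf) = tpure (ulf_val a * K) Elf.
  rewrite (phi0_sum _ _ _ _ homog_E u1_E) big_ord1 adlf_u0.
  by rewrite /= expr1 mulr1.
have pK a : phi R 0 (tpure a Klf) = tpure (ulf_val a) Klf +
    tpure (ulf_val a * K * F) (- (q ^+ 2 * eta) *: Elf).
  rewrite (phi0_sum _ _ _ _ homog_Klf u2_K) !big_ord_recr big_ord0 /=.
  by rewrite adlf_u0 u1_K !add0r !expr0 !mulr1.
have pD a : phi R 0 (tpure a Dlf) = tpure (ulf_val a) Dlf +
    tpure (ulf_val a * K * F) (eta *: Elf).
  rewrite (phi0_sum _ _ _ _ homog_D u2_D) !big_ord_recr big_ord0 /=.
  by rewrite adlf_u0 u1_D !add0r !expr0 !mulr1.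
have pF a : phi R 0 (tpure a FKlf) = tpure (ulf_val a * Ki) FKlf +
    tpure (ulf_val a * F) (q ^+ 2 *: (Klf - Dlf)) +
    tpure (ulf_val a * K * F ^+ 2) (- (q ^+ 4 * eta) *: Elf).
  rewrite (phi0_sum _ _ _ _ homog_FK u3_FK) !big_ord_recr big_ord0 /=.
  by rewrite adlf_u0 u1_FK u2_FK !add0r !expr0 !mulr1.
apply: (in4_ext (f := fun y => phi R 0 (bDelta R y)) (g := Delta_lf R)).
- by move=> c y z; rewrite bDelta_lin phi_lin.
- exact: Delta_lf_lin.
- rewrite bDelta_K (linD (@phi_lin 0)) (linZ (@phi_lin 0)) pK pE Delta_lf_K.
  rewrite ulf_K ulf_FK (KKF q0 q1) !(tpureZl, tpureZr).
  lin_eq.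
- rewrite bDelta_FK (linD (@phi_lin 0)) pF pD Delta_lf_FK ulf_K ulf_FK.
  move: Dlf => d'.
  rewrite KKi KF (KKFF q0 q1) (FKKF q0 q1) !(tpureZl, tpureZr, tpureDr, tpureNr).
  lin_eq.
- rewrite bDelta_E (linD (@phi_lin 0)) pE pK Delta_lf_E ulf_E ulf_Dlf.
  rewrite EKF (casimir_entry_K q0 q1) !(tpureZl, tpureZr, tpureDl).
  lin_eq.
- rewrite bDelta_D (linD (@phi_lin 0)) (linZ (@phi_lin 0)) pD pF Delta_lf_D.
  rewrite ulf_E ulf_Dlf (casimir_entry_KF q0 q1) (EKFF q0 q1) (KiE q0) D_E.
  move: Dlf => d'.
  rewrite !(tpureZl, tpureZr, tpureDr, tpureNr, tpureDl).
  lin_eq.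
Qed.

(** * Units in the remaining positions *)

Definition ones m : tpow Ulf m := tpow_pure m (fun=> 1).

Lemma adK_1 : adlf K (1 : Ulf) = 1.
Proof.
apply: ulf_inj; rewrite ulf_ad (ad_K (q_neq0 R)).
by rewrite -[ulf_val 1]/(1 : U) mulr1 KKi.
Qed.
Lemma adE_1 : adlf E (1 : Ulf) = 0.
Proof.
apply: ulf_inj; rewrite ulf_ad (ad_E (q_neq0 R)).
by rewrite -[ulf_val 1]/(1 : U) mulr1 mul1r subrr.
Qed.

Lemma act_K_ones m : act K (ones m) = ones m.
Proof.
elim: m => [|m IH]; first exact: adK_1.
by rewrite -[ones m.+1]/(tpure 1 (ones m)) act_K_pure adK_1 IH.
Qed.
Lemma act_E_ones m : act E (ones m) = 0.
Proof.
elim: m => [|m IH]; first exact: adE_1.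
rewrite -[ones m.+1]/(tpure 1 (ones m)) act_E_pure adE_1 IH.
by rewrite tpure0l tpure0r addr0.
Qed.
Lemma homog_1 : homogU 0 (ulf_val (1 : Ulf)). Proof. exact: HomogOne. Qed.

Lemma homog_ones m : homog 0 (ones m).
Proof.
elim: m => [|m IH]; first exact: HomogOne.
exact: (homog_pure homog_1 IH).
Qed.

Lemma phi_ones m a : phi R m (tpure a (ones m)) = tpure (ulf_val a) (ones m).
Proof.
have u1 : act (u_ 1) (ones m) = 0.
  by rewrite act_uS act_u0 act_E_ones scaler0.
rewrite (phi_sum _ (homog_ones m) u1) big_ord1 act_u0.
by rewrite /= expr0 !mulr1.
Qed.

Lemma gamma_lin m : linear (@gamma R m).
Proof.
elim: m => [|m IH]; first exact: ulf_lin.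
by move=> c x y /=; rewrite (@phi_lin m) tmap_lin.
Qed.

Lemma gamma_ones m : gamma (ones m) = tpow_pure m (fun=> 1).
Proof.
elim: m => [//|m IH]; rewrite -[ones m.+1]/(tpure 1 (ones m)) /=.
rewrite phi_ones tmap_pure ?IH //; exact: gamma_lin.
Qed.

Lemma bDelta_iter_lin k : linear (@bDelta_iter R k).
Proof.
elim: k => [//|k IH] c x y /=.
by rewrite bDelta_lin tmap_lin.
Qed.

(** * Equivariant maps and their passage through phi *)

Section Equivariant.
Variables (m : nat) (beta : Ulf -> tpow Ulf m).

(** Compatibility with K is expressed through degrees, since phi needs the degree itself to evaluate
    its terms; commutation with E then gives commutation with every [u_ i]. *)
Definition equivariant : Prop :=
  [/\ linear beta,
      forall x, in4 x -> act E (beta x) = beta (adlf E x) &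
      [/\ homog 0 (beta Klf), homog (-1) (beta FKlf), homog 1 (beta Elf) &
          homog 0 (beta Dlf)]].

Hypothesis Hbeta : equivariant.

Lemma equivariant_u i x : in4 x -> act (u_ i) (beta x) = beta (adlf (u_ i) x).
Proof.
have [lb HE _] := Hbeta => hx; elim: i => [|i IH]; first by rewrite act_u0 adlf_u0.
rewrite act_uS IH HE; last exact: in4_u.
by rewrite -(linZ lb) adlf_uS.
Qed.

Lemma phi_equivariant a x : in4 x ->
  phi R m (tpure a (beta x)) = tmap id beta (phi R 0 (tpure a x)).
Proof.
have [lb _ [hK hFK hE hD]] := Hbeta.
have H N d y : in4 y -> homog d (beta y) -> homogU d (ulf_val y) ->
    adlf (u_ N) y = 0 ->
    phi R m (tpure a (beta y)) = tmap id beta (phi R 0 (tpure a y)).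
  move=> iy hy hy' y0.
  have by0 : act (u_ N) (beta y) = 0 by rewrite equivariant_u // y0 (lin0 lb).
  rewrite (phi_sum _ hy by0) (@phi_sum 0 N a d y hy' y0).
  rewrite (lin_sum (tmap_lin (@id_lin _ U) lb)); apply: eq_bigr => i _.
  by rewrite tmap_pure // equivariant_u.
apply: (in4_ext (f := fun y => phi R m (tpure a (beta y)))
  (g := fun y => tmap id beta (phi R 0 (tpure a y)))).
- by move=> c y z; rewrite lb tpureDr tpureZr phi_lin.
- by move=> c y z; rewrite tpureDr tpureZr (@phi_lin 0) tmap_lin.
- exact: (H _ _ _ InCasimirK hK homog_Klf u2_K).
- exact: (H _ _ _ InCasimirFK hFK homog_FK u3_FK).
- exact: (H _ _ _ InCasimirE hE homog_E u1_E).
- exact: (H _ _ _ InCasimirD hD homog_D u2_D).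
Qed.
End Equivariant.

Lemma equivariant_ones m :
  equivariant (m := m.+1) (fun x => tpure x (ones m)).
Proof.
split; first by move=> c x y; rewrite tpureDl tpureZl.
  move=> x _; rewrite act_E_pure act_K_ones act_E_ones tpure0r addr0 //.
split.
- exact: (homog_pure homog_Klf (homog_ones m)).
- exact: (homog_pure homog_FK (homog_ones m)).
- exact: (homog_pure homog_E (homog_ones m)).
- exact: (homog_pure homog_D (homog_ones m)).
Qed.

Lemma equivariant_id : equivariant (m := 0) id.
Proof.
split=> //; split.
- exact: homog_Klf.
- exact: homog_FK.
- exact: homog_E.
- exact: homog_D.
Qed.

Lemma equivariant_one m (beta : Ulf -> tpow Ulf m) : equivariant beta ->
  equivariant (m := m.+1) (fun x => tpure 1 (beta x)).
Proof.
move=> [lb HE [hK hFK hE hD]]; split.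
- by move=> c x y; rewrite lb tpureDr tpureZr.
- by move=> x hx; rewrite act_E_pure adE_1 tpure0l add0r HE.
split.
- exact: (homog_pure homog_1 hK).
- exact: (homog_pure homog_1 hFK).
- exact: (homog_pure homog_1 hE).
- exact: (homog_pure homog_1 hD).
Qed.

(** Expanding the action by Delta E = E (x) K + 1 (x) E, with K acting on a right factor of degree d
    by q^(2d), leaves one identity for each of the four entries. *)
Lemma bDelta_adE x : in4 x ->
  act (m := 1) E (bDelta R x) = bDelta R (adlf E x).
Proof.
have dE (a b : Ulf) d : homogU d (ulf_val b) -> act (m := 1) E (tpure a b) =
    qdeg d *: tpure (adlf E a) b + tpure a (adlf E b).
  move=> hb; rewrite act_E_pure -tpureZr; congr (tpure _ _ + _).
  exact: homog_adK.
have dK a := dE a _ _ homog_Klf; have dF a := dE a _ _ homog_FK.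
have dEE a := dE a _ _ homog_E; have dD a := dE a _ _ homog_D.
have La := linD (@act_linr 1 E); have Lz := linZ (@act_linr 1 E).
have Ba := linD bDelta_lin; have Bz := linZ bDelta_lin.
have Bn y : bDelta R (- y) = - bDelta R y by rewrite -scaleN1r Bz scaleN1r.
have q_0 : qdeg 0 = 1 by [].
have q_1 : qdeg 1 = q ^+ 2 by [].
have q_N1 : qdeg (-1) = q ^- 2 by [].
apply: (in4_ext (f := fun y => act (m := 1) E (bDelta R y))
  (g := fun y => bDelta R (adlf E y))).
- by move=> c y z; rewrite bDelta_lin (act_linr (m := 1)).
- by move=> c y z; rewrite adlf_linr bDelta_lin.
- rewrite bDelta_K !La !Lz dK dEE adE_K adE_E adE_FK Bz bDelta_E.
  move: Dlf => d'.
  rewrite !(tpureZl, tpureZr, tpureDl, tpureNl, tpure0r) q_0 q_1.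
  lin_eq.
- rewrite bDelta_FK !La dF dD adE_K adE_FK adE_D Bz Ba Bn bDelta_K bDelta_D.
  move: Dlf => d'.
  rewrite !(tpureZl, tpureZr, tpureDl, tpureDr, tpureNl, tpureNr) q_0 q_N1.
  lin_eq.
- rewrite bDelta_E !La dK dEE adE_E adE_K adE_D.
  rewrite (lin0 bDelta_lin).
  move: Dlf => d'.
  rewrite !(tpureZl, tpureZr, tpure0l, tpure0r) q_0 q_1.
  lin_eq.
- rewrite bDelta_D !La !Lz dF dD adE_E adE_FK adE_D Bz bDelta_E.
  move: Dlf => d'.
  rewrite !(tpureZl, tpureZr, tpureDr, tpureNr, tpure0l) q_0 q_N1.
  lin_eq.
Qed.

(* The tensor factors go to the positions p < c with s p and to position c, the
   remaining positions receiving 1; 0 is a junk value for sizes that disagree. *)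
Fixpoint insert (s : nat -> bool) (c m k : nat) : tpow Ulf k -> tpow Ulf m :=
  match c with
  | 0 => match k, m return tpow Ulf k -> tpow Ulf m with
    | 0, 0 => id
    | 0, m'.+1 => fun x => tpure x (ones m')
    | _, _ => fun=> 0
    end
  | c'.+1 => if s 0%N then
      match k, m return tpow Ulf k -> tpow Ulf m with
      | k'.+1, m'.+1 => tmap id (@insert (fun p => s p.+1) c' m' k')
      | _, _ => fun=> 0
      end
    else
      match m return tpow Ulf k -> tpow Ulf m with
      | m'.+1 => fun t => tpure 1 (insert (fun p => s p.+1) c' m' t)
      | _ => fun=> 0
      end
  end.

Fixpoint rank (s : nat -> bool) (c : nat) : nat :=
  if c is c'.+1 then s 0%N + rank (fun p => s p.+1) c' else 0.

Lemma insert_lin s c m k : linear (@insert s c m k).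
Proof.
elim: c s m k => [|c IH] s [|m] [|k] //= d x y;
  rewrite ?scaler0 ?addr0 // ?tpureDl ?tpureZl //; case: (s 0%N);
  rewrite ?scaler0 ?addr0 // ?(tmap_lin (@id_lin _ _) (IH _ _ _)) //.
- by rewrite IH tpureDr tpureZr.
- by rewrite IH tpureDr tpureZr.
Qed.

(** A tensor in [tpow Ulf k] has k + 1 factors: one for position c, occupied whatever [s c] is, and
    one for each p < c with [s p]; hence [k = rank s c]. *)
Lemma insert_pure s c m k f : k = rank s c -> (c <= m)%N ->
  @insert s c m k (tpow_pure k f) = tpow_pure m (fun p =>
    if (p < c)%N && s p || (p == c) then f (rank s p) else 1).
Proof.
elim: c s m k f => [|c IH] s m k f /= ek.
  by rewrite ek; case: m => [|m] //=.
case: m => [//|m] cm /=; case s0: (s 0%N) ek => /= ek.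
  rewrite ek add1n /= tmap_pure //; last exact: insert_lin.
  by rewrite (IH _ _ _ (fun j => f j.+1)).
by rewrite IH.
Qed.

(** Induction from the left. An empty position contributes a factor 1, fixed by K and killed by E;
    an occupied one contributes id (x) beta after bDelta, and equivariance passes from bDelta and
    beta to the composite. *)
Lemma insert_equivariant s c m k : k = rank s c -> (c <= m)%N ->
  equivariant (fun x => @insert s c m k (bDelta_iter k x)).
Proof.
elim: c s m k => [|c IH] s m k /= ek.
  rewrite ek; case: m => [|m] _; first exact: equivariant_id.
  exact: equivariant_ones.
case: m => [//|m] cm; case s0: (s 0%N) ek => /= ek; last first.
  exact: (equivariant_one (IH _ _ _ ek cm)).
rewrite ek add1n /=; set s' := fun p => s p.+1; set k' := rank s' c.
have Hb := IH s' m k' erefl cm; have [lb HE [hK hFK hE hD]] := Hb.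
have -> : (fun x =>
      tmap id (@insert s' c m k') (tmap id (@bDelta_iter R k') (bDelta R x))) =
    (fun x => tmap id (fun x => @insert s' c m k' (bDelta_iter k' x)) (bDelta R x)).
  apply: funext => x; rewrite tmap_comp //; first exact: bDelta_iter_lin.
  exact: insert_lin.
move: lb HE hK hFK hE hD {Hb}; set beta := (fun x => _) => lb HE hK hFK hE hD.
have lt : linear (tmap (@id Ulf) beta) by apply: tmap_lin.
split.
- by move=> d x y; rewrite bDelta_lin lt.
- move=> x hx; rewrite -(bDelta_adE hx).
  apply: (tens_in4_ext (f := fun y => act (m := m.+1) E (tmap id beta y))
    (g := fun y => tmap id beta (act (m := 1) E y))) (bDelta_in4 hx).
  + by move=> d y z; rewrite lt (act_linr (m := m.+1)).
  + by move=> d y z; rewrite (act_linr (m := 1)) lt.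
  move=> a y hy; rewrite tmap_pure // act_E_pure HE //.
  rewrite (act_E_pure (m := 0)) (linD lt) !tmap_pure //; congr (tpure _ _ + _).
  (* The summand E (x) K of Delta E requires beta to commute with K, which is read off from the
     degrees of its four values. *)
  apply: (in4_ext (f := fun y => act K (beta y)) (g := fun y => beta (adlf K y))) hy.
  + by move=> d u v; rewrite lb act_linr.
  + by move=> d u v; rewrite adlf_linr lb.
  + by rewrite (homog_K hK) (homog_adK homog_Klf) (linZ lb).
  + by rewrite (homog_K hFK) (homog_adK homog_FK) (linZ lb).
  + by rewrite (homog_K hE) (homog_adK homog_E) (linZ lb).
  + by rewrite (homog_K hD) (homog_adK homog_D) (linZ lb).
have hadd d (x y : tpow Ulf m.+1) : homog (m := m.+1) d x -> homog (m := m.+1) d y ->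
    homog (m := m.+1) d (x + y).
  by move=> hx hy; rewrite -[x]scale1r; exact: (@homog_lin m.+1 d 1 x y hx hy).
have hscal d e (x : tpow Ulf m.+1) :
    homog (m := m.+1) d x -> homog (m := m.+1) d (e *: x).
  move=> hx; have h0 := @homog_lin m.+1 d (-1) x x hx hx.
  rewrite scaleN1r addNr in h0.
  by rewrite -[_ *: _]addr0; exact: (@homog_lin m.+1 d e x 0 hx h0).
split.
- rewrite bDelta_K (linD lt) (linZ lt) !tmap_pure //.
  apply: hadd; first exact: (homog_pure homog_Klf hK).
  by apply: hscal; exact: (homog_pure homog_FK hE).
- rewrite bDelta_FK (linD lt) !tmap_pure //.
  apply: hadd; first exact: (homog_pure homog_Klf hFK).
  exact: (homog_pure homog_FK hD).
- rewrite bDelta_E (linD lt) !tmap_pure //.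
  apply: hadd; first exact: (homog_pure homog_E hK).
  exact: (homog_pure homog_D hE).
- rewrite bDelta_D (linD lt) (linZ lt) !tmap_pure //.
  apply: hadd; last exact: (homog_pure homog_D hD).
  by apply: hscal; exact: (homog_pure homog_E hFK).
Qed.

(* AW_comp splits off its last map alpha_c; here alpha_1 is split off instead, as
   in the recursion defining gamma. *)
Fixpoint AW_left (s : nat -> bool) (c : nat) : Ulf -> mixed R c :=
  match c with
  | 0 => id
  | c'.+1 => fun x => tmap id (AW_left (fun p => s p.+1) c')
      ((if s 0%N then Delta_lf R else tauL R) x)
  end.

Lemma AW_left_lin s c : linear (AW_left s c).
Proof.
elim: c s => [|c IH] s //= d x y.
by case: (s 0%N); rewrite linearP tmap_lin.
Qed.

Lemma pad_lin c m : linear (@pad R c m).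
Proof.
elim: c m => [|c IH] [|m] d x y /=; rewrite ?scaler0 ?addr0 //.
  by rewrite tpureDl tpureZl.
by rewrite tmap_lin.
Qed.

Lemma gamma_insert s c m k x : k = rank s c -> (c <= m)%N -> in4 x ->
  gamma (@insert s c m k (bDelta_iter k x)) = pad m (AW_left s c x).
Proof.
elim: c s m k x => [|c IH] s m k x /= ek.
  rewrite ek; case: m => [//|m] _ hx /=.
  (* Past the last occupied position only units remain, on which phi reduces to its term i = 0, d =
     0. *)
  by rewrite phi_ones tmap_pure ?gamma_ones //; exact: gamma_lin.
case: m => [//|m] cm hx; rewrite ltnS in cm.
have lg := @gamma_lin m; have lA := AW_left_lin (fun p => s p.+1) c.
have lp := @pad_lin c m.
(* Shared by both cases: the right factors of Delta x and tauL x stay in the span, so the induction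
   hypothesis applies to each pure tensor. *)
have key k' z : k' = rank (fun p => s p.+1) c -> tens_in4 z ->
    tmap id (@gamma R m)
      (tmap id (fun x => @insert (fun p => s p.+1) c m k' (bDelta_iter k' x)) z) =
    tmap id (@pad R c m) (tmap (@id U) (AW_left (fun p => s p.+1) c) z).
  move=> ek'; have [lb _ _] := insert_equivariant ek' cm.
  apply: (tens_in4_ext (f := fun z => tmap id (@gamma R m) (tmap id _ z))
    (g := fun z => tmap id (@pad R c m) (tmap id _ z))).
  - by move=> d y w; rewrite !tmap_lin.
  - by move=> d y w; rewrite !tmap_lin.
  by move=> a y hy; rewrite !tmap_pure // IH.
case s0: (s 0%N) ek => /= ek; last first.
  (* Empty position: phi (1 (x) beta x) equals (id (x) beta) applied to phi (1 (x) x), which is tauL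
     x. *)
  rewrite (phi_equivariant (insert_equivariant ek cm) 1 hx).
  by rewrite -[phi R 0 _]/(tau x) -(tau_eq hx) key //; apply: tauL_in4.
rewrite ek add1n /=; set k' := rank _ _.
have Hb := insert_equivariant (erefl k') cm; have [lb _ _] := Hb.
(* Occupied position: with beta inserting the remaining factors, phi is moved past id (x) beta onto
   bDelta x, where it gives Delta x. *)
rewrite -(key k' _ erefl (Delta_lf_in4 hx)) -(phi0_bDelta hx).
congr (tmap _ _ _); rewrite tmap_comp //; last first.
- exact: insert_lin.
- exact: bDelta_iter_lin.
apply: (tens_in4_ext (f := fun y => phi R m (tmap id _ y))
  (g := fun y => tmap id _ (phi R 0 y))) (bDelta_in4 hx).
- by move=> d y w; rewrite tmap_lin // (@phi_lin m).
- by move=> d y w; rewrite (@phi_lin 0) tmap_lin.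
by move=> a y hy; rewrite tmap_pure // (phi_equivariant Hb).
Qed.

Lemma on_last_lin (f : Ulf -> tens U Ulf) c : linear f -> linear (@on_last R f c).
Proof. by move=> lf; elim: c => [//|c IH]; exact: tmap_lin. Qed.

Lemma AW_left_rcons s c (x : Ulf) : AW_left s c.+1 x =
  @on_last R (if s c then Delta_lf R else tauL R) c (AW_left s c x).
Proof.
elim: c s x => [|c IH] s x.
  rewrite [LHS]/=; apply: (tens_lin_ext (f := tmap id id) (g := id)) => //.
    exact: tmap_lin.
  by move=> a b; rewrite tmap_pure.
set z := if s 0%N then Delta_lf R x else tauL R x.
have -> : AW_left s c.+2 x = tmap id (AW_left (fun p => s p.+1) c.+1)
    ((if s 0%N then Delta_lf R else tauL R) x) by [].
have la i : linear (if s i then Delta_lf R else tauL R).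
  by case: (s i); exact: linearP.
rewrite (tmap_ext (fun=> erefl) (IH (fun p => s p.+1))) /=.
by rewrite tmap_comp //; [exact: AW_left_lin|exact: on_last_lin].
Qed.

Lemma AW_comp_left A c (x : Ulf) :
  AW_comp A c x = AW_left (fun p => p.+1 \in A) c x.
Proof.
elim: c x => [//|c IH] x; rewrite AW_left_rcons -IH /= /AW_alpha.
by case: (c.+1 \in A).
Qed.

(** * Positions of the elements of A *)

Lemma rankE s c : rank s c = count s (iota 0 c).
Proof.
elim: c s => [//|c IH] s /=; rewrite IH; congr (_ + _)%N.
by rewrite (iotaDl 1) count_map.
Qed.

Lemma last_in (A : seq nat) : A <> [::] -> last 0%N A \in A.
Proof. by case: A => // a A _; exact: mem_last. Qed.

Lemma le_last_sorted (A : seq nat) :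
  sorted ltn A -> forall i, i \in A -> (i <= last 0%N A)%N.
Proof.
case: A => [//|a A] sA i iA; rewrite -(nth_index 0%N iA) -nth_last.
apply: (sorted_leq_nth leq_trans leqnn) => //.
- exact: (sub_sorted ltnW).
- by rewrite inE index_mem.
- by rewrite inE.
by rewrite -ltnS index_mem.
Qed.

Lemma index_rank n A p : sorted ltn A -> all (fun i => (1 <= i <= n)%N) A ->
  p.+1 \in A -> index p.+1 A = rank (fun i => i.+1 \in A) p.
Proof.
move=> sA bA pA.
(* A is the sublist of 1, ..., n cut out by membership, so the index of p + 1 counts the members
   among 1, ..., p. *)
have eA : A = [seq i <- iota 1 n | i \in A].
  apply: (irr_sorted_eq ltn_trans ltnn) => //.
    by apply: sorted_filter; [exact: ltn_trans|exact: iota_ltn_sorted].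
  move=> i; rewrite mem_filter mem_iota; case iA: (i \in A) => //=.
  by have := allP bA _ iA; rewrite add1n ltnS => ->.
have /andP[_ pn] := allP bA _ pA.
have en : n = (p + (n - p.+1).+1)%N by rewrite -addSnnS subnKC.
rewrite rankE [in LHS]eA {1}en iotaD filter_cat /= add1n pA index_cat.
rewrite mem_filter mem_iota add1n ltnn !andbF /= eqxx addn0 size_filter.
by rewrite (iotaDl 1 0) count_map.
Qed.

Lemma rank_last n A : A <> [::] -> sorted ltn A ->
  all (fun i => (1 <= i <= n)%N) A ->
  (size A).-1 = rank (fun i => i.+1 \in A) (last 0%N A).-1.
Proof.
case: A => [//|a A] _ sA bA.
have lA := mem_last a A.
have /andP[l0 _] := allP bA _ lA.
rewrite /= -(index_rank sA bA) prednK // index_last //.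
exact: (sorted_uniq ltn_trans ltnn).
Qed.

(** [insert] is linear and takes the values prescribed by [place_graph], which makes the graph
    consistent; pure tensors then determine the map. Positions pass from 1-based to 0-based, whence
    the predecessors of the last element and of n. *)
Lemma placeE n A t : A <> [::] -> sorted ltn A ->
  all (fun i => (1 <= i <= n)%N) A ->
  place R n A t =
  insert (fun p => p.+1 \in A) (last 0%N A).-1 n.-1 t.
Proof.
move=> A0 sA bA; pose s p := p.+1 \in A; pose c := (last 0%N A).-1.
rewrite -/s -/c.
have ek : (size A).-1 = rank s c by exact: (rank_last A0 sA bA).
have lA := last_in A0; have /andP[l1 ln] := allP bA _ lA.
have cn : (c <= n.-1)%N by rewrite /c -!subn1 leq_sub2r.
have sc : s c by rewrite /s /c prednK.
have maxA := le_last_sorted sA.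
have li := @insert_lin s c n.-1 (size A).-1.
have pureE f : insert s c n.-1 (tpow_pure (size A).-1 f) = tpow_pure n.-1
    (fun p => if p.+1 \in A then f (index p.+1 A) else 1) :> tpow Ulf n.-1.
  rewrite insert_pure //; apply: tpow_pure_ext => p pn.
  have [pA|pA] := boolP (p.+1 \in A).
    rewrite (index_rank sA bA pA); have := maxA _ pA.
    by rewrite /s pA andbT -(prednK l1) ltnS leq_eqVlt orbC => ->.
  rewrite /s (negPf pA) andbF /=; case: eqP => // pc; move: pA.
  by rewrite pc /c prednK // lA.
have graphE u v : @place_graph R n A u v -> insert s c n.-1 u = v.
  by move=> [f [-> ->]]; exact: pureE.
have lp : linear (place R n A) by exact: linearP.
apply: (tpow_pure_lin_ext lp li) => h; rewrite pureE.
apply: (lin_ofE (G := @place_graph R n A)) => [w H|]; last by exists h.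
rewrite -(lin0 li); elim: H => [|d u v u' v' /graphE <- _ ->].
  by rewrite (lin0 li).
by rewrite li.
Qed.

Lemma gamma_place n (A : seq nat) :
  A <> [::] -> sorted ltn A -> all (fun i => (1 <= i <= n)%N) A ->
  gamma (place R n A (bDelta_iter (size A).-1 Lambda)) = AW_gen R n A.
Proof.
move=> A0 sA bA; rewrite (placeE _ A0 sA bA) /AW_gen AW_comp_left.
have in4L : in4 Lambda.
  have -> : Lambda = q *: Dlf + q^-1 *: Klf.
    rewrite /Dlf.
    lin_eq.
  apply: InCasimirLin; first exact: InCasimirD.
  apply: in4_Z; exact: InCasimirK.
apply: gamma_insert => //; first exact: (rank_last A0 sA bA).
have /andP[_ ln] := allP bA _ (last_in A0).
by rewrite -!subn1 leq_sub2r.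
Qed.
End OverCq.

(* A is the increasing list (i_1, ..., i_k) of elements of {1, ..., n}. *)
Theorem theorem1p2 (R : realType) (n : nat) (A : seq nat) :
  (1 <= n)%N ->
  A <> [::] ->
  sorted ltn A ->
  all (fun i => (1 <= i <= n)%N) A ->
  gamma (place R n A (bDelta_iter (size A).-1 (Lambda R))) = AW_gen R n A.
Proof.
by move=> _; exact: gamma_place.
Qed.
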